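(* Let $\kappa\ge 5$. Any $\kappa$-doku tiling with $\tau$ tiles and $\rho$ runs satisfies \[ \max\left( \left\lceil \frac{3(\kappa^2-1)}{4}\right\rceil, \left\lceil \frac{\kappa\rho}{2}\right\rceil \right) \le \tau \le \left\lfloor \frac{(\kappa+1)\rho+3}{2}\right\rfloor. \]
   Context: A tile is a closed rhombus of unit side with interior angles $60^\circ$ and $120^\circ$, placed so that its edges lie on a fixed triangular lattice of the plane. Two tiles are adjacent if they share a full common edge. A run is a maximal sequence $T_1,\dots,T_k$ ($k\ge 2$) of distinct tiles such that $T_i$ and $T_{i+1}$ share an edge $e_i$, all the $e_i$ are parallel, and for $1<i<k$ the edges $e_{i-1},e_i$ are opposite edges of $T_i$. For an integer $\kappa\ge2$, a $\kappa$-doku tiling is a finite set of tiles such that: (P1) the adjacency graph on the tiles is connected; (P2) any two tiles are disjoint, meet in exactly one common vertex, or share a full common edge; (P3) after removing any single tile, the remaining tiles are still connected, where two tiles are considered joined if they have nonempty intersection; every run consists of exactly $\kappa$ tiles; and (no holes) the complement of the union of the tiles is connected. $\tau$ is the number of tiles and $\rho$ the number of runs. *)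

(* Defs.v *)
From HB Require Import structures.
From mathcomp Require Import all_boot all_order all_algebra finmap.
From mathcomp Require Import all_classical all_reals all_analysis.

Set Implicit Arguments.
Unset Strict Implicit.
Unset Printing Implicit Defensive.

Import Order.TTheory GRing.Theory Num.Theory.
Import numFieldNormedType.Exports.

Local Open Scope fset_scope.
Local Open Scope classical_set_scope.
Local Open Scope ring_scope.

(* The triangular lattice, in the basis of unit vectors at 0 and 60 degrees.  *)
Definition lattice : Type := (int * int)%type.

(* The three edge directions of the lattice, at 0, 60 and 120 degrees.        *)
Definition dir (k : 'I_3) : lattice :=
  match val k with
  | 0%N => (1, 0)
  | 1%N => (0, 1)
  | _ => (-1, 1)
  end.

(* (p, k) is the lattice edge from p to p + dir k.                            *)
Definition edge : Type := (lattice * 'I_3)%type.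

(* (p, k) is the rhombus with corner p spanned by the two directions other    *)
(* than k, namely k + 1 and k + 2 modulo 3. Any two of the directions make an *)
(* angle of 60 or 120 degrees, so these are all the unit rhombi of the        *)
(* lattice, each one given exactly once.                                      *)
Definition tile : Type := (lattice * 'I_3)%type.

Definition vertices (t : tile) : seq lattice :=
  let: (p, k) := t in
  [:: p; p + dir (k + 1); p + dir (k + 2); p + dir (k + 1) + dir (k + 2)].

Definition edges (t : tile) : seq edge :=
  let: (p, k) := t in
  [:: (p, k + 1); (p + dir (k + 2), k + 1);
      (p, k + 2); (p + dir (k + 1), k + 2)].

Definition parallel (e f : edge) : bool := e.2 == f.2.

Definition opposite (t : tile) (e f : edge) : bool :=
  [&& e \in edges t, f \in edges t, e != f & parallel e f].

Definition adjacent (s t : tile) : Prop :=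
  s != t /\ exists e : edge, e \in edges s /\ e \in edges t.

Definition pt (R : realType) (p : lattice) : R * R :=
  (p.1%:~R + p.2%:~R / 2, p.2%:~R * Num.sqrt 3 / 2).

Definition segment (R : realType) (e : edge) : set (R * R) :=
  [set z | exists x : R, 0 <= x <= 1 /\
     z = pt R e.1 + x *: pt R (dir e.2)].

Definition region (R : realType) (t : tile) : set (R * R) :=
  [set z | exists x y : R, [/\ 0 <= x <= 1, 0 <= y <= 1 &
     z = pt R t.1 + x *: pt R (dir (t.2 + 1)) + y *: pt R (dir (t.2 + 2))]].

Arguments segment : clear implicits.
Arguments region : clear implicits.

Definition meets (R : realType) (s t : tile) : Prop :=
  region R s `&` region R t !=set0.

Definition well_placed (R : realType) (s t : tile) : Prop :=
  [\/ region R s `&` region R t = set0,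
      exists v : lattice, [/\ v \in vertices s, v \in vertices t &
        region R s `&` region R t = [set pt R v]]
    | exists e : edge, [/\ e \in edges s, e \in edges t &
        region R s `&` region R t = segment R e]].

(* Graph connectivity; the empty graph does not count as connected.           *)
Definition graph_connected (r : tile -> tile -> Prop) (V : {fset tile}) : Prop :=
  V != fset0 /\
  forall s t : V, connect (fun x y : V => `[< r (val x) (val y) >]) s t.

Definition is_strip (T : {fset tile}) (s : seq tile) : Prop :=
  let t (i : nat) := nth (0, 0) s i in
  [/\ (2 <= size s)%N, uniq s, {subset s <= T} &
      exists e : nat -> edge,
      [/\ forall i : nat, (i.+1 < size s)%N ->
            e i \in edges (t i) /\ e i \in edges (t i.+1),
          forall i j : nat, (i.+1 < size s)%N -> (j.+1 < size s)%N ->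
            parallel (e i) (e j) &
          forall i : nat, (i.+2 < size s)%N ->
            opposite (t i.+1) (e i) (e i.+1)]].

Definition is_run (T : {fset tile}) (s : seq tile) : Prop :=
  is_strip T s /\
  forall s' : seq tile, is_strip T s' -> infix s s' -> s' = s.

(* A sequence and its reversal are the same run.                              *)
Definition runs (T : {fset tile}) : set (set (seq tile)) :=
  [set [set s; rev s] | s in [set s | is_run T s]].

Record doku_tiling (R : realType) (kappa : nat) (T : {fset tile}) : Prop := {
  doku_kappa : (2 <= kappa)%N;
  doku_adjacent_connected : graph_connected adjacent T;
  doku_well_placed : forall s t : tile, s \in T -> t \in T -> s != t ->
    well_placed R s t;
  doku_removal : forall t : tile, t \in T ->
    graph_connected (meets R) (T `\ t)%fset;
  doku_run_size : forall s : seq tile, is_run T s -> size s = kappa;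
  doku_no_holes : connected (~` \bigcup_(t in [set` T]) region R t)
}.

(* Main.v *)
(* For a direction d, every tile having edges of direction d lies in one strip of that direction,
   namely a run or a single tile; a tile that forms a strip on its own in some direction is a leaf.
   Each tile lies in two strips, so 2 tau = kappa rho + l, where l is the number of leaves.

   Because the union has no holes, a function on the edges with zero circulation around every tile
   is the coboundary of a potential on the vertices. Applied to the indicator of the edges of a
   strip, this shows that strips of different directions meet at most once, hence
   tau - l <= r0 r1 + r1 r2 + r2 r0 with r_d the number of runs of direction d; applied to the two
   edges of a leaf, together with (P3), it shows that an end of the leaf touches no other tile.
   Counting covered and uncovered sectors around the vertices then gives l <= rho + 3, which is the
   upper bound. The inequalities also give the lower bound except when kappa = 6 and the runs
   split as 3 + 2 + 2. Then the three parallel runs cross all the others and end in leaves, and the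
   potentials place these leaves on three consecutive collinear edges, which is impossible. *)
Require Import Defs.
From HB Require Import structures.
From mathcomp Require Import all_boot all_order all_algebra finmap.
From mathcomp Require Import all_classical all_reals all_analysis.
From mathcomp Require Import zify ring lra.
Set Implicit Arguments.
Unset Strict Implicit.
Unset Printing Implicit Defensive.
Import Order.TTheory GRing.Theory Num.Theory.
Import numFieldNormedType.Exports.
Local Open Scope fset_scope.
Local Open Scope classical_set_scope.
Local Open Scope ring_scope.

(** No boundary curve is constructed; arguments along a boundary are replaced by sums over triangles
    and vertices. A tile is a pair of lattice triangles glued along its short diagonal, and (P2)
    enters mainly as the fact that each triangle lies in at most one tile. An edge function is read
    as a flow across edges, so that circulation becomes divergence. The value on the diagonal of a
    tile can be chosen to balance both of its triangles. Divergence left at uncovered triangles is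
    led out of a large box through uncovered triangles only; the absence of holes makes this
    possible, and the values on tile edges stay untouched. In the sector count Euler's relation is
    used as V + tau <= E + 1. Each leaf contributes four units to it: three at the two vertices of
    its free end and one at the uncovered triangle facing that end. Positions in the exceptional
    case are computable because each edge lies in exactly one strip: up to a constant, a vertex is
    the sum over all strips of potential times direction. *)

(** * Lattice directions and the two triangles of a tile *)

Lemma I3P (P : 'I_3 -> Prop) : P 0 -> P 1 -> P 2 -> forall k, P k.
Proof.
move=> P0 P1 P2 [[|[|[|//]]] i].
- by have -> : Ordinal i = 0 by exact/val_inj.
- by have -> : Ordinal i = 1 by exact/val_inj.
- by have -> : Ordinal i = 2 by exact/val_inj.
Qed.

Lemma I3_01 : (0 + 1 : 'I_3) = 1. Proof. exact/val_inj. Qed.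
Lemma I3_02 : (0 + 2 : 'I_3) = 2. Proof. exact/val_inj. Qed.
Lemma I3_11 : (1 + 1 : 'I_3) = 2. Proof. exact/val_inj. Qed.
Lemma I3_12 : (1 + 2 : 'I_3) = 0. Proof. exact/val_inj. Qed.
Lemma I3_21 : (2 + 1 : 'I_3) = 0. Proof. exact/val_inj. Qed.
Lemma I3_22 : (2 + 2 : 'I_3) = 1. Proof. exact/val_inj. Qed.
Definition I3E := (I3_01, I3_02, I3_11, I3_12, I3_21, I3_22).

Lemma dir0 : dir 0 = (1, 0). Proof. by []. Qed.
Lemma dir1 : dir 1 = (0, 1). Proof. by []. Qed.
Lemma dir2 : dir 2 = (-1, 1). Proof. by []. Qed.

(** Across its side of direction [d], the triangle p, p + (1, 0), p + (0, 1) borders the triangle q,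
    q + (0, 1), q + (-1, 1) with q = p + [delta d]. That side starts at p + [mu d], which is q +
    [nu d]. *)
Definition delta (k : 'I_3) : lattice :=
  match val k with 0%N => (1, -1) | 1%N => (0, 0) | _ => (1, 0) end.
Lemma delta0 : delta 0 = (1, -1). Proof. by []. Qed.
Lemma delta1 : delta 1 = (0, 0). Proof. by []. Qed.
Lemma delta2 : delta 2 = (1, 0). Proof. by []. Qed.
Definition mu (k : 'I_3) : lattice := match val k with 2%N => (1, 0) | _ => (0, 0) end.
Lemma mu0 : mu 0 = (0, 0). Proof. by []. Qed.
Lemma mu1 : mu 1 = (0, 0). Proof. by []. Qed.
Lemma mu2 : mu 2 = (1, 0). Proof. by []. Qed.
Definition nu (k : 'I_3) : lattice := match val k with 0%N => (-1, 1) | _ => (0, 0) end.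
Lemma nu0 : nu 0 = (-1, 1). Proof. by []. Qed.
Lemma nu1 : nu 1 = (0, 0). Proof. by []. Qed.
Lemma nu2 : nu 2 = (0, 0). Proof. by []. Qed.
Definition tabE := (dir0, dir1, dir2, delta0, delta1, delta2, mu0, mu1, mu2, nu0, nu1, nu2).

Lemma addlE (x y z w : int) : ((x, y) : lattice) + (z, w) = (x + z, y + w). Proof. by []. Qed.
Lemma opplE (x y : int) : - ((x, y) : lattice) = (- x, - y). Proof. by []. Qed.
Definition latE := (I3E, tabE, opplE, addlE).

(** The short diagonal of a tile has direction [t.2] and cuts it into an upward triangle at [up t]
    and a downward one at [dn t]; [mktile] recovers the tile from the upward triangle. For
    [d != t.2], [uedge t d] and [dedge t d] are its two sides of direction [d]. *)
Definition up (t : tile) : lattice := t.1 + nu t.2.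
Definition dn (t : tile) : lattice := up t + delta t.2.
Definition mktile (x : lattice) (k : 'I_3) : tile := (x - nu k, k).
Definition uedge (t : tile) (d : 'I_3) : edge := (up t + mu d, d).
Definition dedge (t : tile) (d : 'I_3) : edge := (dn t + nu d, d).

Lemma up_mktile x k : up (mktile x k) = x. Proof. by rewrite /up /= subrK. Qed.
Lemma mktile_up t : mktile (up t) t.2 = t.
Proof. by case: t => p k; rewrite /mktile /up /= addrK. Qed.

Lemma I3eqE : ((0 == 1 :> 'I_3) = false) * ((0 == 2 :> 'I_3) = false) *
  ((1 == 0 :> 'I_3) = false) * ((1 == 2 :> 'I_3) = false) *
  ((2 == 0 :> 'I_3) = false) * ((2 == 1 :> 'I_3) = false).
Proof. by []. Qed.
Lemma lat_eqE (x y z w : int) : ((x, y) == (z, w) :> lattice) = (x == z) && (y == w).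
Proof. by []. Qed.
Lemma edge_eqE (p q : lattice) (k l : 'I_3) :
  ((p, k) == (q, l) :> edge) = (p == q) && (k == l).
Proof. by []. Qed.
Lemma tile_eqE (p q : lattice) (k l : 'I_3) :
  ((p, k) == (q, l) :> tile) = (p == q) && (k == l).
Proof. by []. Qed.

Ltac lat := rewrite ?latE ?edge_eqE ?tile_eqE ?lat_eqE ?eqxx ?I3eqE /=; try congr pair; lia.

Lemma mem_edges (t : tile) (e : edge) :
  (e \in edges t) = (e.2 != t.2) && ((e == uedge t e.2) || (e == dedge t e.2)).
Proof.
case: t => p k; case: e => q d; case: p => x y; case: q => z w.
elim/I3P: k; elim/I3P: d; rewrite /edges /uedge /dedge /dn /up /= !inE; lat.
Qed.

Lemma mem_vertices (t : tile) (v : lattice) :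
  (v \in vertices t) =
  [|| v == up t, v == up t + (1, 0), v == up t + (0, 1),
      v == dn t, v == dn t + (0, 1) | v == dn t + (-1, 1)].
Proof.
case: t => p k; case: p => x y; case: v => z w.
elim/I3P: k; rewrite /vertices /dn /up /= !inE; lat.
Qed.

(** * Lattice coordinates in the plane; regions of tiles as unions of two triangles *)

Section Geometry.
Variable R : realType.
Implicit Types (z : R * R) (p v : lattice) (t : tile).

(** [lu] and [lv] are the coordinates of a plane point in the basis [dir 0], [dir 1], inverse to
    [pt] on lattice points. *)
Definition lu z : R := z.1 - z.2 / Num.sqrt 3.
Definition lv z : R := 2 * z.2 / Num.sqrt 3.

Lemma sqrt3_neq0 : Num.sqrt 3 != 0 :> R.
Proof. by rewrite gt_eqF // sqrtr_gt0. Qed.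

Lemma luD z z' : lu (z + z') = lu z + lu z'.
Proof. by case: z z' => x y [x' y']; rewrite /lu /=; ring. Qed.
Lemma lvD z z' : lv (z + z') = lv z + lv z'.
Proof. by case: z z' => x y [x' y']; rewrite /lv /=; ring. Qed.
Lemma luZ (a : R) z : lu (a *: z) = a * lu z.
Proof. by case: z => x y; rewrite /lu /= /GRing.scale /=; ring. Qed.
Lemma lvZ (a : R) z : lv (a *: z) = a * lv z.
Proof. by case: z => x y; rewrite /lv /= /GRing.scale /=; ring. Qed.
Lemma lu_pt p : lu (pt R p) = p.1%:~R.
Proof. by rewrite /lu /pt /=; field; exact: sqrt3_neq0. Qed.
Lemma lv_pt p : lv (pt R p) = p.2%:~R.
Proof. by rewrite /lv /pt /=; field; exact: sqrt3_neq0. Qed.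
Lemma luv_inj z z' : lu z = lu z' -> lv z = lv z' -> z = z'.
Proof.
case: z z' => x y [x' y']; rewrite /lu /lv /= => e1 e2.
have s := sqrt3_neq0.
have ey : y = y'.
  have -> : y = (2 * y / Num.sqrt 3) * Num.sqrt 3 / 2 by field.
  by rewrite e2; field.
by congr pair => //; move: e1; rewrite ey; apply: addIr.
Qed.

Definition inU p z := (p.1%:~R <= lu z) && (p.2%:~R <= lv z) &&
  (lu z + lv z <= p.1%:~R + p.2%:~R + 1).
Definition inD p z := (lu z <= p.1%:~R) && (lv z <= p.2%:~R + 1) &&
  (p.1%:~R + p.2%:~R <= lu z + lv z).

Lemma region_tri t z : region R t z <-> inU (up t) z || inD (dn t) z.
Proof.
case: t => p k; case: p => x y; rewrite /region /=.
have luvE (d d' : lattice) (s r : R) :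
  z = pt R (x, y) + s *: pt R d + r *: pt R d' <->
  lu z = x%:~R + s * d.1%:~R + r * d'.1%:~R /\
  lv z = y%:~R + s * d.2%:~R + r * d'.2%:~R.
  split=> [->|[e1 e2]]; first by rewrite !luD !lvD !luZ !lvZ !lu_pt !lv_pt.
  by apply: luv_inj; rewrite ?luD ?lvD ?luZ ?lvZ ?lu_pt ?lv_pt.
rewrite /inU /inD /dn /up /=; move: luvE.
elim/I3P: k; rewrite ?latE /= => luvE; rewrite ?addr0 ?rmorphD ?rmorphN ?rmorphB /= ?rmorph0 ?rmorph1.
- split.
  + move=> [s [r [hs hr]]] /luvE[/=]; rewrite ?rmorphN ?rmorph0 ?rmorph1 => -> ->.
    by case: (lerP (s + r) 1) => h; apply/orP; [right|left]; lra.
  + move=> h; exists (lv z - y%:~R - (x%:~R - lu z)), (x%:~R - lu z).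
    split; [lra|lra|apply/luvE => /=; rewrite ?rmorphN ?rmorph0 ?rmorph1; split; ring].
- split.
  + move=> [s [r [hs hr]]] /luvE[/=]; rewrite ?rmorphN ?rmorph0 ?rmorph1 => -> ->.
    by case: (lerP s r) => h; apply/orP; [left|right]; lra.
  + move=> h; exists (lv z - y%:~R), (lu z - x%:~R + (lv z - y%:~R)).
    split; [lra|lra|apply/luvE => /=; rewrite ?rmorphN ?rmorph0 ?rmorph1; split; ring].
- split.
  + move=> [s [r [hs hr]]] /luvE[/=]; rewrite ?rmorphN ?rmorph0 ?rmorph1 => -> ->.
    by case: (lerP (s + r) 1) => h; apply/orP; [left|right]; lra.
  + move=> h; exists (lu z - x%:~R), (lv z - y%:~R).
    split; [lra|lra|apply/luvE => /=; rewrite ?rmorphN ?rmorph0 ?rmorph1; split; ring].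
Qed.

Lemma inU_pt p v : inU p (pt R v) =
  (p.1 <= v.1) && (p.2 <= v.2) && (v.1 + v.2 <= p.1 + p.2 + 1).
Proof.
by rewrite /inU lu_pt lv_pt !ler_int -!rmorphD /= -(rmorph1 (intmul 1)) -rmorphD ler_int.
Qed.
Lemma inD_pt p v : inD p (pt R v) =
  (v.1 <= p.1) && (v.2 <= p.2 + 1) && (p.1 + p.2 <= v.1 + v.2).
Proof.
by rewrite /inD lu_pt lv_pt !ler_int -!rmorphD /= -(rmorph1 (intmul 1)) -rmorphD !ler_int.
Qed.

Lemma pt_inj : injective (pt R).
Proof.
move=> [x y] [x' y'] e; congr pair; apply: (@intr_inj R).
  by rewrite -[LHS](lu_pt (x, y)) e lu_pt.
by rewrite -[LHS](lv_pt (x, y)) e lv_pt.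
Qed.

Lemma segment_pt (e : edge) v : segment R e (pt R v) -> v = e.1 \/ v = e.1 + dir e.2.
Proof.
case: e => p k; case: p => x y; case: v => a b [s [/= hs E]].
have E1 : a%:~R = x%:~R + s * (dir k).1%:~R :> R.
  by rewrite -(lu_pt (a, b)) E luD luZ !lu_pt.
have E2 : b%:~R = y%:~R + s * (dir k).2%:~R :> R.
  by rewrite -(lv_pt (a, b)) E lvD lvZ !lv_pt.
have key (n : int) : s = n%:~R -> n = 0 \/ n = 1.
  move=> sE; move: hs; rewrite sE ler0z -(rmorph1 (intmul 1)) ler_int; lia.
move: E1 E2; elim/I3P: k E => E; rewrite ?latE /= ?rmorphN ?rmorph1 ?rmorph0 ?mulr0 ?mulr1 ?mulrN ?mulr1 ?addr0 => E1 E2.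
- have : s = (a - x)%:~R by rewrite rmorphB /= E1; ring.
  move/key=> h; have {}E2 := @intr_inj R _ _ E2.
  by case: h => h; [left|right]; lat.
- have : s = (b - y)%:~R by rewrite rmorphB /= E2; ring.
  move/key=> h; have {}E1 := @intr_inj R _ _ E1.
  by case: h => h; [left|right]; lat.
- have sE : s = (b - y)%:~R by rewrite rmorphB /= E2; ring.
  have E3 : (a - x = y - b)%R.
    by apply: (@intr_inj R); rewrite !rmorphB /= E1 E2; ring.
  by case: (key _ sE) => h; [left|right]; lat.
Qed.

Lemma region_pt t v : region R t (pt R v) <-> v \in vertices t.
Proof.
apply: (iff_trans (region_tri t (pt R v))).
rewrite inU_pt inD_pt mem_vertices; case: (up t) => x y; case: (dn t) => x' y'; case: v => a b.
rewrite ?addlE ?lat_eqE /=; split; lia.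
Qed.
End Geometry.

(** * Proper placement: each triangle lies in at most one tile *)

Section Placement.
Variables (R : realType) (T : {fset tile}).
Hypothesis wp : forall s t : tile, s \in T -> t \in T -> s != t -> well_placed R s t.

Lemma meets_vertex (s t : tile) : s \in T -> t \in T -> Defs.meets R s t ->
  exists2 v, v \in vertices s & v \in vertices t.
Proof.
move=> sT tT [z [zs zt]]; have [->|/(wp sT tT)] := eqVneq s t.
  by exists (up t); rewrite mem_vertices eqxx.
case=> [h|[v [vs vt _]]|[e [es et h]]].
- by have : (region R s `&` region R t) z by []; rewrite h.
- by exists v.
- suff : (region R s `&` region R t) (pt R e.1) by case=> /region_pt ? /region_pt; exists e.1.
  by rewrite h; exists 0; rewrite lexx ler01 scale0r addr0.
Qed.

(** A single vertex or an edge contains at most two lattice points, so (P2) leaves no room for a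
    third common vertex of distinct tiles. *)
Lemma wp_three (s t : tile) (u v w : lattice) : s \in T -> t \in T ->
  u != v -> v != w -> u != w ->
  (forall x, x \in [:: u; v; w] -> x \in vertices s /\ x \in vertices t) -> s = t.
Proof.
move=> sT tT uv vw uw h; apply/eqP/negPn/negP => /(wp sT tT).
have I x : x \in [:: u; v; w] -> (region R s `&` region R t) (pt R x).
  by move=> /h[? ?]; split; apply/region_pt.
have [Iu Iv Iw] : [/\ (region R s `&` region R t) (pt R u),
    (region R s `&` region R t) (pt R v) & (region R s `&` region R t) (pt R w)].
  by split; apply: I; rewrite !inE eqxx ?orbT.
case=> [E|[x [_ _ E]]|[e [_ _ E]]]; move: Iu Iv Iw; rewrite E //.
- by move=> /pt_inj ux /pt_inj vx; move: uv; rewrite ux vx eqxx.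
- move=> /segment_pt a /segment_pt b /segment_pt c.
  by move: uv vw uw; case: a => ->; case: b => ->; case: c => ->; rewrite ?eqxx.
Qed.

(** The corners of the upward triangle would be three common vertices. This lemma and the next are
    the discrete form in which non-overlapping is used from here on. *)
Lemma up_inj_in : {in T &, injective up}.
Proof.
move=> s t sT tT e; apply: (@wp_three s t (up t) (up t + (1, 0)) (up t + (0, 1))) => //.
1-3: by case: (up t) => x y; lat.
move=> x; rewrite !inE !mem_vertices -e => h.
by split; apply/or3P; case/or3P: h => ->; rewrite ?e ?eqxx ?orbT; by [left|right|constructor].
Qed.

Lemma dn_inj_in : {in T &, injective dn}.
Proof.
move=> s t sT tT e; apply: (@wp_three s t (dn t) (dn t + (0, 1)) (dn t + (-1, 1))) => //.
1-3: by case: (dn t) => x y; lat.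
by move=> x; rewrite !inE !mem_vertices -e => /or3P[]/eqP->; rewrite ?e ?eqxx ?orbT.
Qed.
End Placement.

(** * Sets of triangles that can be left only into covered triangles *)

Definition box (M : nat) : {fset lattice} :=
  seq_fset tt [seq (Posz i - Posz M, Posz j - Posz M) | i <- iota 0 (2 * M).+1, j <- iota 0 (2 * M).+1].

Lemma in_box M (p : lattice) : (p \in box M) = (`|p.1|%N <= M)%N && (`|p.2|%N <= M)%N.
Proof.
rewrite /box seq_fsetE; apply/allpairsP/idP => [[[i j] [hi hj ->]]|h].
  by move: hi hj; rewrite !mem_iota /=; lia.
case: p h => x y h; exists (absz (x + Posz M), absz (y + Posz M)).
have key (u : int) : (absz u <= M)%N ->
    (absz (u + Posz M)%R < (2 * M).+1)%N /\ u = Posz (absz (u + Posz M)) - Posz M by lia.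
have /andP[/key[hx ex] /key[hy ey]] := h.
by split; [rewrite mem_iota|rewrite mem_iota|congr pair].
Qed.

Lemma box_bound (s : seq lattice) : exists M, {subset s <= box M}.
Proof.
elim: s => [|p s [M h]]; first by exists 0%N.
exists (M + `|p.1| + `|p.2|)%N => q; rewrite inE in_box => /predU1P[->|/h]; rewrite ?in_box; lia.
Qed.

(* [(true, p)] is the triangle p, p + a, p + b and [(false, p)] the triangle p, p + b, p + c,
   where a, b, c are the directions at 0, 60 and 120 degrees. *)
Definition tri : Type := (bool * lattice)%type.

Definition covered (T : {fset tile}) (x : tri) : bool :=
  x.2 \in (if x.1 then [fset up t | t in T] else [fset dn t | t in T]).

(** Only passages across an edge are mentioned: around a lattice point of the complement all six
    triangles are uncovered, and they are linked through edges. *)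
Definition sealed (T : {fset tile}) (S : {fset tri}) : Prop := forall p d,
  ((true, p) \in S -> covered T (false, p + delta d) \/ (false, p + delta d) \in S) /\
  ((false, p + delta d) \in S -> covered T (true, p) \/ (true, p) \in S).

Section Hole.
Variables (R : realType) (T : {fset tile}).
Definition intri (x : tri) (z : R * R) := if x.1 then inU x.2 z else inD x.2 z.
Let C := ~` \bigcup_(t in [set` T]) region R t.

Lemma uncovered_intri x z : C z -> intri x z -> ~~ covered T x.
Proof.
move=> Cz xz; apply/negP; rewrite /covered; case: x xz => -[] p /= pz /imfsetP[t /= tT pE];
  apply: Cz; exists t => //; apply/region_tri; move: pz; rewrite /intri /= pE => ->; rewrite ?orbT //.
Qed.

(** Half-open cells choose one reference triangle for every point, to which the other triangles
    through the point are compared. *)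
Definition base_tri (z : R * R) : tri :=
  let i := Num.floor (lu z) in let j := Num.floor (lv z) in
  if (lu z - i%:~R) + (lv z - j%:~R) < 1 then (true, (i, j)) else (false, (i + 1, j)).

Lemma base_triE z (i j : int) : i%:~R <= lu z -> lu z < i%:~R + 1 -> j%:~R <= lv z ->
  lv z < j%:~R + 1 ->
  base_tri z = if lu z + lv z < i%:~R + j%:~R + 1 then (true, (i, j)) else (false, (i + 1, j)).
Proof.
move=> h1 h2 h3 h4; rewrite /base_tri.
have -> : Num.floor (lu z) = i by apply: floor_def; rewrite h1 rmorphD.
have -> : Num.floor (lv z) = j by apply: floor_def; rewrite h3 rmorphD.
by congr (if _ then _ else _); apply/idP/idP; lra.
Qed.

Lemma intri_base z : intri (base_tri z) z.
Proof.
rewrite /base_tri; set i := Num.floor _; set j := Num.floor _.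
have /andP[h1 h2] := floor_itv (lu z); have /andP[h3 h4] := floor_itv (lv z).
rewrite -/i -/j !rmorphD /= in h1 h2 h3 h4.
by case: ifPn; rewrite /intri /= /inU /inD /= ?rmorphD /=; lra.
Qed.

Section Link.
Variable S : {fset tri}.
Hypothesis sS : sealed T S.

Lemma sealed_step z p d : C z -> intri (true, p) z -> intri (false, p + delta d) z ->
  ((true, p) \in S) = ((false, p + delta d) \in S).
Proof.
move=> Cz h1 h2; have [s1 s2] := sS p d.
have n1 := uncovered_intri Cz h1; have n2 := uncovered_intri Cz h2.
apply/idP/idP => [/s1|/s2]; by case=> // c; rewrite c in n1 n2.
Qed.

(** All triangles through a point of the complement are uncovered and linked across edges through
    that point, so [S] contains all of them or none. The cases are the positions of [z] in which
    [base_tri] may pick a different triangle. *)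
Lemma sealed_link z x : C z -> intri x z -> (x \in S) = (base_tri z \in S).
Proof.
move=> Cz; case: x => -[] [x y]; rewrite /intri /= => h.
- have [h1 [h2 h3]] : x%:~R <= lu z /\ y%:~R <= lv z /\ lu z + lv z <= x%:~R + y%:~R + 1.
    by move: h; rewrite /inU /=; lra.
  have st p d := @sealed_step z p d Cz.
  have e2 := st (x, y) 2; have e1 := st (x + 1, y) 1; have e0 := st (x, y + 1) 0.
  rewrite /intri /= /inU /inD ?latE /= ?addr0 ?subrr ?addrK ?rmorphD ?rmorphB /= in e0 e1 e2.
  have [l1|l1] := ltrP (lu z) (x%:~R + 1); have [l2|l2] := ltrP (lv z) (y%:~R + 1).
  + rewrite (@base_triE z x y) //; case: ifPn => // l3; rewrite e2 ?rmorph0 ?rmorph1 //; lra.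
  + rewrite (@base_triE z x (y + 1)) ?rmorphD //=; try lra.
    rewrite ifT; last lra.
    rewrite e2 ?e0 ?rmorph0 ?rmorph1 //; lra.
  + rewrite (@base_triE z (x + 1) y) ?rmorphD //=; try lra.
    rewrite ifT; last lra.
    rewrite e2 ?e1 ?rmorph0 ?rmorph1 //; lra.
  + exfalso; lra.
- have [h1 [h2 h3]] : lu z <= x%:~R /\ lv z <= y%:~R + 1 /\ x%:~R + y%:~R <= lu z + lv z.
    by move: h; rewrite /inD /=; lra.
  have st p d := @sealed_step z p d Cz.
  have e1 := st (x, y) 1; have e0 := st (x - 1, y + 1) 0; have e2 := st (x, y) 2.
  have e0' := st (x, y + 1) 0.
  rewrite /intri /= /inU /inD ?latE /= ?addr0 ?subrr ?addrK ?subrK ?rmorphD ?rmorphB /= in e0 e1 e2 e0'.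
  have [l1|l1] := ltrP (lu z) x%:~R; have [l2|l2] := ltrP (lv z) (y%:~R + 1).
  + rewrite (@base_triE z (x - 1) y) ?rmorphB //=; try lra.
    by rewrite ifF ?subrK //; lra.
  + rewrite (@base_triE z (x - 1) (y + 1)) ?rmorphB ?rmorphD //=; try lra.
    rewrite ifT; last lra.
    by rewrite e0 ?rmorph0 ?rmorph1 //; lra.
  + rewrite (@base_triE z x y) //=; try lra.
    rewrite ifT; last lra.
    by rewrite e1 ?rmorph0 ?rmorph1 //; lra.
  + rewrite (@base_triE z x (y + 1)) ?rmorphD //=; try lra.
    rewrite ifT; last lra.
    rewrite -e1 ?e2 ?e0' ?rmorph0 ?rmorph1 //; lra.
Qed.
End Link.
End Hole.

(** * Absence of holes in terms of triangles *)

Section Topology.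
Variables (R : realType) (T : {fset tile}).
Let C := ~` \bigcup_(t in [set` T]) region R t.

Lemma continuous_lu : continuous (@lu R).
Proof.
move=> z; rewrite /lu; apply: cvgB; first exact: cvg_fst.
by apply: cvgMr_tmp; exact: cvg_snd.
Qed.
Lemma continuous_lv : continuous (@lv R).
Proof.
move=> z; rewrite /lv; apply: cvgMr_tmp; apply: cvgMl_tmp; exact: cvg_snd.
Qed.
Lemma continuous_luv : continuous (fun z => @lu R z + lv z).
Proof. by move=> z; apply: cvgD; [exact: continuous_lu|exact: continuous_lv]. Qed.

Lemma closed_ge_fun (f : R * R -> R) c : continuous f -> closed [set z | c <= f z].
Proof. by move=> cf; apply: (@preimage_closed _ _ f [set u | c <= u]) => [z _|]; [exact: cf|exact: closed_ge]. Qed.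
Lemma closed_le_fun (f : R * R -> R) c : continuous f -> closed [set z | f z <= c].
Proof. by move=> cf; apply: (@preimage_closed _ _ f [set u | u <= c]) => [z _|]; [exact: cf|exact: closed_le]. Qed.

Lemma closed_intri x : closed [set z | @intri R x z].
Proof.
case: x => -[] p; rewrite /intri /= /inU /inD.
- have -> : [set z : R * R | (p.1%:~R <= lu z) && (p.2%:~R <= lv z) &&
     (lu z + lv z <= p.1%:~R + p.2%:~R + 1)] =
     [set z | p.1%:~R <= lu z] `&` [set z | p.2%:~R <= lv z] `&`
     [set z | lu z + lv z <= p.1%:~R + p.2%:~R + 1].
    by apply/seteqP; split=> z /= => [/andP[/andP[]]|[[-> ->] ->]].
  apply: closedI; last exact: (closed_le_fun continuous_luv).
  apply: closedI; [exact: (closed_ge_fun continuous_lu)|exact: (closed_ge_fun continuous_lv)].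
- have -> : [set z : R * R | (lu z <= p.1%:~R) && (lv z <= p.2%:~R + 1) &&
     (p.1%:~R + p.2%:~R <= lu z + lv z)] =
     [set z | lu z <= p.1%:~R] `&` [set z | lv z <= p.2%:~R + 1] `&`
     [set z | p.1%:~R + p.2%:~R <= lu z + lv z].
    by apply/seteqP; split=> z /= => [/andP[/andP[]]|[[-> ->] ->]].
  apply: closedI; last exact: (closed_ge_fun continuous_luv).
  apply: closedI; [exact: (closed_le_fun continuous_lu)|exact: (closed_le_fun continuous_lv)].
Qed.

Lemma closed_tris (s : seq tri) : closed [set z | exists2 x, x \in s & @intri R x z].
Proof.
elim: s => [|x s IH].
  by rewrite (_ : [set _ | _] = set0) ?seteqP; [exact: closed0|split=> z // []].
rewrite (_ : [set _ | _] = [set z | intri x z] `|` [set z | exists2 x, x \in s & intri x z]).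
  by apply: closedU => //; exact: closed_intri.
apply/seteqP; split=> z /=.
  by move=> [y]; rewrite inE => /predU1P[->|ys] yz; [left|right; exists y].
by case=> [xz|[y ys yz]]; [exists x|exists y]; rewrite ?inE ?eqxx ?ys ?orbT.
Qed.

Lemma int_le_add (m n : int) (r : R) : r < 1 -> m%:~R <= n%:~R + r -> m <= n.
Proof.
move=> r1 h; rewrite leNgt; apply/negP => nm.
have : (n + 1)%:~R <= m%:~R :> R by rewrite ler_int; lia.
by rewrite rmorphD /= => h'; lra.
Qed.

(** The centroid, used as a point that lies in this triangle only. *)
Definition center (x : tri) : R * R :=
  pt R x.2 + (if x.1 then 3^-1 *: pt R (1, 1) else 3^-1 *: pt R (-1, 2)).

Lemma lu_center x : lu (center x) = x.2.1%:~R + (if x.1 then 3^-1 else - 3^-1).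
Proof. by case: x => -[] p; rewrite /center luD luZ !lu_pt /= ?rmorphN /= ?rmorph1 ?mulrN mulr1. Qed.
Lemma lv_center x : lv (center x) = x.2.2%:~R + (if x.1 then 3^-1 else 2 / 3).
Proof. by case: x => -[] p; rewrite /center lvD lvZ !lv_pt /= ?rmorph1 ?mulr1 //; congr (_ + _); ring. Qed.

Lemma intri_center x y : intri y (center x) = (y == x).
Proof.
apply/idP/eqP => [|->].
  rewrite /intri /inU /inD lu_center lv_center.
  case: x => b [i j]; case: y => b' [i' j'] /=; case: b; case: b' => /= /andP[/andP[h1 h2] h3].
  - have a1 : i' <= i by apply: (@int_le_add _ _ 3^-1); lra.
    have a2 : j' <= j by apply: (@int_le_add _ _ 3^-1); lra.
    have a3 : i + j <= i' + j' by apply: (@int_le_add _ _ 3^-1); rewrite ?rmorphD /=; lra.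
    by congr (_, (_, _)); lia.
  - exfalso.
    have a1 : i + 1 <= i' by apply: (@int_le_add _ _ (2/3)); rewrite ?rmorphD /=; lra.
    have a2 : j <= j' by apply: (@int_le_add _ _ (2/3)); lra.
    have a3 : i' + j' <= i + j by apply: (@int_le_add _ _ (2/3)); rewrite ?rmorphD /=; lra.
    lia.
  - exfalso.
    have a1 : i' + 1 <= i by apply: (@int_le_add _ _ (2/3)); rewrite ?rmorphD /=; lra.
    have a2 : j' <= j by apply: (@int_le_add _ _ (2/3)); lra.
    have a3 : i + j <= i' + j' by apply: (@int_le_add _ _ (2/3)); rewrite ?rmorphD /=; lra.
    lia.
  - have a1 : i <= i' by apply: (@int_le_add _ _ (1/2)); lra.
    have a2 : j <= j' by apply: (@int_le_add _ _ (1/2)); lra.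
    have a3 : i' + j' <= i + j by apply: (@int_le_add _ _ (1/2)); rewrite ?rmorphD /=; lra.
    by congr (_, (_, _)); lia.
rewrite /intri /inU /inD lu_center lv_center; case: x => -[] p /=; lra.
Qed.

Lemma center_out x : ~~ covered T x -> C (center x).
Proof.
move=> nx [t /= tT /region_tri].
have := intri_center x (true, up t); have := intri_center x (false, dn t).
rewrite /intri /= => -> -> /orP[]/eqP xE; move: nx; rewrite -xE /covered /= => /negP; apply;
  by apply/imfsetP; exists t.
Qed.

(** Within the complement, the union of [S] is closed, and it is also open because it is cut out by
    removing finitely many other triangles from an open box. Connectedness would make it the whole
    complement, although a remote triangle is missed. *)
Lemma no_hole (S : {fset tri}) : connected C -> sealed T S ->
  (forall x, x \in S -> ~~ covered T x) -> S = fset0.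
Proof.
move=> cC sS uS; apply/eqP/negPn/negP => /fset0Pn[x0 x0S].
have [M hM] := box_bound ([seq x.2 | x <- enum_fset S] ++
  [seq up t | t <- enum_fset T] ++ [seq dn t | t <- enum_fset T]).
have MS x : x \in S -> x.2 \in box M.
  by move=> xS; apply: hM; rewrite !mem_cat map_f.
(* An upward triangle outside the box that holds [S] and all tiles. *)
pose far : tri := (true, (Posz M + 5, 0)).
have nfar : ~~ covered T far.
  apply/negP; rewrite /covered /= => /imfsetP[t /= tT E].
  have : up t \in box M by apply: hM; rewrite !mem_cat [in X in _ || X]map_f ?orbT.
  by rewrite -E in_box /=; lia.
have farS : far \notin S by apply/negP => /MS; rewrite in_box /=; lia.
(* [N] lists the triangles near [S] but not in it. [O] is large enough to contain every triangle of
   [S], and small enough that the base triangle of each of its points has its corner in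
   [box (M + 9)]. *)
pose N := [seq x <- [seq (b, p) | b <- [:: true; false], p <- enum_fset (box (M + 9))] | x \notin S].
pose In (s : seq tri) := [set z | exists2 x, x \in s & @intri R x z].
pose O := [set z : R * R | [/\ - (M%:R + 5) < lu z, lu z < M%:R + 5, - (M%:R + 5) < lv z & lv z < M%:R + 5]].
have openO : open O.
  have -> : O = ([set z | - (M%:R + 5) < lu z] `&` [set z | lu z < M%:R + 5]) `&`
     ([set z | - (M%:R + 5) < lv z] `&` [set z | lv z < M%:R + 5]).
    by apply/seteqP; split=> z /=; [case=> *; do !split|case=> -[? ?] [? ?]; split].
  have oc (f : R * R -> R) (c : R) : continuous f -> open [set z : R * R | c < f z] /\ open [set z : R * R | f z < c].
    move=> cf; split.
      by apply: (@open_comp _ _ f [set u | c < u]) => // z _; exact: cf.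
    by apply: (@open_comp _ _ f [set u | u < c]) => // z _; exact: cf.
  by do !apply: openI; apply oc; first [exact: continuous_lu | exact: continuous_lv].
have SO z x : x \in S -> intri x z -> O z.
  move=> /MS; rewrite in_box; case: x => b [i j] /= /andP[hi hj] xz.
  have [i1 i2] : - M%:R <= i%:~R :> R /\ i%:~R <= M%:R :> R.
    by split; rewrite -[M%:R]/((Posz M)%:~R) -?rmorphN ler_int; lia.
  have [j1 j2] : - M%:R <= j%:~R :> R /\ j%:~R <= M%:R :> R.
    by split; rewrite -[M%:R]/((Posz M)%:~R) -?rmorphN ler_int; lia.
  by move: xz; rewrite /intri /inU /inD; case: b => /= h; split; lra.
have BE : C `&` In (enum_fset S) = C `&` (O `&` ~` In N).
  apply/seteqP; split=> z /= [Cz].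
    move=> [x xS xz]; split => //; split; first exact: SO xS xz.
    move=> [y]; rewrite mem_filter => /andP[yS _] yz; move: yS.
    by rewrite (sealed_link sS Cz yz) -(sealed_link sS Cz xz) xS.
  move=> [Oz nz]; split => //; exists (base_tri z); last exact: intri_base.
  apply/negPn/negP => nS; apply: nz; exists (base_tri z); last exact: intri_base.
  rewrite mem_filter nS andTb.
  have : (base_tri z).2 \in box (M + 9).
    have := intri_base z; case: (base_tri z) => b [i j]; case: Oz => o1 o2 o3 o4.
    have ME : (M + 9)%:R = M%:R + 9 :> R by rewrite natrD.
    rewrite in_box /= /intri /inU /inD => h.
    have k (u : int) : - (M%:R + 9) <= u%:~R :> R -> u%:~R <= M%:R + 9 :> R -> (absz u <= M + 9)%N.
      rewrite -ME -[(M + 9)%:R]/((Posz (M + 9))%:~R) -rmorphN !ler_int; lia.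
    by case: b h => /= h; apply/andP; split; apply: k; lra.
  case: (base_tri z) => b p pb; apply/allpairsP; exists (b, p); split => //=.
  by case: (b); rewrite !inE.
have : C `&` In (enum_fset S) = C.
  apply: cC.
  - by exists (center x0); split; [exact/center_out/uS|exists x0 => //; rewrite intri_center].
  - exists (O `&` ~` In N) => //; apply: openI => //; apply: closed_openC; exact: closed_tris.
  - by exists (In (enum_fset S)) => //; exact: closed_tris.
move/seteqP => -[_ /(_ (center far) (center_out nfar))] [_ [x xS]].
by rewrite intri_center => /eqP xf; move: farS; rewrite -xf xS.
Qed.
End Topology.

(** * Flows between triangles and discrete integration *)

Lemma sum3 (V : zmodType) (F : 'I_3 -> V) : \sum_d F d = F 0 + F 1 + F 2.
Proof.
rewrite !big_ord_recl big_ord0 addr0 addrA; congr (F _ + F _ + F _); exact/val_inj.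
Qed.

Definition flow := lattice -> 'I_3 -> int.
(* [f p d] is the flow from the triangle [(true, p)] to [(false, p + delta d)]. *)
Definition div (f : flow) (x : tri) : int :=
  if x.1 then \sum_d f x.2 d else - \sum_d f (x.2 - delta d) d.

Lemma div_sum (I : Type) (s : seq I) (f : I -> flow) (a : I -> int) x :
  div (fun p d => \sum_(i <- s) a i * f i p d) x = \sum_(i <- s) a i * div (f i) x.
Proof.
rewrite /div; case: x.1; rewrite exchange_big /= -?sumrN; apply: eq_bigr => i _.
  by rewrite mulr_sumr.
by rewrite mulrN mulr_sumr.
Qed.
Lemma divB (f g : flow) x : div (fun p d => f p d - g p d) x = div f x - div g x.
Proof. by rewrite /div; case: x.1; rewrite sumrB // opprB opprK addrC. Qed.
Lemma divD (f g : flow) x : div (fun p d => f p d + g p d) x = div f x + div g x.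
Proof. by rewrite /div; case: x.1; rewrite big_split //= opprD. Qed.
Definition unit_flow (q : lattice) (e : 'I_3) : flow := fun p d => ((p == q) && (d == e))%:Z.

Lemma div_unit q e x :
  div (unit_flow q e) x = (x == (true, q))%:Z - (x == (false, q + delta e))%:Z.
Proof.
case: x => -[] p; rewrite /div /= /unit_flow.
  rewrite (bigD1 e) //= eqxx andbT big1 => [|d /negPf->]; last by rewrite andbF.
  by rewrite xpair_eqE eqxx andTb; case: (p == q).
rewrite (bigD1 e) //= eqxx andbT big1 => [|d /negPf->]; last by rewrite andbF.
by rewrite xpair_eqE eqxx andTb subr_eq; case: (p == _).
Qed.

Section Escape.
Variables (R : realType) (T : {fset tile}).
Hypothesis nh : connected (~` \bigcup_(t in [set` T]) region R t).

(** One unit of flow leaves [x] and exits the box through uncovered triangles. Divergence is not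
    prescribed outside of the box, so the exit needs no description. *)
Definition drains (M : nat) (x : tri) (f : flow) : Prop :=
  (forall p d, f p d != 0 -> ~~ covered T (true, p) && ~~ covered T (false, p + delta d)) /\
  (forall y : tri, y.2 \in box M -> div f y = (y == x)%:Z).

(** A drain of one triangle gives a drain of an uncovered neighbour after one unit is added across
    their common edge. Hence the uncovered triangles without a drain form a sealed set; it is
    finite, and [no_hole] empties it. *)
Lemma drain_ex M x : ~~ covered T x -> exists f, drains M x f.
Proof.
pose good y := `[< exists f, drains M y f >].
(* Outside of the box the zero flow is a drain, so every triangle without one lies in the box. *)
have far y : y.2 \notin box M -> good y.
  move=> yM; apply/asboolP; exists (fun _ _ => 0); split=> [p d|z zM]; first by rewrite eqxx.
  rewrite /div big1 // oppr0 if_same; case: eqP => // zy; by rewrite zy (negPf yM) in zM.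
have step1 p d : ~~ covered T (true, p) -> ~~ covered T (false, p + delta d) ->
    good (false, p + delta d) -> good (true, p).
  move=> c1 c2 /asboolP[f [f1 f2]]; apply/asboolP.
  exists (fun q e => f q e + unit_flow p d q e); split=> [q e|y yM].
    have [fz|/f1 //] := eqVneq (f q e) 0; rewrite fz add0r /unit_flow.
    by case: andP => // -[/eqP-> /eqP->]; rewrite c1 c2.
  by rewrite divD f2 // div_unit addrC subrK.
have step2 p d : ~~ covered T (true, p) -> ~~ covered T (false, p + delta d) ->
    good (true, p) -> good (false, p + delta d).
  move=> c1 c2 /asboolP[f [f1 f2]]; apply/asboolP.
  exists (fun q e => f q e - unit_flow p d q e); split=> [q e|y yM].
    have [fz|/f1 //] := eqVneq (f q e) 0; rewrite fz sub0r oppr_eq0 /unit_flow.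
    by case: andP => // -[/eqP-> /eqP->]; rewrite c1 c2.
  by rewrite divB f2 // div_unit opprB addrC subrK.
pose S : {fset tri} := seq_fset tt
  [seq y <- [seq (b, p) | b <- [:: true; false], p <- enum_fset (box M)] | ~~ covered T y & ~~ good y].
have inS y : (y \in S) = ~~ covered T y && ~~ good y.
  rewrite seq_fsetE mem_filter; case: (boolP (~~ covered T y && ~~ good y)) => // /andP[_ ng].
  rewrite andTb.
  case: y ng => b p ng; apply/allpairsP; exists (b, p); split => //=.
    by case: (b); rewrite !inE.
  by apply/negPn/negP => nb; move: ng; rewrite (far (b, p) nb).
have S0 : S = fset0.
  apply: (no_hole nh) => [p d|y]; last by rewrite inS => /andP[].
  rewrite !inS; split=> /andP[c1 ng]; case: (boolP (covered T _)) => c2; [by left|right|by left|right];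
    apply/negP => g; move/negP: ng; apply; [exact: step1 g|exact: step2 g].
move=> cx; suff /asboolP : good x by [].
by apply/negPn/negP => ng; have := inS x; rewrite S0 inE cx ng.
Qed.
End Escape.

(** Going around a triangle in a suitable sense traverses its sides of directions 0 and 2 forwards
    and the one of direction 1 backwards. With these signs divergence at a triangle is, up to sign,
    circulation of [cochain_of w] around it. *)
Definition sg (d : 'I_3) : int := if d == 1 then -1 else 1.
Lemma sg_sqr d : sg d * sg d = 1. Proof. by rewrite /sg; case: ifP. Qed.

Definition cochain_of (w : flow) (e : edge) : int := sg e.2 * w (e.1 - mu e.2) e.2.

(** A discrete Poincare lemma on a box. *)
Lemma integrate (M : nat) (w : flow) : (forall y : tri, y.2 \in box M.+1 -> div w y = 0) ->
  exists h : lattice -> int, forall e : edge,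
    e.1 \in box M -> h (e.1 + dir e.2) - h e.1 = cochain_of w e.
Proof.
move=> hw; pose c x y (k : 'I_3) := cochain_of w ((x, y), k).
have wc x y k : w (x, y) k = sg k * c (x + (mu k).1) (y + (mu k).2) k.
  by rewrite /c /cochain_of /= mulrA sg_sqr mul1r; congr w; case: (mu k) => a b; lat.
have inb (x y : int) : (absz x <= M.+1)%N -> (absz y <= M.+1)%N -> ((x, y) : lattice) \in box M.+1.
  by move=> h1 h2; rewrite in_box h1 h2.
have cU x y : (absz x <= M.+1)%N -> (absz y <= M.+1)%N -> c x y 0 + c (x + 1) y 2 = c x y 1.
  move=> hx hy; have := hw (true, (x, y)) (inb x y hx hy).
  by rewrite /div /= sum3 !wc /sg /= ?latE /= ?addr0 ?eqxx /=; lia.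
have cD x y : (absz x <= M.+1)%N -> (absz y <= M.+1)%N -> c (x - 1) (y + 1) 0 + c x y 2 = c x y 1.
  move=> hx hy; have := hw (false, (x, y)) (inb x y hx hy).
  have e0 : ((x, y) : lattice) - delta 0 = (x - 1, y + 1) by lat.
  have e1 : ((x, y) : lattice) - delta 1 = (x, y) by lat.
  have e2 : ((x, y) : lattice) - delta 2 = (x - 1, y) by lat.
  by rewrite /div /= sum3 e0 e1 e2 !wc /sg !tabE /= ?addr0 ?subrK /=; lia.
pose m := Posz M.+1.
(* Integration runs along the bottom row and then up the column of [x]. Steps in direction 1 are
   exact by construction; those in direction 0 follow row by row from the two triangles between
   neighbouring columns. *)
pose H (x y : int) : int := \sum_(i < absz (x + m)) c (Posz i - m) (- m) 0 +
  \sum_(j < absz (y + m)) c x (Posz j - m) 1.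
have absS (z : int) : - m <= z -> absz (z + 1 + m) = (absz (z + m)).+1 by lia.
have Hb (x y : int) : - m <= y -> H x (y + 1) - H x y = c x y 1.
  move=> hy; rewrite /H absS //.
  rewrite big_ord_recr /= (_ : Posz (absz (y + m)) - m = y); last by lia.
  by ring.
have Ha0 (x : int) : - m <= x -> H (x + 1) (- m) - H x (- m) = c x (- m) 0.
  move=> hx; rewrite /H !addNr !big_ord0 !addr0 absS //.
  rewrite big_ord_recr /= (_ : Posz (absz (x + m)) - m = x); last by lia.
  by ring.
have cE x y k : cochain_of w ((x, y), k) = c x y k by [].
have mE : m = Posz M.+1 by [].
clearbody H c m; have Ha (n : nat) (x : int) : - m <= x -> x < m -> (n <= 2 * M.+1)%N ->
    H (x + 1) (Posz n - m) - H x (Posz n - m) = c x (Posz n - m) 0.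
  move=> hx1 hx2; elim: n => [|n IH] hn; first by rewrite sub0r Ha0.
  have E : Posz n.+1 - m = Posz n - m + 1 by lia.
  have b1 := Hb (x + 1) (Posz n - m) ltac:(lia); have b2 := Hb x (Posz n - m) ltac:(lia).
  have u := cU x (Posz n - m) ltac:(lia) ltac:(lia).
  have d := cD (x + 1) (Posz n - m) ltac:(lia) ltac:(lia).
  rewrite addrK in d.
  have := IH ltac:(lia); rewrite E; lia.
have Ha' (x y : int) : - m <= x -> x < m -> - m <= y -> y <= m -> H (x + 1) y - H x y = c x y 0.
  move=> ? ? ? ?; have -> : y = Posz (absz (y + m)) - m by lia.
  by apply: Ha => //; lia.
exists (fun p => H p.1 p.2) => -[[x y] k]; rewrite in_box /= => /andP[hx hy].
rewrite cE; elim/I3P: k; rewrite tabE /= ?addr0.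
- by apply: Ha'; lia.
- by apply: Hb; lia.
- have a := Ha' (x - 1) y ltac:(lia) ltac:(lia) ltac:(lia) ltac:(lia).
  have b := Hb (x - 1) y ltac:(lia).
  have u := cU (x - 1) y ltac:(lia) ltac:(lia).
  rewrite subrK in a u; lia.
Qed.

(** * Potentials for edge functions without circulation around tiles *)

Section Potential.
Variables (R : realType) (T : {fset tile}).
Hypothesis wp : forall s t : tile, s \in T -> t \in T -> s != t -> well_placed R s t.
Hypothesis nh : connected (~` \bigcup_(t in [set` T]) region R t).

Lemma uedge_mem t d : t.2 != d -> uedge t d \in edges t.
Proof. by move=> h; rewrite mem_edges /= eq_sym h eqxx. Qed.
Lemma dedge_mem t d : t.2 != d -> dedge t d \in edges t.
Proof. by move=> h; rewrite mem_edges /= eq_sym h eqxx orbT. Qed.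

(** Equal values on opposite sides allow one value on the diagonal of a tile to balance both of its
    triangles. The divergence that remains sits at uncovered triangles, and subtracting drains
    cancels it there without changing any edge next to a covered triangle. *)
Lemma potential (c : edge -> int) :
  (forall t d, t \in T -> d != t.2 -> c (uedge t d) = c (dedge t d)) ->
  exists h : lattice -> int, forall (t : tile) (e : edge), t \in T -> e \in edges t ->
    h (e.1 + dir e.2) - h e.1 = c e.
Proof.
(* Diagonals get the balancing value, tile edges the value prescribed by [c], and all other edges
   zero. The cases do not clash because no side of a tile is the diagonal of another one. *)
move=> hc; pose ue (p : lattice) d : edge := (p + mu d, d).
pose w : flow := fun p d =>
  if mktile p d \in T then - \sum_(d' | d' != d) sg d' * c (ue p d')
  else if has (fun t => ue p d \in edges t) (enum_fset T) then sg d * c (ue p d) else 0.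
have w_edge t p d : t \in T -> ue p d \in edges t -> mktile p d \notin T -> w p d = sg d * c (ue p d).
  by move=> tT et /negPf nT; rewrite /w nT ifT //; apply/hasP; exists t.
have dn_mk p d : dn (mktile p d) = p + delta d by rewrite /dn up_mktile.
have w_up t d : t \in T -> d != t.2 -> w (up t) d = sg d * c (uedge t d).
  move=> tT dt; apply: w_edge (tT) _ _; first by rewrite uedge_mem // eq_sym.
  apply/negP => mT; have := up_inj_in wp mT tT; rewrite up_mktile => /(_ erefl) mt.
  by move: dt; rewrite -mt eqxx.
have ue_dn t d : ue (dn t - delta d) d = dedge t d.
  rewrite /ue /dedge; congr pair; case: (dn t) => x y; elim/I3P: d; lat.
have w_dn t d : t \in T -> d != t.2 -> w (dn t - delta d) d = sg d * c (dedge t d).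
  move=> tT dt; rewrite -ue_dn; apply: w_edge (tT) _ _; first by rewrite ue_dn dedge_mem // eq_sym.
  apply/negP => mT; have := dn_inj_in wp mT tT; rewrite dn_mk subrK => /(_ erefl) mt.
  by move: dt; rewrite -mt eqxx.
have w_diag t : t \in T -> w (up t) t.2 = - \sum_(d | d != t.2) sg d * c (uedge t d).
  by move=> tT; rewrite /w mktile_up tT.
have cov0 x : covered T x -> div w x = 0.
  case: x => -[] p; rewrite /covered /= => /imfsetP[t /= tT ->]; rewrite /div /= (bigD1 t.2) //=.
    rewrite w_diag // [X in _ + X](eq_bigr (fun d => sg d * c (uedge t d))) ?addNr // => d ?.
    by rewrite w_up.
  rewrite {1}/dn addrK w_diag // [X in _ + X](eq_bigr (fun d => sg d * c (uedge t d))) => [|d ?].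
    by rewrite addNr oppr0.
  by rewrite w_dn // hc.
have [M hM] := box_bound (flatten [seq [seq e.1 | e <- edges t] | t <- enum_fset T]).
pose X := [seq x <- [seq (b, p) | b <- [:: true; false], p <- enum_fset (box M.+1)] | ~~ covered T x].
have Xu x : x \in X -> ~~ covered T x by rewrite mem_filter => /andP[].
have uX : uniq X.
  by apply: filter_uniq; apply: allpairs_uniq => // -[b p] [b' p'] _ _ [-> ->].
have [f hf] : {f : tri -> flow | forall x, ~~ covered T x -> drains T M.+1 x (f x)}.
  have fx x : {f : flow | ~~ covered T x -> drains T M.+1 x f}.
    apply: cid; case: (boolP (covered T x)) => [cx|/(drain_ex nh M.+1)[f fP]]; last by exists f.
    by exists (fun _ _ => 0).
  by exists (fun x => sval (fx x)) => x; exact: (svalP (fx x)).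
(* [X] contains all uncovered triangles of the box, each drained with its residual divergence as
   weight. *)
pose w' : flow := fun p d => w p d - \sum_(x <- X) div w x * f x p d.
have dw' y : y.2 \in box M.+1 -> div w' y = 0.
  move=> yM; rewrite /w' divB div_sum.
  have -> : \sum_(x <- X) div w x * div (f x) y = \sum_(x <- X) div w x * (y == x)%:Z.
    by apply: eq_big_seq => x /Xu /hf[_ ->].
  case: (boolP (covered T y)) => cy.
    rewrite cov0 // sub0r big_seq big1 ?oppr0 // => x /Xu nx.
    by case: eqP => [yx|]; rewrite ?mulr0 //; rewrite -yx cy in nx.
  have yX : y \in X.
    rewrite mem_filter cy andTb; case: y yM cy => b p yM cy; apply/allpairsP; exists (b, p); split => //=.
    by case: (b); rewrite !inE.
  rewrite (bigD1_seq y) //= eqxx mulr1 big1 ?addr0 ?subrr // => x /negPf.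
  by rewrite eq_sym => ->; rewrite mulr0.
have [h hh] := integrate dw'; exists h => t e tT et; rewrite hh; last first.
  by apply: hM; apply/flatten_mapP; exists t => //; exact: (map_f fst).
have f0 x p d : x \in X -> covered T (true, p) || covered T (false, p + delta d) -> f x p d = 0.
  move=> /Xu /hf[h1 _] cc; apply/eqP/negPn/negP => /h1.
  by move: cc; case: (covered T _); case: (covered T _).
have w'w p d : covered T (true, p) || covered T (false, p + delta d) -> w' p d = w p d.
  by move=> cc; rewrite /w' big_seq big1 ?subr0 // => x xX; rewrite f0 // mulr0.
move: et; rewrite mem_edges /cochain_of => /andP[dt /orP[]/eqP eE].
  have -> : e.1 - mu e.2 = up t by rewrite [in LHS]eE /= addrK.
  rewrite w'w; last by apply/orP; left; apply/imfsetP; exists t.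
  by rewrite w_up // mulrA sg_sqr mul1r -eE.
have -> : e.1 - mu e.2 = dn t - delta e.2.
  by rewrite [in LHS]eE /=; case: (dn t) => x y; elim/I3P: e.2; lat.
rewrite w'w; last by apply/orP; right; rewrite subrK; apply/imfsetP; exists t.
by rewrite w_dn // mulrA sg_sqr mul1r -eE.
Qed.
End Potential.

(** * Locally constant functions and the free end of a leaf *)

Lemma graph_connected_ind (r : tile -> tile -> Prop) (V : {fset tile}) (P : tile -> Prop) :
  graph_connected r V -> (forall x y, x \in V -> y \in V -> r x y -> P x -> P y) ->
  forall s t, s \in V -> t \in V -> P s -> P t.
Proof.
move=> [_ cV] hP s t sV tV.
have /connectP[p] := cV [` sV]%fset [` tV]%fset.
elim: p s sV => [|y p IH] s sV /=; first by move=> _ [->].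
move=> /andP[/asboolP sy yp] tE Ps.
have yV := fsvalP y.
have yE : y = [` yV]%fset by apply/val_inj.
apply: (IH (val y) yV); [by rewrite -yE|by rewrite -yE|exact: hP sy Ps].
Qed.

Lemma mem_vertices_edge (t : tile) (e : edge) : e \in edges t ->
  (e.1 \in vertices t) /\ (e.1 + dir e.2 \in vertices t).
Proof.
case: t => p k; case: e => q d; case: p => x y; case: q => z w.
by elim/I3P: k; elim/I3P: d; rewrite /edges /vertices /= !inE; lat.
Qed.

Lemma vertices_const (A : eqType) (h : lattice -> A) (t : tile) :
  (forall e, e \in edges t -> h (e.1 + dir e.2) = h e.1) ->
  forall u v, u \in vertices t -> v \in vertices t -> h u = h v.
Proof.
case: t => p k /= hh.
have h1 := hh (p, k + 1); have h2 := hh (p + dir (k + 2), k + 1); have h3 := hh (p, k + 2).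
rewrite /= !inE !eqxx ?orbT /= in h1 h2 h3.
have E u : u \in vertices (p, k) -> h u = h p.
  rewrite /vertices !inE => /or4P[]/eqP-> //; rewrite ?h1 ?h3 //.
  by rewrite addrAC h2 // h3.
by move=> u v /E -> /E ->.
Qed.

(** A neighbour across a side is recognised by its triangle beyond that side. For [d = t.2] that
    triangle is the other half of [t] itself, hence the guard [d != t.2] wherever neighbours are
    meant. *)
Definition hasnext T t d := covered T (false, up t + delta d).
Definition hasprev T t d := covered T (true, dn t - delta d).

Section Doku.
Variables (R : realType) (kappa : nat) (T : {fset tile}).
Hypothesis hT : doku_tiling R kappa T.
Let wp := doku_well_placed hT.
Let nh := doku_no_holes hT.

Lemma const_on_T (A : Type) (h : lattice -> A) :
  (forall t u v, t \in T -> u \in vertices t -> v \in vertices t -> h u = h v) ->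
  forall s t u v, s \in T -> t \in T -> u \in vertices s -> v \in vertices t -> h u = h v.
Proof.
move=> hh s t u v sT tT us; move: v.
apply: (graph_connected_ind (doku_adjacent_connected hT)
  (P := fun t => forall v, v \in vertices t -> h u = h v) _ sT tT).
  move=> x y xT yT [_ [e [ex ey]]] IH v vy.
  rewrite (IH e.1); last by case: (mem_vertices_edge ex).
  by apply: hh (yT) _ vy; case: (mem_vertices_edge ey).
by move=> v; exact: hh.
Qed.

Lemma const_removed (A : Type) (h : lattice -> A) (r : tile) : r \in T ->
  (forall t u v, t \in T -> t != r -> u \in vertices t -> v \in vertices t -> h u = h v) ->
  forall s t u v, s \in T -> t \in T -> s != r -> t != r ->
    u \in vertices s -> v \in vertices t -> h u = h v.
Proof.
move=> rT hh s t u v sT tT sr tr us; move: v.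
have sV : s \in (T `\ r)%fset by rewrite !inE sr.
have tV : t \in (T `\ r)%fset by rewrite !inE tr.
apply: (graph_connected_ind (doku_removal hT rT)
  (P := fun t => forall v, v \in vertices t -> h u = h v) _ sV tV).
  move=> x y; rewrite !inE => /andP[xr xT] /andP[yr yT] xy IH v vy.
  have [z zx zy] := meets_vertex wp xT yT xy.
  by rewrite (IH z) //; apply: hh (yT) yr zy vy.
by move=> v; exact: hh.
Qed.

Lemma uedge_eq (s t : tile) d : s \in T -> t \in T -> uedge s d = uedge t d -> s = t.
Proof.
by move=> sT tT /(congr1 fst); rewrite /uedge => /addIr E; exact: (up_inj_in wp) sT tT E.
Qed.
Lemma dedge_eq (s t : tile) d : s \in T -> t \in T -> dedge s d = dedge t d -> s = t.
Proof.
by move=> sT tT /(congr1 fst); rewrite /dedge => /addIr E; exact: (dn_inj_in wp) sT tT E.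
Qed.
Lemma uedge_dedge s t d : (uedge s d = dedge t d) <-> (dn t = up s + delta d).
Proof.
have mnd : mu d = nu d + delta d by elim/I3P: d; lat.
rewrite /uedge /dedge; split=> [/(congr1 fst)|->]; last by rewrite mnd (addrC (nu d)) addrA.
by rewrite /fst mnd (addrC (nu d)) addrA => /addIr.
Qed.

Definition leafdir (t : tile) d := [&& t \in T, d != t.2, ~~ hasnext T t d & ~~ hasprev T t d].

(** The indicator of the two sides of direction [d] has no circulation around any tile, so it has a
    potential [h]. By (P3) [h] takes a single value on all other tiles, but the values at the two
    sides of direction [d'] differ; at most one of these sides can touch another tile. *)
Lemma leaf_private (t : tile) d d' : leafdir t d -> d' != t.2 -> d' != d ->
  (forall s, s \in T -> s != t ->
     (uedge t d').1 \notin vertices s /\ (uedge t d').1 + dir d' \notin vertices s) \/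
  (forall s, s \in T -> s != t ->
     (dedge t d').1 \notin vertices s /\ (dedge t d').1 + dir d' \notin vertices s).
Proof.
move=> /and4P[tT dt nn np] dt' dd.
pose c (e : edge) : int := ((e == uedge t d) || (e == dedge t d))%:Z.
have c1 (s : tile) : s \in T -> s != t -> (uedge s d == uedge t d) || (uedge s d == dedge t d) = false.
  move=> sT st; apply/negP => /orP[/eqP /(uedge_eq sT tT) E|/eqP /uedge_dedge E].
    by rewrite E eqxx in st.
  by move/negP: np; apply; apply/imfsetP; exists s => //=; rewrite E addrK.
have c2 (s : tile) : s \in T -> s != t -> (dedge s d == uedge t d) || (dedge s d == dedge t d) = false.
  move=> sT st; apply/negP => /orP[/eqP /esym /uedge_dedge E|/eqP /(dedge_eq sT tT) E].
    by move/negP: nn; apply; apply/imfsetP; exists s.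
  by rewrite E eqxx in st.
have c3 (e : edge) : e.2 != d -> c e = 0.
  rewrite /c => ed; case: orP => //; case=> /eqP E; by rewrite E eqxx in ed.
have cs (s : tile) (e : edge) : s \in T -> s != t -> e \in edges s -> c e = 0.
  move=> sT st; rewrite mem_edges => /andP[_ es].
  have [ed|] := eqVneq e.2 d; last exact: c3.
  by move: es; rewrite ed /c => /orP[]/eqP->; rewrite ?c1 ?c2.
have [h hh] : exists h : lattice -> int, forall (s : tile) (e : edge), s \in T -> e \in edges s ->
    h (e.1 + dir e.2) - h e.1 = c e.
  apply: (potential wp nh) => s e sT es.
  have [ed|ed] := eqVneq e d; last by rewrite !c3.
  have [st|st] := eqVneq s t; last by rewrite ed /c c1 // c2.
  by rewrite ed st /c !eqxx orbT.
have rem (s s' : tile) (u v : lattice) : s \in T -> s' \in T -> s != t -> s' != t ->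
    u \in vertices s -> v \in vertices s' -> h u = h v.
  apply: const_removed (tT) _ s s' u v => s u v sT st us vs.
  apply: vertices_const us vs => e es; apply/eqP; rewrite -subr_eq0 (hh s) //; apply/eqP.
  exact: cs es.
have [b1 b2 b3 b4] : [/\ h (uedge t d').1 != h (dedge t d').1,
    h (uedge t d').1 != h ((dedge t d').1 + dir d'),
    h ((uedge t d').1 + dir d') != h (dedge t d').1 &
    h ((uedge t d').1 + dir d') != h ((dedge t d').1 + dir d')].
  have dt2 : t.2 != d by rewrite eq_sym.
  have dt2' : t.2 != d' by rewrite eq_sym.
  move: (hh t _ tT (uedge_mem dt2)) (hh t _ tT (dedge_mem dt2)).
  move: (hh t _ tT (uedge_mem dt2')) (hh t _ tT (dedge_mem dt2')).
  rewrite (c3 (uedge t d')) // (c3 (dedge t d')) // /c !eqxx orbT /=.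
  clear -dt dt' dd; rewrite /uedge /dedge /dn /=; case: (up t) => x y; move: dt dt' dd.
  elim/I3P: (t.2); elim/I3P: d; elim/I3P: d' => // _ _ _; rewrite ?latE /=
    ?(addrA, addr0, subr0, add0r, sub0r, addNKr, addrNK, addrK, subrK); split; lia.
case: (pselect (exists s, [/\ s \in T, s != t & ((uedge t d').1 \in vertices s) ||
    ((uedge t d').1 + dir d' \in vertices s)])) => [[s [sT st sv]]|nex]; [right|left] => r rT rt.
  by split; apply/negP => rv; case/orP: sv => sv; have := rem _ _ _ _ sT rT st rt sv rv => E;
    rewrite E eqxx in b1 b2 b3 b4.
by split; apply/negP => rv; apply: nex; exists r; rewrite rv ?orbT.
Qed.
End Doku.

(** * Euler's inequality by linear algebra *)

Definition VT (T : {fset tile}) : {fset lattice} := seq_fset tt (flatten [seq vertices t | t <- enum_fset T]).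
Definition ET (T : {fset tile}) : {fset edge} := seq_fset tt (flatten [seq edges t | t <- enum_fset T]).

Lemma in_VT T v : reflect (exists2 t, t \in T & v \in vertices t) (v \in VT T).
Proof.
rewrite seq_fsetE; apply: (iffP flatten_mapP) => -[t tT vt]; exists t => //.
Qed.
Lemma in_ET T e : reflect (exists2 t, t \in T & e \in edges t) (e \in ET T).
Proof.
rewrite seq_fsetE; apply: (iffP flatten_mapP) => -[t tT vt]; exists t => //.
Qed.

Definition sgr (d : 'I_3) : rat := (sg d)%:~R.
(** The coefficient of [e] in the oriented boundary of [t]: pairing an edge function with it gives
    the circulation around [t]. *)
Definition bd (t : tile) (e : edge) : rat :=
  if e.2 == t.2 then 0 else sgr e.2 * ((e == uedge t e.2)%:R - (e == dedge t e.2)%:R).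

Lemma sum_fset_ind (K : choiceType) (A : {fset K}) (x : K) (F : A -> rat) (xA : x \in A) :
  \sum_(i : 'I_#|{: A}|) F (enum_val i) * (val (enum_val i) == x)%:R = F [` xA]%fset.
Proof.
rewrite (bigD1 (enum_rank [` xA]%fset)) //= enum_rankK eqxx mulr1 big1 ?addr0 // => i ne.
case: eqP => // E; last by rewrite mulr0.
by case/eqP: ne; apply: enum_val_inj; rewrite enum_rankK; apply/val_inj.
Qed.

Lemma curl_sum (T : {fset tile}) (t : tile) (F : edge -> rat) : t \in T ->
  \sum_(i : 'I_#|{: ET T}|) F (val (enum_val i)) * bd t (val (enum_val i)) =
  \sum_(d | d != t.2) sgr d * (F (uedge t d) - F (dedge t d)).
Proof.
move=> tT; have inE' d : d != t.2 -> (uedge t d \in ET T) && (dedge t d \in ET T).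
  by rewrite eq_sym => dt; apply/andP; split; apply/in_ET; exists t => //; [exact: uedge_mem|exact: dedge_mem].
transitivity (\sum_(d | d != t.2) \sum_(i : 'I_#|{: ET T}|) F (val (enum_val i)) *
   (sgr d * ((val (enum_val i) == uedge t d)%:R - (val (enum_val i) == dedge t d)%:R))).
  rewrite exchange_big /=; apply: eq_bigr => i _; set e := fsval _.
  rewrite -mulr_sumr; congr (_ * _); rewrite /bd; case: ifPn => ek.
    rewrite big1 // => d dt; have nE (q : edge) : q.2 = d -> (e == q) = false.
      by move=> qd; apply/negP => /eqP E; move: dt; rewrite -qd -E (eqP ek) eqxx.
    by rewrite !nE // subrr mulr0.
  rewrite (bigD1 e.2) //= big1 ?addr0 // => d /andP[_ de].
  have nE (q : edge) : q.2 = d -> (e == q) = false.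
    by move=> qd; apply/negP => /eqP E; move: de; rewrite -qd -E eqxx.
  by rewrite !nE // subrr mulr0.
apply: eq_bigr => d dt; have /andP[uE dE] := inE' d dt.
rewrite (eq_bigr (fun i : 'I_#|{: ET T}| => sgr d * (F (val (enum_val i)) * (val (enum_val i) == uedge t d)%:R) -
   sgr d * (F (val (enum_val i)) * (val (enum_val i) == dedge t d)%:R))); last by move=> i _; ring.
rewrite sumrB -!mulr_sumr (sum_fset_ind (fun e => F (val e)) uE) (sum_fset_ind (fun e => F (val e)) dE).
by rewrite mulrBr.
Qed.

(** A flow with its only source at the upward triangle [p], carried along the row of triangles to
    the right without end. Its circulation around a tile is 1 if the tile owns that triangle and 0
    otherwise. *)
Definition ray (p : lattice) : flow := fun q d =>
  ((q.2 == p.2) && (p.1 <= q.1) && (d == 2))%:Z - ((q.2 == p.2) && (p.1 < q.1) && (d == 1))%:Z.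

Lemma div_ray p x : div (ray p) x = (x == (true, p))%:Z.
Proof.
case: p => i j; case: x => -[] [k l]; rewrite xpair_eqE lat_eqE /div /= sum3 /ray ?latE /= ?eqxx ?andbT ?andbF; lia.
Qed.

Lemma cochain_uedge (w : flow) t d : cochain_of w (uedge t d) = sg d * w (up t) d.
Proof. by rewrite /cochain_of /= addrK. Qed.
Lemma cochain_dedge (w : flow) t d : cochain_of w (dedge t d) = sg d * w (dn t - delta d) d.
Proof.
by rewrite /cochain_of /=; congr (_ * w _ _); case: (dn t) => x y; elim/I3P: d; lat.
Qed.

Lemma curl_cochain (w : flow) t :
  \sum_(d | d != t.2) sgr d * ((cochain_of w (uedge t d))%:~R - (cochain_of w (dedge t d))%:~R) =
  (div w (true, up t) + div w (false, dn t))%:~R :> rat.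
Proof.
have -> : div w (true, up t) + div w (false, dn t) = \sum_(d | d != t.2) (w (up t) d - w (dn t - delta d) d).
  rewrite /div /= (bigD1 t.2) //= [X in _ - X](bigD1 t.2) //= sumrB {1}/dn addrK; ring.
rewrite rmorph_sum /=; apply: eq_bigr => d _.
by rewrite cochain_uedge cochain_dedge /sgr -rmorphB -rmorphM /= -mulrBr mulrA sg_sqr mul1r.
Qed.

Lemma curl_grad (g : lattice -> rat) t :
  \sum_(d | d != t.2) sgr d * ((g ((uedge t d).1 + dir d) - g (uedge t d).1) -
     (g ((dedge t d).1 + dir d) - g (dedge t d).1)) = 0.
Proof.
rewrite big_mkcond sum3 /= /dn; case: (up t) => x y.
elim/I3P: t.2; rewrite /= /sgr /sg ?eqxx ?I3eqE /= ?latE /=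
    ?(addrA, addr0, subr0, add0r, sub0r, addNKr, addrNK, addrK, subrK) /=; ring.
Qed.

Section Euler.
Variables (R : realType) (kappa : nat) (T : {fset tile}).
Hypothesis hT : doku_tiling R kappa T.
Let wp := doku_well_placed hT.

(** [A] is the vertex-edge incidence matrix and [B] the edge-tile boundary matrix. The rays supply a
    left inverse of [B], so its rank is the number of tiles; by (P1) the left kernel of [A] contains
    only constants, so its rank is at least V - 1. Since [A *m B = 0], the two ranks add up to at
    most E. *)
Lemma euler_le : (#|` VT T| + #|` T| <= #|` ET T| + 1)%N.
Proof.
pose A : 'M[rat]_(#|{: VT T}|, #|{: ET T}|) := \matrix_(i, j)
  ((val (enum_val i) == (val (enum_val j)).1 + dir (val (enum_val j)).2)%:R -
   (val (enum_val i) == (val (enum_val j)).1)%:R).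
pose B : 'M[rat]_(#|{: ET T}|, #|{: T}|) := \matrix_(j, k) bd (val (enum_val k)) (val (enum_val j)).
pose C : 'M[rat]_(#|{: T}|, #|{: ET T}|) := \matrix_(k, j)
  (cochain_of (ray (up (val (enum_val k)))) (val (enum_val j)))%:~R.
have AB : A *m B = 0.
  apply/matrixP => i k; rewrite !mxE; set t := val (enum_val k); set v := val (enum_val i).
  pose F (e : edge) : rat := (v == e.1 + dir e.2)%:R - (v == e.1)%:R.
  rewrite (eq_bigr (fun j : 'I_#|{: ET T}| => F (val (enum_val j)) * bd t (val (enum_val j)))); last first.
    by move=> j _; rewrite !mxE.
  rewrite curl_sum; last exact: fsvalP.
  exact: (curl_grad (fun u => (v == u)%:R)).
have CB : C *m B = 1%:M.
  apply/matrixP => l k; rewrite !mxE; set t := val (enum_val k); set s := val (enum_val l).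
  rewrite (eq_bigr (fun j : 'I_#|{: ET T}| => (cochain_of (ray (up s)) (val (enum_val j)))%:~R *
    bd t (val (enum_val j)))); last by move=> j _; rewrite !mxE.
  rewrite (curl_sum (fun e => (cochain_of (ray (up s)) e)%:~R)); last exact: fsvalP.
  rewrite curl_cochain !div_ray /= addr0 xpair_eqE andTb.
  have -> : (up t == up s) = (l == k); last by case: (l == k).
  apply/eqP/eqP => [/(up_inj_in wp (fsvalP _) (fsvalP _)) E|lk]; last by rewrite /t /s lk.
  by apply/esym/enum_val_inj/val_inj.
have rB : \rank B = #|{: T}|.
  apply/eqP; rewrite eqn_leq rank_leq_col /=.
  by have := mxrankM_maxr C B; rewrite CB mxrank1.
have rA : (#|{: VT T}| <= \rank A + 1)%N.
  suff : (\rank (kermx A) <= 1)%N by rewrite mxrank_ker; lia.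
  suff /mxrankS h : (kermx A <= (const_mx 1 : 'rV[rat]_#|{: VT T}|))%MS.
    exact: leq_trans h (rank_leq_row _).
  apply/rV_subP => u /sub_kermxP uA.
  pose h (v : lattice) : rat := if insub v is Some x then u 0 (enum_rank (x : VT T)) else 0.
  have hE v (vV : v \in VT T) : h v = u 0 (enum_rank [` vV]%fset).
    by rewrite /h (insubT (fun x => x \in VT T) vV).
  have hc : forall t x y, t \in T -> x \in vertices t -> y \in vertices t -> h x = h y.
    move=> t x y tT; apply: vertices_const => e et.
    have eE : e \in ET T by apply/in_ET; exists t.
    have [v1 v2] := mem_vertices_edge et.
    have V1 : e.1 \in VT T by apply/in_VT; exists t.
    have V2 : e.1 + dir e.2 \in VT T by apply/in_VT; exists t.
    have := congr1 (fun m : 'rV_#|{: ET T}| => m 0 (enum_rank [` eE]%fset)) uA.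
    rewrite !mxE (eq_bigr (fun i : 'I_#|{: VT T}| => u 0 (enum_rank (enum_val i)) * (val (enum_val i) == e.1 + dir e.2)%:R -
       u 0 (enum_rank (enum_val i)) * (val (enum_val i) == e.1)%:R)); last first.
      by move=> i _; rewrite !mxE enum_rankK enum_valK /= mulrBr.
    rewrite sumrB (sum_fset_ind (fun v => u 0 (enum_rank v)) V2) (sum_fset_ind (fun v => u 0 (enum_rank v)) V1).
    by rewrite -!hE => /eqP; rewrite subr_eq0 => /eqP.
  have hcc := const_on_T hT hc.
  case: (posnP #|{: VT T}|) => [V0|Vp].
    have -> : u = 0 by apply/matrixP => i j; have := ltn_ord j; rewrite {2}V0.
    exact: sub0mx.
  have -> : u = u 0 (Ordinal Vp) *: const_mx 1.
    apply/matrixP => i j; rewrite !mxE mulr1 (ord1 i).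
    have /in_VT[s sT vs] := fsvalP (enum_val j).
    have /in_VT[t tT vt] := fsvalP (enum_val (Ordinal Vp)).
    have := hcc s t _ _ sT tT vs vt; rewrite !hE => E.
    rewrite -[j in LHS]enum_valK -[Ordinal Vp in RHS]enum_valK.
    by move: E; congr (u 0 (enum_rank _) = u 0 (enum_rank _)); apply/val_inj.
  exact: scalemx_sub.
have := mulmx0_rank_max AB; rewrite rB !cardfE in rA *; lia.
Qed.
End Euler.

(** * Covered and uncovered sectors around a vertex *)

(** The six triangles at [v] in cyclic order. The entries of [rims v] are their neighbours across
    the sides opposite to [v], in the same order. *)
Definition tris (v : lattice) : seq tri :=
  [:: (true, v); (false, v); (true, v + (-1, 0)); (false, v + (0, -1)); (true, v + (0, -1));
      (false, v + (1, -1))].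
Definition rims (v : lattice) : seq tri :=
  [:: (false, v + (1, 0)); (true, v + (-1, 1)); (false, v + (-1, 0)); (true, v + (-1, -1));
      (false, v + (1, -2)); (true, v + (1, -1))].
Definition tri0 : tri := (true, 0).

Definition cyc (s : seq bool) (i : nat) : bool := nth false s (i %% 6).
Definition cnt (P : nat -> bool) : nat := count P (iota 0 6).

(* [gap k c] counts the maximal uncovered sectors made of at least k triangles,
   [c] listing which of the six triangles around a vertex are covered. *)
Definition gap (k : nat) (c : seq bool) : nat :=
  cnt (fun i => cyc c (i + 5) && all (fun j => ~~ cyc c (i + j)) (iota 0 k)).
Definition gap_one c := cnt (fun i => [&& cyc c (i + 5), ~~ cyc c i & cyc c (i + 1)]).
Definition gap3_end c :=
  cnt (fun j => [&& cyc c (j + 1), ~~ cyc c j, ~~ cyc c (j + 5) & ~~ cyc c (j + 4)]).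
Definition just1 c := count id c == 1%N.
Definition just2 c := (count id c == 2%N) && has (fun i => cyc c i && cyc c (i + 1)) (iota 0 6).

(* The same quantities seen from the third vertex p of an uncovered triangle: [r] lists which
   of the six triangles opposite to p are covered. *)
Definition rim_one c r := cnt (fun i => [&& cyc c (i + 5), ~~ cyc c i & cyc r i]).
Definition rim3 c r :=
  cnt (fun i => [&& cyc r (i + 5), ~~ cyc c (i + 5), ~~ cyc c i & ~~ cyc r i]).
(** The view from the apex of the uncovered triangle that faces the free end of a leaf; the covered
    rim triangle is the outer half of the leaf. *)
Definition is_cap c r i := [&& ~~ cyc c (i + 5), ~~ cyc r (i + 5), ~~ cyc c i, cyc r i,
  ~~ cyc c (i + 1) & ~~ cyc r (i + 1)].
Definition caps c r := cnt (is_cap c r).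
(** An uncovered sector shut in on both sides and along its whole rim, which would be a hole. *)
Definition fan c r i m := [&& cyc c (i + 5), all (fun j => ~~ cyc c (i + j) && cyc r (i + j)) (iota 0 m.+1)
  & cyc c (i + m.+1)].
Definition nofan c r := all (fun i => all (fun m => ~~ fan c r i m) (iota 0 5)) (iota 0 6).

Fixpoint bits n : seq (seq bool) :=
  if n is n'.+1 then [seq b :: s | b <- [:: true; false], s <- bits n'] else [:: [::]].
Lemma bitsP s : s \in bits (size s).
Proof.
elim: s => [|b s IH]; first by rewrite inE.
rewrite [size _]/=; apply/allpairsP; exists (b, s); split => //; by case: b; rewrite !inE.
Qed.

Lemma bits_all n (P : seq bool -> bool) : all P (bits n) -> forall s, size s = n -> P s.
Proof. by move=> /allP h s sn; apply: h; rewrite -sn; exact: bitsP. Qed.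

(** A maximal uncovered sector of k triangles is counted once in each of [gap 1], ..., [gap k]. With
    nothing covered there is no sector start, so that case is excluded. *)
Lemma gap_sum c : size c = 6%N -> has id c ->
  6%N = (count id c + gap 1 c + gap 2 c + gap 3 c + gap 4 c + gap 5 c)%N.
Proof.
move=> sc hc; move: c sc hc.
suff h : forall c, size c = 6%N -> has id c ==>
    (6 == (count id c + gap 1 c + gap 2 c + gap 3 c + gap 4 c + gap 5 c))%N.
  by move=> c /h /implyP hc /hc /eqP.
by apply: (@bits_all 6 (fun c => has id c ==>
    (6 == (count id c + gap 1 c + gap 2 c + gap 3 c + gap 4 c + gap 5 c))%N)); vm_compute.
Qed.
Lemma gap_none c k : size c = 6%N -> ~~ has id c -> gap k c = 0%N.
Proof.
move=> sc nc; rewrite /gap /cnt; apply/eqP; rewrite -leqn0 leqNgt -has_count; apply/hasPn => i _.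
apply/negP => /andP[ci _]; move/hasPn: nc => /(_ true); rewrite /cyc in ci.
by rewrite -ci mem_nth ?sc ?ltn_mod // => /(_ isT); rewrite ci.
Qed.
Lemma gap12 c : size c = 6%N -> (gap 2 c + gap_one c = gap 1 c)%N.
Proof.
move=> sc; apply/eqP; move: c sc.
by apply: (@bits_all 6 (fun c => gap 2 c + gap_one c == gap 1 c)%N); vm_compute.
Qed.
Lemma gap3E c : size c = 6%N -> gap 3 c = gap3_end c.
Proof.
move=> sc; apply/eqP; move: c sc.
by apply: (@bits_all 6 (fun c => gap 3 c == gap3_end c)); vm_compute.
Qed.
(** One covered triangle leaves a sector of five, counted by both [gap 4] and [gap 5]; two adjacent
    ones leave a sector of four, counted by [gap 4]. *)
Lemma gap45 c : size c = 6%N -> (2 * just1 c + just2 c <= gap 4 c + gap 5 c)%N.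
Proof.
move: c; by apply: (@bits_all 6 (fun c => (2 * just1 c + just2 c <= gap 4 c + gap 5 c)%N)); vm_compute.
Qed.
(** Each item counted on the left begins its own block of covered rim triangles inside an uncovered
    sector. Without a fan the block stops before the sector does, and [rim3] counts that stop. All
    4096 patterns are checked by computation. *)
Lemma fan_ineq c r : size c = 6%N -> size r = 6%N -> nofan c r ->
  (rim_one c r + caps c r <= rim3 c r)%N.
Proof.
move=> sc sr nf.
have h : all (fun c => all (fun r => nofan c r ==> (rim_one c r + caps c r <= rim3 c r)%N) (bits 6)) (bits 6).
  by vm_compute.
move/allP: h => /(_ c); rewrite -{1}sc bitsP => /(_ isT) /allP /(_ r).
by rewrite -{1}sr bitsP => /(_ isT) /implyP /(_ nf).
Qed.

Lemma sum_support (K : eqType) (f : K -> nat) (s1 s2 : seq K) : uniq s1 -> uniq s2 ->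
  (forall u, f u != 0%N -> (u \in s1) && (u \in s2)) ->
  (\sum_(u <- s1) f u = \sum_(u <- s2) f u)%N.
Proof.
move=> u1 u2 h.
have E s : (\sum_(u <- s) f u = \sum_(u <- [seq v <- s | f v != 0%N]) f u)%N.
  rewrite big_filter [LHS](bigID (fun u => f u != 0%N)) /= [X in (_ + X)%N]big1 ?addn0 //.
  by move=> u; rewrite negbK => /eqP.
rewrite E [RHS]E; apply: perm_big; apply: uniq_perm; rewrite ?filter_uniq // => u.
by rewrite !mem_filter; case: (boolP (f u != 0%N)) => // /h /andP[-> ->].
Qed.

Lemma sum_card (K : choiceType) (A : {fset K}) (s : seq K) : uniq s -> {subset A <= s} ->
  (\sum_(u <- s) (u \in A) = #|` A|)%N.
Proof.
move=> us sA; rewrite (@sum_support _ _ s (enum_fset A)) //.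
  by rewrite big_seq (eq_bigr (fun=> 1%N)) => [|u ->//]; rewrite -big_seq sum1_size.
by move=> u; case: (boolP (u \in A)) => // uA _; rewrite (sA u uA) andTb.
Qed.

Lemma sum_inj (K : eqType) (L : eqType) (P : pred K) (s : seq K) (l : seq L) (g : L -> K) :
  uniq l -> {in l &, injective g} -> (forall x, x \in l -> (g x \in s) && P (g x)) ->
  (size l <= \sum_(u <- s) P u)%N.
Proof.
move=> ul gi h; rewrite -(size_map g).
have -> : (\sum_(u <- s) P u = size [seq u <- s | P u])%N.
  by rewrite size_filter -sum1_count [RHS]big_mkcond /=; apply: eq_bigr => u _; case: (P u).
apply: uniq_leq_size; first by rewrite map_inj_in_uniq.
by move=> u /mapP[x xl ->]; rewrite mem_filter andbC h.
Qed.

Lemma tris_shift q w : tris (q + w) = [seq (x.1, q + x.2) | x <- tris w].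
Proof. by rewrite /tris /= !addrA. Qed.
Lemma rims_shift q w : rims (q + w) = [seq (x.1, q + x.2) | x <- rims w].
Proof. by rewrite /rims /= !addrA. Qed.

Lemma mem_tris (t : tile) (v : lattice) :
  (v \in vertices t) = ((true, up t) \in tris v) || ((false, dn t) \in tris v).
Proof.
rewrite mem_vertices; move: (up t) (dn t) => p q; case: p => x y; case: q => z w; case: v => a b.
by rewrite /tris !inE ?latE !xpair_eqE /=; lia.
Qed.

Section Fan.
Variables (R : realType) (T : {fset tile}).
Hypothesis nh : connected (~` \bigcup_(t in [set` T]) region R t).
Definition cbits v := map (covered T) (tris v).
Definition rbits v := map (covered T) (rims v).
Definition trn v i := nth tri0 (tris v) (i %% 6).
Definition rimn v i := nth tri0 (rims v) (i %% 6).

Lemma cycb v i : cyc (cbits v) i = covered T (trn v i).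
Proof. by rewrite /cyc /cbits (nth_map tri0) // ltn_mod. Qed.
Lemma cycr v i : cyc (rbits v) i = covered T (rimn v i).
Proof. by rewrite /cyc /rbits (nth_map tri0) // ltn_mod. Qed.

Lemma trn_neighbours v i (x : tri) :
  (exists d, (x.1 = true /\ (false, x.2 + delta d) = trn v i) \/
             (x.1 = false /\ (true, x.2 - delta d) = trn v i)) ->
  [\/ x = trn v (i + 1), x = trn v (i + 5) | x = rimn v i].
Proof.
rewrite /trn /rimn -(modnDml i 1) -(modnDml i 5).
have : (i %% 6 < 6)%N by rewrite ltn_mod.
move: (i %% 6)%N => {}i hi [d]; case: x => b [x1 x2]; case: v => v1 v2.
move: i hi => [|[|[|[|[|[|//]]]]]] _ /=; elim/I3P: d; rewrite ?latE /=; case=> -[/= -> []] //= => e1 e2;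
  rewrite ?latE;
  first [ apply: Or31; congr (_, (_, _)); lia | apply: Or32; congr (_, (_, _)); lia
        | apply: Or33; congr (_, (_, _)); lia ].
Qed.

(** The triangles of a fan would form a nonempty finite sealed set of uncovered triangles. *)
Lemma no_fan v : nofan (cbits v) (rbits v).
Proof.
apply/allP => i; rewrite mem_iota => hi; apply/allP => m; rewrite mem_iota => hm.
apply/negP => /and3P[c0 /allP ca c1].
pose S : {fset tri} := seq_fset tt [seq trn v (i + j) | j <- iota 0 m.+1].
have inS x : reflect (exists2 j, (j <= m)%N & x = trn v (i + j)) (x \in S).
  rewrite seq_fsetE; apply: (iffP mapP) => -[j]; rewrite ?mem_iota => hj ->; exists j => //.
  by rewrite mem_iota.
have uS x : x \in S -> ~~ covered T x.
  by move=> /inS[j hj ->]; have := ca j; rewrite mem_iota => /(_ hj) /andP[]; rewrite cycb.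
have nb x y : y \in S ->
   (exists d, (x.1 = true /\ (false, x.2 + delta d) = y) \/ (x.1 = false /\ (true, x.2 - delta d) = y)) ->
   covered T x \/ x \in S.
  move=> /inS[j hj ->] /trn_neighbours[] ->.
  - have [jm|jm] := leqP j.+1 m; first by right; apply/inS; exists j.+1; rewrite // addn1 addnS.
    have mj : m = j by lia.
    by left; rewrite addn1 -addnS -mj -cycb.
  - case: j hj => [|j] hj; first by left; rewrite addn0 -cycb.
    right; apply/inS; exists j; first lia.
    have -> : (i + j.+1 + 5 = i + j + 6)%N by lia.
    by rewrite /trn modnDr.
  - by left; have := ca j; rewrite mem_iota => /(_ hj) /andP[_]; rewrite cycr.
suff : trn v i \in S.
  rewrite (_ : S = fset0) ?inE //; apply: (no_hole nh) => // p d; split=> h.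
  - apply: nb h _; exists d; right; split => //=; by rewrite addrK.
  - by apply: nb h _; exists d; left.
by apply/inS; exists 0%N => //; rewrite addn0.
Qed.
End Fan.

(** * Summing the local counts over all vertices *)

Section LocalCount.
Variables (R : realType) (kappa : nat) (T : {fset tile}).
Hypothesis hT : doku_tiling R kappa T.
Let wp := doku_well_placed hT.
Let nh := doku_no_holes hT.
Let cb := cbits T.
Let rb := rbits T.

Lemma covered_box : exists M, forall x, covered T x -> x.2 \in box M.
Proof.
have [M hM] := box_bound ([seq up t | t <- enum_fset T] ++ [seq dn t | t <- enum_fset T]).
exists M => -[b p]; rewrite /covered /=; case: b => /imfsetP[t /= tT ->]; apply: hM;
  rewrite mem_cat; apply/orP; [left|right]; exact: map_f.
Qed.

Section Sums.
Variable M : nat.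
Hypothesis hM : forall x, covered T x -> x.2 \in box M.
(** Summands that get shifted are supported in [box (M + 3)], and shifts are by vectors of [box 2],
    so sums over this larger box are translation invariant. *)
Let A := enum_fset (box (M + 6)).
Let uA : uniq A. Proof. exact: fset_uniq. Qed.
Definition small (w : lattice) := w \in box 2.

Lemma sum_shift (f : lattice -> nat) w : small w ->
  (forall v, f v != 0%N -> v \in box (M + 3)) ->
  (\sum_(v <- A) f (v + w)%R = \sum_(v <- A) f v)%N.
Proof.
move=> sw hf; rewrite -(big_map (fun v => v + w) xpredT f); apply: sum_support => //.
  by rewrite map_inj_uniq // => x y /addIr.
move=> u /hf; rewrite in_box => hu; apply/andP; split; last by rewrite [u \in A]in_box; lia.
apply/mapP; exists (u - w); last by rewrite subrK.
rewrite [_ \in A]in_box; move: sw; rewrite /small in_box.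
by case: u hu => x y; case: w => z t /=; lia.
Qed.

Lemma sum_covered b w : small w -> (\sum_(v <- A) covered T (b, (v + w)%R) = #|` T|)%N.
Proof.
move=> sw; rewrite (sum_shift (f := fun v => covered T (b, v) : nat) sw); last first.
  move=> v; case: (boolP (covered T (b, v))) => // cv _; move: (hM cv); rewrite !in_box /=; lia.
have sub : {subset (if b then [fset up t | t in T] else [fset dn t | t in T]) <= A}.
  by move=> v vu; have := @hM (b, v) vu; rewrite [_ \in A]in_box in_box /=; lia.
rewrite [LHS](sum_card uA sub); case: b {sub} => /=; rewrite card_in_imfset //.
- exact: (up_inj_in wp).
- exact: (dn_inj_in wp).
Qed.

Lemma small_in (x y : int) : (absz x <= 2)%N -> (absz y <= 2)%N -> small (x, y).
Proof. by move=> hx hy; rewrite /small in_box hx hy. Qed.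

Lemma sum_covered0 b : (\sum_(v <- A) covered T (b, v) = #|` T|)%N.
Proof.
rewrite -(@sum_covered b 0); last exact: small_in.
by apply: eq_bigr => v _; rewrite addr0.
Qed.

Lemma sum_count : (\sum_(v <- A) count id (cb v) = 6 * #|` T|)%N.
Proof.
rewrite (eq_bigr (fun v => (covered T (true, v) + (covered T (false, v) +
  (covered T (true, (v + (-1, 0))%R) + (covered T (false, (v + (0, -1))%R) + (covered T (true, (v + (0, -1))%R) +
  covered T (false, (v + (1, -1))%R))))))%N)); last by move=> v _; rewrite /cb /cbits /= addn0.
rewrite !big_split /= !sum_covered0 !sum_covered; [by rewrite !mulSn mul0n addn0|exact: small_in..].
Qed.

Lemma has_cb v : has id (cb v) = (v \in VT T).
Proof.
apply/idP/in_VT.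
  rewrite /cb /cbits has_map => /hasP[x xv /= cx].
  move: cx xv; case: x => -[] p; rewrite /covered /= => /imfsetP[t /= tT ->] tv; exists t => //;
    by rewrite mem_tris tv ?orbT.
move=> [t tT]; rewrite mem_tris /cb /cbits has_map => h; apply/hasP.
by case/orP: h => h; [exists (true, up t)|exists (false, dn t)] => //=; apply/imfsetP; exists t.
Qed.

Lemma tris_box (v : lattice) (x : tri) : x \in tris v -> x.2 \in box M -> v \in box (M + 6).
Proof.
case: x => c p; case: p => d e; case: v => a b; rewrite /tris !inE ?latE !xpair_eqE !in_box /=; lia.
Qed.

Lemma sum_VT : (\sum_(v <- A) has id (cb v) = #|` VT T|)%N.
Proof.
rewrite (eq_bigr (fun v => (v \in VT T) : nat)) => [|v _]; last by rewrite has_cb.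
apply: sum_card => // v; rewrite -has_cb /cb /cbits has_map => /hasP[x xv /= /hM].
exact: tris_box xv.
Qed.

Definition tot (f : seq bool -> nat) := (\sum_(v <- A) f (cb v))%N.

Lemma gap_total :
  (6 * #|` VT T| = 6 * #|` T| + tot (gap 1) + tot (gap 2) + tot (gap 3) + tot (gap 4) + tot (gap 5))%N.
Proof.
rewrite -sum_VT -sum_count /tot -!big_split big_distrr; apply: eq_bigr => v _.
have sz : size (cb v) = 6%N by [].
case: (boolP (has id (cb v))) => h; first exact: (gap_sum sz h).
by rewrite !gap_none //; move: h; rewrite has_count -leqNgt leqn0 => /eqP ->.
Qed.

Lemma tot12 : (tot (gap 2) + tot gap_one = tot (gap 1))%N.
Proof. by rewrite /tot -big_split; apply: eq_bigr => v _; exact: gap12. Qed.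

Definition rtot (f : seq bool -> seq bool -> nat) := (\sum_(v <- A) f (cb v) (rb v))%N.

Lemma supp_bits (P : nat -> bool) v :
  (forall i, P i -> (exists j, covered T (trn v j)) \/ (exists j, covered T (rimn v j))) ->
  forall i, (P i : nat) != 0%N -> v \in box (M + 3).
Proof.
move=> h i; case: (boolP (P i)) => // /h[] [j]; rewrite ?/trn ?/rimn;
  have : (j %% 6 < 6)%N by rewrite ltn_mod.
- move: (j %% 6)%N => [|[|[|[|[|[|//]]]]]] _ /= c _; move: (hM c); rewrite !in_box /=;
    case: (v) => a b /=; lia.
- move: (j %% 6)%N => [|[|[|[|[|[|//]]]]]] _ /= c _; move: (hM c); rewrite !in_box /=;
    case: (v) => a b /=; lia.
Qed.

Definition spoke (i : nat) : lattice :=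
  nth 0 [:: (1, 0); (0, 1); (-1, 1); (-1, 0); (0, -1); (1, -1)] (i %% 6).
Lemma spoke_small i : small (spoke i).
Proof.
rewrite /spoke; have : (i %% 6 < 6)%N by rewrite ltn_mod.
by move: (i %% 6)%N => [|[|[|[|[|[|//]]]]]] _; exact: small_in.
Qed.

Lemma cntE (P : nat -> bool) : cnt P = (\sum_(i < 6) P i)%N.
Proof. by rewrite /cnt !big_ord_recl big_ord0 /=. Qed.

Lemma cyc_per s i : cyc s (i + 6) = cyc s i.
Proof. by rewrite /cyc modnDr. Qed.

Lemma sum_rot (F : nat -> nat) k : (forall i, F (i + 6)%N = F i) ->
  (\sum_(i < 6) F (i + k)%N = \sum_(i < 6) F i)%N.
Proof.
move=> hF; elim: k => [|k IH]; first by apply: eq_bigr => i _; rewrite addn0.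
rewrite -IH big_ord_recr [RHS]big_ord_recl /= addnC; congr (_ + _)%N.
  by rewrite add0n -(hF k); congr F; lia.
by apply: eq_bigr => i _; rewrite /bump leq0n; congr F; lia.
Qed.

(** The same configuration is recorded at two different vertices: position [i] at [v] becomes
    position [i + k] at the outer end of spoke [i + l]. *)
Lemma recenter (P Q : lattice -> nat -> bool) (k l : nat) :
  (forall v i, Q v (i + 6)%N = Q v i) ->
  (forall v i, (Q v i : nat) != 0%N -> v \in box (M + 3)) ->
  (forall v i, (i < 6)%N -> Q (v + spoke (i + l)) (i + k)%N = P v i) ->
  (\sum_(v <- A) cnt (P v) = \sum_(v <- A) cnt (Q v))%N.
Proof.
move=> per supp h.
transitivity (\sum_(i < 6) \sum_(v <- A) Q v (i + k))%N.
  rewrite (eq_bigr (fun v => \sum_(i < 6) P v i)%N) => [|v _]; last exact: cntE.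
  rewrite exchange_big /=; apply: eq_bigr => i _.
  rewrite -(sum_shift (f := fun v => Q v (i + k)%N : nat) (spoke_small (i + l)) (fun v => @supp v _)).
  by apply: eq_bigr => v _; rewrite h.
rewrite exchange_big /=; apply: eq_bigr => v _; rewrite cntE.
by apply: (sum_rot (F := fun i => Q v i : nat)) => i; rewrite per.
Qed.

(** Both totals count an uncovered triangle together with two covered neighbours, across sides that
    meet at v. The right-hand one records it at the end of spoke [i + 1], where the triangle
    numbered [i] at v has number [i + 4]. *)
Lemma tot_one : tot gap_one = rtot rim_one.
Proof.
apply: (@recenter _ _ 4 1) => [v i|v i|v i hi].
- by rewrite -addnA (addnC 6) addnA !cyc_per.
- apply: (supp_bits (P := fun i => [&& cyc (cb v) (i + 5), ~~ cyc (cb v) i & cyc (rb v) i])).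
  by move=> j /and3P[]; rewrite /cb cycb => c _ _; left; eexists; exact: c.
- have [e1 e2 e3] : [/\ trn (v + spoke (i + 1)) (i + 4 + 5) = trn v (i + 1),
     trn (v + spoke (i + 1)) (i + 4) = trn v i & rimn (v + spoke (i + 1)) (i + 4) = trn v (i + 5)].
    rewrite /trn /rimn /spoke; move: i hi => [|[|[|[|[|[|//]]]]]] _; case: v => a b;
      by split; rewrite /= ?latE; congr (_, (_, _)); lia.
  rewrite /cb /rb !cycb !cycr e1 e2 e3.
  by case: (covered T _); case: (covered T _); case: (covered T _).
Qed.

(** The end of a sector of at least three triangles is recorded at the outer end of the spoke
    between its last two triangles. *)
Lemma tot_three : tot (gap 3) = rtot rim3.
Proof.
rewrite /tot (eq_bigr (fun v => gap3_end (cb v))) => [|v _]; last exact: gap3E.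
apply: (@recenter _ _ 3 0) => [v i|v i|v i hi].
- by rewrite -addnA (addnC 6) addnA !cyc_per.
- apply: (supp_bits (P := fun i => [&& cyc (rb v) (i + 5), ~~ cyc (cb v) (i + 5), ~~ cyc (cb v) i & ~~ cyc (rb v) i])).
  by move=> j /and4P[]; rewrite /rb cycr => c _ _ _; right; eexists; exact: c.
- have [e1 e2 e3 e4] : [/\ rimn (v + spoke (i + 0)) (i + 3 + 5) = trn v (i + 1),
     trn (v + spoke (i + 0)) (i + 3 + 5) = trn v i,
     trn (v + spoke (i + 0)) (i + 3) = trn v (i + 5) &
     rimn (v + spoke (i + 0)) (i + 3) = trn v (i + 4)].
    rewrite /trn /rimn /spoke; move: i hi => [|[|[|[|[|[|//]]]]]] _; case: v => a b;
      by split; rewrite /= ?latE; congr (_, (_, _)); lia.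
  by rewrite /cb /rb !cycb !cycr e1 e2 e3 e4.
Qed.

Lemma rim_total : (rtot rim_one + rtot caps <= rtot rim3)%N.
Proof.
rewrite /rtot -big_split /=; apply: leq_sum => v _; apply: fan_ineq => //.
exact: (no_fan nh).
Qed.

Lemma tot45 : (2 * tot (fun c => just1 c) + tot (fun c => just2 c) <= tot (gap 4) + tot (gap 5))%N.
Proof.
by rewrite /tot -big_split /= big_distrr /= -big_split /=; apply: leq_sum => v _; exact: gap45.
Qed.

Lemma sum_pairs (K : {fset lattice * 'I_3}) (s : 'I_3 -> lattice) :
  (forall d, small (s d)) -> (forall x, x \in K -> x.1 \in box (M + 3)) ->
  (\sum_(v <- A) \sum_d ((v + s d, d)%R \in K) = #|` K|)%N.
Proof.
move=> hs hK; rewrite exchange_big /=.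
transitivity (\sum_d \sum_(v <- A) ((v, d) \in K))%N.
  apply: eq_bigr => d _.
  rewrite (sum_shift (f := fun v => (v, d) \in K : nat) (hs d)) // => v.
  by case: (boolP ((v, d) \in K)) => // /hK.
rewrite exchange_big /= -(@sum_card _ K [seq (v, d) | v <- A, d <- enum 'I_3]).
- by rewrite big_allpairs; apply: eq_bigr => v _; rewrite big_enum.
- by apply: allpairs_uniq => //; [exact: enum_uniq|move=> [v d] [v' d'] _ _ [-> ->]].
- move=> [v d] /hK /= hv; apply/allpairsP; exists (v, d); split => //=; last exact: mem_enum.
  by move: hv; rewrite [v \in A]in_box in_box; lia.
Qed.

Lemma up_box (t : tile) : t \in T -> up t \in box M.
Proof. by move=> tT; apply: (@hM (true, up t)); apply/imfsetP; exists t. Qed.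
Lemma dn_box (t : tile) : t \in T -> dn t \in box M.
Proof. by move=> tT; apply: (@hM (false, dn t)); apply/imfsetP; exists t. Qed.

Lemma mu_small d : small (mu d). Proof. by elim/I3P: d; exact: small_in. Qed.
Lemma nuN_small d : small (- nu d). Proof. by elim/I3P: d; rewrite ?latE; exact: small_in. Qed.
Lemma delta_small d : small (delta d). Proof. by elim/I3P: d; exact: small_in. Qed.

(** Among the edges that bound a covered triangle, the short diagonals are the only ones that are
    not edges of tiles. *)
Lemma in_ETE (p : lattice) d : ((p + mu d, d) \in ET T) =
  (covered T (true, p) || covered T (false, p + delta d)) && (mktile p d \notin T).
Proof.
have mnd : mu d = delta d + nu d by elim/I3P: d; lat.
apply/in_ET/idP => [[t tT]|].
  rewrite mem_edges /= => /andP[dt /orP[]/eqP /(congr1 fst)]; rewrite /uedge /dedge [LHS]/= [RHS]/=.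
    move/addIr => pE; rewrite {1}/covered /= pE in_imfset //=; apply/negP => mT.
    have := up_inj_in wp mT tT; rewrite up_mktile => /(_ erefl) E.
    by move: dt; rewrite -E eqxx.
  rewrite mnd addrA => /addIr pE; rewrite [X in _ || X]/covered /= pE in_imfset //= orbT /=.
  apply/negP => mT; have := dn_inj_in wp mT tT; rewrite /dn up_mktile => /(_ pE) E.
  by move: dt; rewrite -E eqxx.
move=> /andP[/orP[]/imfsetP[t /= tT pE] nT]; exists t => //; rewrite mem_edges /=.
  have -> : d != t.2 by apply/negP => /eqP dt; move: nT; rewrite pE dt mktile_up tT.
  by rewrite /uedge pE eqxx.
have -> : d != t.2.
  apply/negP => /eqP dt; move: nT; rewrite (_ : p = up t) ?dt ?mktile_up ?tT //.
  by apply: (addIr (delta d)); rewrite pE dt.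
by rewrite /dedge -pE mnd addrA eqxx orbT.
Qed.

Lemma mk_covered (p : lattice) d : mktile p d \in T ->
  covered T (true, p) && covered T (false, p + delta d).
Proof.
move=> mT; apply/andP; split; apply/imfsetP; exists (mktile p d) => //=; by rewrite /dn up_mktile.
Qed.

Let g d (v : lattice) := covered T (true, v) && ~~ covered T (false, v + delta d).
Let k d (v : lattice) := covered T (false, v + delta d) && ~~ covered T (true, v).

Lemma add_box (p q : lattice) : p \in box M -> small q -> p + q \in box (M + 3).
Proof. by rewrite /small !in_box; case: p => a b; case: q => a' b' /=; lia. Qed.
Lemma edge_box (e : edge) : e \in ET T -> e.1 \in box (M + 3).
Proof.
move=> /in_ET[t tT]; rewrite mem_edges => /andP[_ /orP[]/eqP ->]; apply: add_box.
- exact: up_box.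
- exact: mu_small.
- exact: dn_box.
- by elim/I3P: e.2; exact: small_in.
Qed.
Lemma tile_box (t : tile) : t \in T -> t.1 \in box (M + 3).
Proof.
move=> tT; have -> : t.1 = up t - nu t.2 by rewrite /up addrK.
by apply: add_box; [exact: up_box|exact: nuN_small].
Qed.

(** [g] and [k] mark the boundary edges, with exactly one covered side. The covered triangles have 6
    tau sides in all; adding each boundary edge once more counts every tile edge and every diagonal
    twice. *)
Lemma edge_pairs : (\sum_(v <- A) \sum_d (g d v + k d v) + 6 * #|` T| = 2 * #|` ET T| + 2 * #|` T|)%N.
Proof.
rewrite -(@sum_pairs (ET T) mu mu_small edge_box).
rewrite -[in RHS](@sum_pairs T (fun d => - nu d) nuN_small tile_box).
have -> : (6 * #|` T| = \sum_(v <- A) \sum_d (covered T (true, v) + covered T (false, (v + delta d)%R)))%N.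
  rewrite exchange_big /= (eq_bigr (fun=> 2 * #|` T|)%N); first by rewrite sum_nat_const card_ord mulnA.
  move=> d _; rewrite big_split /= sum_covered0 sum_covered; first by rewrite mul2n addnn.
  exact: delta_small.
rewrite !big_distrr -!big_split; apply: eq_bigr => v _; rewrite !big_distrr -!big_split; apply: eq_bigr => d _.
rewrite in_ETE -/(mktile v d) /g /k; have := @mk_covered v d.
by case: (mktile v d \in T); case: (covered T _); case: (covered T _) => // /(_ isT).
Qed.

(** Turning around its two ends in the same sense, a boundary edge is crossed from covered to
    uncovered at exactly one of them. So starts of uncovered sectors correspond to boundary
    edges. *)
Lemma gap1_total : tot (gap 1) = (\sum_(v <- A) \sum_d (g d v + k d v))%N.
Proof.
pose F (v : lattice) : nat := (k 0%R v + (g 1%R v + (k 2%R (v + (-1, 0))%R + (g 0%R (v + (-1, 0))%R +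
  (k 1%R (v + (0, -1))%R + g 2%R (v + (0, -1))%R)))))%N.
have sg d : (forall v, (g d v : nat) != 0%N -> v \in box (M + 3)) /\
    (forall v, (k d v : nat) != 0%N -> v \in box (M + 3)).
  split=> v; rewrite /g /k.
    case: (boolP (covered T (true, v))) => // c _; move: (hM c); rewrite !in_box /=; lia.
  case: (boolP (covered T (false, v + delta d))) => // c _; move: (hM c) (delta_small d).
  rewrite /small !in_box; case: v {c} => a b; case: (delta d) => a' b' /=; lia.
rewrite /tot (eq_bigr F) => [|v _].
  rewrite /F !big_split /= (sum_shift (f := k 2) _ (sg 2).2) ?(sum_shift (f := g 0) _ (sg 0).1)
    ?(sum_shift (f := k 1) _ (sg 1).2) ?(sum_shift (f := g 2) _ (sg 2).1); try exact: small_in.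
  rewrite [RHS](eq_bigr (fun v => (g 0%R v + k 0%R v) + ((g 1%R v + k 1%R v) + (g 2%R v + k 2%R v)))%N).
    rewrite !big_split /=.
    move: (\sum_(_ <- A) g 0%R _)%N (\sum_(_ <- A) g 1%R _)%N (\sum_(_ <- A) g 2%R _)%N.
    move: (\sum_(_ <- A) k 0%R _)%N (\sum_(_ <- A) k 1%R _)%N (\sum_(_ <- A) k 2%R _)%N.
    by move=> x1 x2 x3 x4 x5 x6; rewrite -!plusE; lia.
  move=> v _; rewrite !big_ord_recl big_ord0 addn0; congr (g _ _ + k _ _ + (g _ _ + k _ _ + (g _ _ + k _ _)))%N;
    exact/val_inj.
rewrite /gap /cnt /cb /F /g /k /cyc /cbits /= !andbT ?addn0.
have e0 : v + delta 0 = v + (1, -1) by [].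
have e1 : v + delta 1 = v by case: (v) => a b; lat.
have e2 : v + (-1, 0) + delta 2 = v by case: (v) => a b; lat.
have e3 : v + (-1, 0) + delta 0 = v + (0, -1) by case: (v) => a b; lat.
have e4 : v + (0, -1) + delta 1 = v + (0, -1) by case: (v) => a b; lat.
have e5 : v + (0, -1) + delta 2 = v + (1, -1) by case: (v) => a b; lat.
by rewrite e0 e1 e2 e3 e4 e5.
Qed.
End Sums.
End LocalCount.

(** * The free end of a leaf and the sector count for leaves *)

Lemma sum_injP (K L : eqType) (P : pred K) (s : seq K) (l : seq L) (rel : L -> K -> Prop) :
  uniq l -> (forall x, x \in l -> exists u, [/\ u \in s, P u & rel x u]) ->
  (forall x y u, x \in l -> y \in l -> rel x u -> rel y u -> x = y) ->
  (size l <= \sum_(u <- s) P u)%N.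
Proof.
move=> ul ex inj; case: l ul ex inj => [//|x0 l] ul ex inj.
have [u0 _] := cid (ex x0 (mem_head _ _)).
have fP x : {u : K | x \in x0 :: l -> [/\ u \in s, P u & rel x u]}.
  case: (boolP (x \in x0 :: l)) => [xl|_]; last by exists u0.
  by have [u hu] := cid (ex x xl); exists u.
apply: (sum_inj (g := fun x => sval (fP x))) => // [x y xl yl E|x xl].
  have [_ _ rx] := svalP (fP x) xl; have [_ _ ry] := svalP (fP y) yl.
  by apply: (inj _ _ (sval (fP x))) => //; rewrite E.
by have [-> ->] := svalP (fP x) xl.
Qed.

Lemma tri_eqE (b c : bool) (p q : lattice) : ((b, p) == (c, q) :> tri) = (b == c) && (p == q).
Proof. by []. Qed.

(** Coverage relative to [up t] if [t], of class [k], were the only tile. Around a free end this is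
    the true coverage, which reduces the local picture to a finite check. *)
Definition cov0 (k : 'I_3) (x : tri) := (x == (true, 0)) || (x == (false, delta k)).
Definition outer (k d : 'I_3) (b : bool) : lattice * lattice :=
  if b then (mu d, mu d + dir d) else (delta k + nu d, delta k + nu d + dir d).
Definition cap_tris (p : lattice) i :=
  [:: trn p (i + 5); rimn p (i + 5); trn p i; rimn p i; trn p (i + 1); rimn p (i + 1)].
(** All six triangles of the cap must touch an endpoint [w1] or [w2] of the free end, since only
    there is the coverage known. [outer_check] searches for the apex in a 7 by 7 window. *)
Definition cap_check k w1 w2 (p : lattice) i :=
  all (fun x => x \in tris w1 ++ tris w2) (cap_tris p i) &&
  (map (cov0 k) (cap_tris p i) == [:: false; false; false; true; false; false]).
Definition outer_check k w1 w2 :=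
  ((just1 (map (cov0 k) (tris w1)) && just2 (map (cov0 k) (tris w2))) ||
   (just2 (map (cov0 k) (tris w1)) && just1 (map (cov0 k) (tris w2)))) &&
  has (fun a => has (fun b => has (fun i => cap_check k w1 w2 (Posz a - 3, Posz b - 3) i)
    (iota 0 6)) (iota 0 7)) (iota 0 7).
Definition leaf_check k d b := outer_check k (outer k d b).1 (outer k d b).2.

Lemma leaf_check_ok k d b : d != k -> leaf_check k d b.
Proof. by elim/I3P: k; elim/I3P: d => // _; case: b; vm_compute. Qed.

Lemma trn_shift q w i : trn (q + w) i = ((trn w i).1, q + (trn w i).2).
Proof. by rewrite /trn tris_shift (nth_map tri0) // ltn_mod. Qed.
Lemma rimn_shift q w i : rimn (q + w) i = ((rimn w i).1, q + (rimn w i).2).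
Proof. by rewrite /rimn rims_shift (nth_map tri0) // ltn_mod. Qed.

Section Leaves.
Variables (R : realType) (kappa : nat) (T : {fset tile}).
Hypothesis hT : doku_tiling R kappa T.
Let wp := doku_well_placed hT.

Lemma count_sum (K : Type) (P : pred K) s : count P s = (\sum_(i <- s) P i)%N.
Proof. by elim: s => [|x s IH]; rewrite ?big_nil ?big_cons //= IH. Qed.

Definition is_leaf (t : tile) := [exists d, leafdir T t d].
Definition leaves := [seq t <- enum_fset T | is_leaf t].
Definition arcs := (\sum_(t <- enum_fset T) \sum_(d | d != t.2) hasnext T t d)%N.

Lemma I3_third (k d : 'I_3) : exists d', (d' != k) && (d' != d).
Proof.
by elim/I3P: k; elim/I3P: d; first [by exists 0|by exists 1|by exists 2].
Qed.

(** Near its free end the leaf alone decides what is covered: one triangle at the acute corner, two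
    at the obtuse corner, and a cap in front. The last conjuncts let the leaf be recovered from each
    of the three items. *)
Lemma leaf_geom t : is_leaf t -> exists v1 v2 p i,
  [/\ just1 (cbits T v1), just2 (cbits T v2), is_cap (cbits T p) (rbits T p) i, (i < 6)%N &
     [/\ (forall s, s \in T -> v1 \in vertices s -> s = t),
         (forall s, s \in T -> v2 \in vertices s -> s = t) &
         (rimn p i = (true, up t)) \/ (rimn p i = (false, dn t))]].
Proof.
move=> /existsP[d ld]; have /and4P[tT dt _ _] := ld; have [d' /andP[d't d'd]] := I3_third t.2 d.
have [b hb] : exists b, forall s, s \in T -> s != t ->
    (up t + (outer t.2 d' b).1 \notin vertices s) /\ (up t + (outer t.2 d' b).2 \notin vertices s).
  case: (leaf_private hT ld d't d'd) => h; [exists true|exists false] => s sT st;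
    have [h1 h2] := h s sT st; move: h1 h2; rewrite /uedge /dedge /dn /outer /= !addrA; by split.
have := leaf_check_ok b d't; rewrite /leaf_check; move: (outer _ _ _).1 (outer _ _ _).2 hb => w1 w2 hb.
have cov w x : w = w1 \/ w = w2 -> x \in tris w -> covered T (x.1, up t + x.2) = cov0 t.2 x.
  move=> hw xw; have xs : (x.1, up t + x.2) \in tris (up t + w).
    by rewrite tris_shift; apply: (map_f (fun x : tri => (x.1, up t + x.2))).
  have priv s : s \in T -> up t + w \in vertices s -> s = t.
    move=> sT sv; apply/eqP/negPn/negP => /(hb s sT)[h1 h2].
    by case: hw sv => -> sv; [move: h1|move: h2]; rewrite sv.
  rewrite /cov0; case: x xw xs => c p /= xw xs.
  have -> : ((c, p) == (true, 0)) = ((c, up t + p) == (true, up t)).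
    by rewrite !tri_eqE -{2}(addr0 (up t)) (inj_eq (addrI _)).
  have -> : ((c, p) == (false, delta t.2)) = ((c, up t + p) == (false, dn t)).
    by rewrite !tri_eqE /dn (inj_eq (addrI _)).
  apply/idP/orP => [|[]/eqP ->]; last 2 first.
  - by apply/imfsetP; exists t.
  - by apply/imfsetP; exists t.
  rewrite /covered /=; case: c xs xw => xs xw /imfsetP[s /= sT E]; [left|right]; rewrite E;
    rewrite E in xs; by rewrite (priv s sT) // mem_tris xs ?orbT.
have cbE w : w = w1 \/ w = w2 -> cbits T (up t + w) = map (cov0 t.2) (tris w).
  move=> hw; rewrite /cbits tris_shift -map_comp; apply/eq_in_map => x xw /=; exact: cov hw xw.
have priv w s : w = w1 \/ w = w2 -> s \in T -> up t + w \in vertices s -> s = t.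
  move=> hw sT sv; apply/eqP/negPn/negP => /(hb s sT)[h1 h2].
  by case: hw sv => -> sv; [move: h1|move: h2]; rewrite sv.
move=> /andP[h12 /hasP[a _ /hasP[c _ /hasP[i i6]]]].
set p := ((Posz a - 3, Posz c - 3) : lattice); rewrite /cap_check => /andP[/and5P[m1 m2 m3 m4 /andP[m5 /andP[m6 _]]] /eqP[b1 b2 b3 b4 b5 b6]].
have i6' : (i < 6)%N by move: i6; rewrite mem_iota.
have covm x : x \in tris w1 ++ tris w2 -> covered T (x.1, up t + x.2) = cov0 t.2 x.
  by rewrite mem_cat => /orP[]; apply: cov; [left|right].
have cap : is_cap (cbits T (up t + p)) (rbits T (up t + p)) i.
  rewrite /is_cap !cycb !cycr !trn_shift !rimn_shift !covm //.
  by rewrite b1 b2 b3 b4 b5 b6.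
have rimE : rimn (up t + p) i = (true, up t) \/ rimn (up t + p) i = (false, dn t).
  move: b4; rewrite rimn_shift /cov0 => /orP[]/eqP -> /=; [left|right] => //; by rewrite addr0.
have c1 := cbE w1 (or_introl erefl); have c2 := cbE w2 (or_intror erefl).
have p1 s := @priv w1 s (or_introl erefl); have p2 s := @priv w2 s (or_intror erefl).
case/orP: h12 => /andP[j1 j2].
  by exists (up t + w1), (up t + w2), (up t + p), i; rewrite c1 c2.
by exists (up t + w2), (up t + w1), (up t + p), i; rewrite c1 c2.
Qed.

(** Let G_k be the total of [gap k] and l the number of leaves. The number of boundary edges is G_1
    = 4 tau - 2 [arcs] = 2 E - 4 tau. From [tot12] and [rim_total], G_2 + G_3 >= G_1 + l; from
    [tot45], G_4 + G_5 >= 3 l. Inserting these into 6 V = 6 tau + G_1 + ... + G_5 and V + tau <= E +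
    1 leaves 4 l <= G_1 + 6. *)
Lemma leaf_bound : (4 * size leaves + 2 * arcs <= 6 + 4 * #|` T|)%N.
Proof.
have [M hM] := covered_box T.
have ul : uniq leaves by apply: filter_uniq; exact: fset_uniq.
have lT t : t \in leaves -> is_leaf t /\ t \in T by rewrite mem_filter => /andP[].
have inA v : has id (cbits T v) -> v \in enum_fset (box (M + 6)).
  rewrite /cbits has_map => /hasP[x xv /= /hM]; exact: tris_box xv.
have hv v : has id (cbits T v) -> exists2 s, s \in T & v \in vertices s.
  by rewrite (has_cb T) => /in_VT.
have n1 : (size leaves <= tot T M (fun c => just1 c))%N.
  apply: (sum_injP (P := fun v => just1 (cbits T v))
    (rel := fun t v => has id (cbits T v) /\ forall s, s \in T -> v \in vertices s -> s = t)) => //.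
    move=> t /lT[/leaf_geom[v1 [v2 [p [i [j1 j2 _ _ [h1 h2 _]]]]]] tT]; exists v1.
    have hc : has id (cbits T v1) by rewrite has_count (eqP j1).
    by split => //; exact: inA.
  by move=> x y u _ _ [hc hx] [_ hy]; have [s sT us] := hv u hc; rewrite -(hx s sT us) (hy s sT us).
have n2 : (size leaves <= tot T M (fun c => just2 c))%N.
  apply: (sum_injP (P := fun v => just2 (cbits T v))
    (rel := fun t v => has id (cbits T v) /\ forall s, s \in T -> v \in vertices s -> s = t)) => //.
    move=> t /lT[/leaf_geom[v1 [v2 [p [i [j1 j2 _ _ [h1 h2 _]]]]]] tT]; exists v2.
    have hc : has id (cbits T v2) by case/andP: j2 => /eqP j2 _; rewrite has_count j2.
    by split => //; exact: inA.
  by move=> x y u _ _ [hc hx] [_ hy]; have [s sT us] := hv u hc; rewrite -(hx s sT us) (hy s sT us).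
have n3 : (size leaves <= rtot T M caps)%N.
  have -> : rtot T M caps = (\sum_(u <- [seq (p, i) | p <- enum_fset (box (M + 6)), i <- iota 0 6])
      is_cap (cbits T u.1) (rbits T u.1) u.2)%N.
    rewrite big_allpairs; apply: eq_bigr => v _; exact: count_sum.
  apply: (sum_injP (P := fun u => is_cap (cbits T u.1) (rbits T u.1) u.2)
    (rel := fun t u => (rimn u.1 u.2 = (true, up t)) \/ (rimn u.1 u.2 = (false, dn t)))) => //.
    move=> t /lT[/leaf_geom[v1 [v2 [p [i [_ _ cp i6 [_ _ rE]]]]]] tT]; exists (p, i); split => //.
    have sp : (cyc (rbits T p) i : nat) != 0%N by case/and5P: cp => _ _ _ ->.
    have pb : p \in box (M + 3).
      apply: (supp_bits hM (P := fun j => cyc (rbits T p) j) _ sp) => j.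
      by rewrite cycr => c; right; exists j.
    have pA : p \in enum_fset (box (M + 6)).
      by move: pb; rewrite [_ \in enum_fset _]in_box in_box; lia.
    by apply/allpairsP; exists (p, i); split; rewrite ?mem_iota.
  move=> x y u /lT[_ xT] /lT[_ yT] [] -> [] // => E.
    by apply: (up_inj_in wp) => //; exact: (congr1 snd E).
  by apply: (dn_inj_in wp) => //; exact: (congr1 snd E).
have ar : (\sum_(v <- enum_fset (box (M + 6))) \sum_d (covered T (true, v) && covered T (false, (v + delta d)%R)) = arcs + #|` T|)%N.
  rewrite (@sum_support _ (fun v => \sum_d (covered T (true, v) && covered T (false, (v + delta d)%R)))%N _
     [seq up t | t <- enum_fset T]); last 3 first.
  - exact: fset_uniq.
  - rewrite map_inj_in_uniq ?fset_uniq //; exact: (up_inj_in wp).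
  - move=> v; case: (boolP (covered T (true, v))) => [cv _|_]; last by rewrite big1.
    apply/andP; split; first by have := hM _ cv; rewrite [_ \in enum_fset _]in_box in_box /=; lia.
    by case/imfsetP: cv => t /= tT ->; apply: map_f.
  rewrite big_map /arcs -sum1_size -big_split big_seq [RHS]big_seq; apply: eq_bigr => t tT.
  have cu : covered T (true, up t) by apply/imfsetP; exists t.
  have cd : covered T (false, up t + delta t.2) by apply/imfsetP; exists t.
  by rewrite (bigD1 t.2) // cu cd; exact: (addnC 1%N _).
have ep := edge_pairs hT hM; have g1 := gap1_total hM.
have six : (\sum_(v <- enum_fset (box (M + 6))) \sum_d (covered T (true, v) + covered T (false, (v + delta d)%R)) = 6 * #|` T|)%N.
  rewrite exchange_big /= (eq_bigr (fun=> 2 * #|` T|)%N); first by rewrite sum_nat_const card_ord mulnA.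
  move=> d _; rewrite big_split /= (sum_covered0 hT hM) (sum_covered hT hM); first by rewrite mul2n addnn.
  exact: delta_small.
have S1 : (tot T M (gap 1) + 2 * (arcs + #|` T|) = 6 * #|` T|)%N.
  rewrite -six -ar g1 big_distrr -big_split; apply: eq_bigr => v _; rewrite big_distrr -big_split.
  by apply: eq_bigr => d _ /=; case: (covered T _); case: (covered T _).
rewrite -g1 in ep.
have := gap_total hT hM; have := tot12 T M; have := tot_one hM; have := tot_three hM; have := rim_total hT M.
have := tot45 T M; have := euler_le hT.
move: S1 ep n1 n2 n3; move: (tot T M (gap 1)) (tot T M (gap 2)) (tot T M (gap 3)) (tot T M (gap 4))
  (tot T M (gap 5)) (tot T M gap_one) (rtot T M rim_one) (rtot T M rim3) (rtot T M caps)
  (tot T M (fun c => just1 c)) (tot T M (fun c => just2 c)) arcs (size leaves) => *; lia.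
Qed.
End Leaves.

(** * Strips as directed chains of tiles *)

(** Shared edges are oriented from the upward half of one tile to the downward half of the next. *)
Definition nrel (d : 'I_3) (x y : tile) : bool := dn y == up x + delta d.
(** A linear form that vanishes on [dir d]. It grows by one at each step of a strip of direction
    [d], so strips cannot close up. *)
Definition lam (d : 'I_3) (p : lattice) : int :=
  match val d with 0%N => - p.2 | 1%N => - p.1 | _ => p.1 + p.2 end.

Lemma delta_inj : injective delta.
Proof. by move=> k l; elim/I3P: k; elim/I3P: l. Qed.

Lemma nrel_lam d x y : y.2 != d -> nrel d x y -> lam d (up y) = lam d (up x) + 1.
Proof.
rewrite /nrel /dn => yd /eqP E; have -> : up y = up x + delta d - delta y.2 by rewrite -E addrK.
clear E; case: (up x) => a b; move: yd; elim/I3P: y.2; elim/I3P: d => // _; rewrite ?latE /lam /=; lia.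
Qed.

Lemma nrel_two d d' x y : x.2 != d -> y.2 != d -> nrel d x y -> ~~ nrel d' y x.
Proof.
rewrite /nrel /dn => xd yd /eqP E; apply/negP => /eqP.
have -> : up y = up x + delta d - delta y.2 by rewrite -E addrK.
clear E; case: (up x) => a b; move: xd yd; elim/I3P: x.2; elim/I3P: y.2; elim/I3P: d => // _ _;
  elim/I3P: d'; rewrite ?latE => -[]; lia.
Qed.

Lemma nrel_dir d d' x y : nrel d x y -> nrel d' x y -> d = d'.
Proof. by rewrite /nrel => /eqP -> /eqP /addrI; exact: delta_inj. Qed.

Section Strips.
Variables (R : realType) (T : {fset tile}).
Hypothesis wp : forall s t : tile, s \in T -> t \in T -> s != t -> well_placed R s t.

Definition slot d (x : tile) := (x \in T) && (x.2 != d).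
(** At the ends of a chain [nx] and [pv] stay put. Iterating [pv] often enough therefore stops at
    the first tile, and as many steps as there are tiles suffice for [st]. *)
Definition nx d (x : tile) : tile := head x [seq y <- enum_fset T | nrel d x y].
Definition pv d (x : tile) : tile := head x [seq y <- enum_fset T | nrel d y x].
Definition st d (x : tile) : tile := iter #|` T| (pv d) x.

Lemma hasnextP (x : tile) d : reflect (exists2 y : tile, y \in T & nrel d x y) (hasnext T x d).
Proof.
apply: (iffP idP) => [/imfsetP[y /= yT h]|[y yT h]].
  by exists y => //; rewrite /nrel h.
by apply/imfsetP; exists y => //=; exact/esym/eqP.
Qed.
Lemma hasprevP (x : tile) d : reflect (exists2 y : tile, y \in T & nrel d y x) (hasprev T x d).
Proof.
apply: (iffP idP) => [/imfsetP[y /= yT h]|[y yT h]].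
  by exists y => //; rewrite /nrel -h subrK.
by apply/imfsetP; exists y => //=; rewrite (eqP h) addrK.
Qed.

Lemma nrel_fun d (x y z : tile) : y \in T -> z \in T -> nrel d x y -> nrel d x z -> y = z.
Proof. by move=> yT zT /eqP h /eqP h'; apply: (dn_inj_in wp) => //; rewrite h h'. Qed.
Lemma nrel_inj d (x y z : tile) : x \in T -> y \in T -> nrel d x z -> nrel d y z -> x = y.
Proof.
move=> xT yT /eqP h /eqP h'; apply: (up_inj_in wp) => //; apply: (addIr (delta d)).
by rewrite -h h'.
Qed.

Lemma nx_nrel d (x : tile) : hasnext T x d -> nx d x \in T /\ nrel d x (nx d x).
Proof.
move=> /hasnextP[y yT xy]; rewrite /nx.
have : y \in [seq y <- enum_fset T | nrel d x y] by rewrite mem_filter xy.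
case E : [seq y <- enum_fset T | nrel d x y] => [//|z s] _ /=.
have : z \in [seq y <- enum_fset T | nrel d x y] by rewrite E inE eqxx.
by rewrite mem_filter => /andP[].
Qed.
Lemma nx_id d (x : tile) : ~~ hasnext T x d -> nx d x = x.
Proof.
move=> nn; rewrite /nx; case E : [seq y <- enum_fset T | nrel d x y] => [//|z s].
have : z \in [seq y <- enum_fset T | nrel d x y] by rewrite E inE eqxx.
by rewrite mem_filter => /andP[xz zT]; case/hasnextP: nn; exists z.
Qed.
Lemma pv_nrel d (x : tile) : hasprev T x d -> pv d x \in T /\ nrel d (pv d x) x.
Proof.
move=> /hasprevP[y yT xy]; rewrite /pv.
have : y \in [seq y <- enum_fset T | nrel d y x] by rewrite mem_filter xy.
case E : [seq y <- enum_fset T | nrel d y x] => [//|z s] _ /=.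
have : z \in [seq y <- enum_fset T | nrel d y x] by rewrite E inE eqxx.
by rewrite mem_filter => /andP[].
Qed.
Lemma pv_id d (x : tile) : ~~ hasprev T x d -> pv d x = x.
Proof.
move=> nn; rewrite /pv; case E : [seq y <- enum_fset T | nrel d y x] => [//|z s].
have : z \in [seq y <- enum_fset T | nrel d y x] by rewrite E inE eqxx.
by rewrite mem_filter => /andP[xz zT]; case/hasprevP: nn; exists z.
Qed.

Lemma slot_nrel d (x y : tile) : slot d x -> y \in T -> nrel d x y -> slot d y.
Proof.
move=> /andP[xT xd] yT xy; rewrite /slot yT /=; apply/negP => /eqP yd.
have := up_inj_in wp yT xT; move: (eqP xy); rewrite /dn yd => /addIr E /(_ E) yx.
by move: xd; rewrite -yx yd eqxx.
Qed.
Lemma slot_nrelV d (x y : tile) : slot d y -> x \in T -> nrel d x y -> slot d x.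
Proof.
move=> /andP[yT yd] xT xy; rewrite /slot xT /=; apply/negP => /eqP xd.
have := dn_inj_in wp yT xT; rewrite (eqP xy) /dn xd => /(_ erefl) yx.
by move: yd; rewrite yx xd eqxx.
Qed.

Lemma slot_nx d (x : tile) : slot d x -> slot d (nx d x).
Proof.
case: (boolP (hasnext T x d)) => [/nx_nrel[nT xn] sx|/nx_id ->//].
exact: slot_nrel sx nT xn.
Qed.
Lemma slot_pv d (x : tile) : slot d x -> slot d (pv d x).
Proof.
case: (boolP (hasprev T x d)) => [/pv_nrel[nT xn] sx|/pv_id ->//].
exact: slot_nrelV sx nT xn.
Qed.
Lemma slot_iter_nx d x i : slot d x -> slot d (iter i (nx d) x).
Proof. by move=> sx; elim: i => //= i; exact: slot_nx. Qed.
Lemma slot_iter_pv d x i : slot d x -> slot d (iter i (pv d) x).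
Proof. by move=> sx; elim: i => //= i; exact: slot_pv. Qed.

Lemma pvK d x y : slot d x -> y \in T -> nrel d x y -> pv d y = x /\ nx d x = y.
Proof.
move=> sx yT xy; have xT : x \in T by case/andP: sx.
have [pT py] : pv d y \in T /\ nrel d (pv d y) y by apply: pv_nrel; apply/hasprevP; exists x.
have [nT nx'] : nx d x \in T /\ nrel d x (nx d x) by apply: nx_nrel; apply/hasnextP; exists y.
by split; [exact: nrel_inj pT xT py xy|exact: nrel_fun nT yT nx' xy].
Qed.

Lemma iter_fix (A : Type) (f : A -> A) x n : f x = x -> iter n f x = x.
Proof. by move=> fx; elim: n => //= n ->. Qed.

Lemma lam_iter_pv d x n : slot d x -> (forall i, (i < n)%N -> hasprev T (iter i (pv d) x) d) ->
  lam d (up (iter n (pv d) x)) = lam d (up x) - n%:Z.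
Proof.
move=> sx; elim: n => [|n IH] h; first by rewrite subr0.
have [pT pn] := pv_nrel (h n (leqnn _)).
have /andP[_ sd] := slot_iter_pv n sx.
have := nrel_lam sd pn; rewrite IH => [|i hi]; last by apply: h; lia.
by rewrite /=; lia.
Qed.

(** [lam] drops at every proper step back, so a longer chain would contain more distinct tiles than
    there are. *)
Lemma st_noprev d x : slot d x -> ~~ hasprev T (st d x) d.
Proof.
move=> sx; have [n hn nprev] : exists2 n, (n <= #|` T|)%N & ~~ hasprev T (iter n (pv d) x) d.
  apply: contrapT => nex.
  have all_prev i : (i <= #|` T|)%N -> hasprev T (iter i (pv d) x) d.
    by move=> hi; apply: contrapT => /negP ni; apply: nex; exists i.
  have lamE i : (i <= #|` T|)%N -> lam d (up (iter i (pv d) x)) = lam d (up x) - i%:Z.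
    by move=> hi; apply: lam_iter_pv => // j hj; apply: all_prev; lia.
  pose s := [seq iter i (pv d) x | i <- iota 0 #|` T|.+1].
  have us : uniq s.
    rewrite map_inj_in_uniq ?iota_uniq // => i j; rewrite !mem_iota !leq0n !andTb !add0n !ltnS => hi hj E.
    by have := lamE i hi; rewrite E (lamE j hj); lia.
  have : (size s <= size (enum_fset T))%N.
    apply: uniq_leq_size => // y /mapP[i _ ->].
    by have /andP[] := slot_iter_pv i sx.
  by rewrite size_map size_iota ltnn.
have -> : st d x = iter n (pv d) x; last by [].
by rewrite /st -(subnK hn) iterD iter_fix // pv_id.
Qed.

Lemma st_slot d x : slot d x -> slot d (st d x).
Proof. exact: slot_iter_pv. Qed.

Lemma iter_nx_pv d x n : slot d x -> exists2 i, (i <= n)%N & x = iter i (nx d) (iter n (pv d) x).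
Proof.
move=> sx; elim: n => [|n [i hi xE]]; first by exists 0%N.
case: (boolP (hasprev T (iter n (pv d) x) d)) => hp; last first.
  by exists i; [lia|rewrite /= (pv_id hp)].
have [pT pn] := pv_nrel hp.
have sp := slot_iter_pv n.+1 sx.
have /andP[yT _] := slot_iter_pv n sx.
by exists i.+1; rewrite ?ltnS // iterSr /= (pvK sp yT pn).2.
Qed.

Lemma st_iter d x : slot d x -> exists i, x = iter i (nx d) (st d x).
Proof. by move=> sx; have [i _ E] := iter_nx_pv #|` T| sx; exists i. Qed.

Lemma st_pv d x : slot d x -> st d (pv d x) = st d x.
Proof.
move=> sx; rewrite /st -iterSr /=.
by rewrite pv_id //; exact: st_noprev.
Qed.

Lemma st_nrel d x y : slot d x -> y \in T -> nrel d x y -> st d y = st d x.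
Proof.
move=> sx yT xy; have sy := slot_nrel sx yT xy.
by rewrite -(st_pv sy) (pvK sx yT xy).1.
Qed.
End Strips.

Lemma slotE (T : {fset tile}) d x : slot T d x = (x \in T) && (x.2 != d).
Proof. by []. Qed.

(** * Runs as maximal chains *)

Section Runs.
Variables (R : realType) (kappa : nat) (T : {fset tile}).
Hypothesis hT : doku_tiling R kappa T.
Let wp := doku_well_placed hT.
Notation slot := (slot T).
Notation nx := (nx T).
Notation st := (st T).
Let t0 : tile := (0, 0).

(** Consecutive shared edges are different sides of the tile between them, so the strip cannot turn
    back and the orientation of its first step persists. *)
Lemma strip_sorted s : is_strip T s -> exists d, all (slot d) s /\
  (sorted (nrel d) s \/ sorted (fun x y => nrel d y x) s).
Proof.
move=> [s2 us sub [e [h1 h2 h3]]]; pose d := (e 0%N).2.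
have ed i : (i.+1 < size s)%N -> (e i).2 = d by move=> hi; apply/eqP; apply: h2.
have nT i : (i < size s)%N -> nth t0 s i \in T by move=> hi; apply: sub; exact: mem_nth.
have E i : (i.+1 < size s)%N -> [/\ slot d (nth t0 s i), slot d (nth t0 s i.+1) &
   (e i = uedge (nth t0 s i) d /\ e i = dedge (nth t0 s i.+1) d) \/
   (e i = dedge (nth t0 s i) d /\ e i = uedge (nth t0 s i.+1) d)].
  move=> hi; have [a b] := h1 i hi; move: a b; rewrite !mem_edges (ed i hi) => /andP[a1 a2] /andP[b1 b2].
  have i1 := nT i (ltnW hi); have i2 := nT i.+1 hi.
  rewrite !slotE i1 i2 /= eq_sym a1 eq_sym b1; split => //.
  have ne : nth t0 s i != nth t0 s i.+1 by rewrite (nth_uniq t0 (ltnW hi) hi us) neq_ltn ltnSn.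
  case/orP: a2 => /eqP a2; case/orP: b2 => /eqP b2; [|by left|by right|].
  - by move: ne; rewrite (uedge_eq hT i1 i2 (etrans (esym a2) b2)) eqxx.
  - by move: ne; rewrite (dedge_eq hT i1 i2 (etrans (esym a2) b2)) eqxx.
exists d; split.
  apply/(all_nthP t0) => i hi; case: (ltnP i.+1 (size s)) => hi1; first by case: (E i hi1).
  case: i hi hi1 => [|i] hi hi1; first lia.
  by case: (E i hi).
have nxt i : (i.+2 < size s)%N -> e i != e i.+1 by move=> hi; have /and4P[] := h3 i hi.
case: (E 0%N s2) => _ _ [F0|B0]; [left|right]; apply/(sortedP t0) => i hi.
  suff [f1 f2] : e i = uedge (nth t0 s i) d /\ e i = dedge (nth t0 s i.+1) d.
    by apply/eqP; apply/(uedge_dedge (nth t0 s i) (nth t0 s i.+1) d); rewrite -f1.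
  elim: i hi => [//|i IH] hi; have [f1 f2] := IH (ltnW hi).
  case: (E i.+1 hi) => _ _ [//|[b1 _]].
  by have := nxt i hi; rewrite f2 b1 eqxx.
suff [f1 f2] : e i = dedge (nth t0 s i) d /\ e i = uedge (nth t0 s i.+1) d.
  by apply/eqP; apply/(uedge_dedge (nth t0 s i.+1) (nth t0 s i) d); rewrite -f2.
elim: i hi => [//|i IH] hi; have [f1 f2] := IH (ltnW hi).
case: (E i.+1 hi) => _ _ [[b1 _]|//].
by have := nxt i hi; rewrite f2 b1 eqxx.
Qed.

Lemma sorted_nrel_uniq d s : all (slot d) s -> sorted (nrel d) s -> uniq s.
Proof.
move=> /(all_nthP t0) as_ /(sortedP t0) ss.
have : sorted (fun x y : tile => lam d (up x) < lam d (up y)) s.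
  apply/(sortedP t0) => i hi; have /andP[_ sd] := as_ i.+1 hi.
  by rewrite (nrel_lam sd (ss i hi)) ltrDl.
apply: sorted_uniq => [y x z|x]; last by rewrite ltxx.
exact: lt_trans.
Qed.

Lemma uedge_neq_dedge d (t : tile) : slot d t -> uedge t d != dedge t d.
Proof.
move=> /andP[_ td]; apply/negP => /eqP /uedge_dedge; rewrite /dn => /addrI /delta_inj E.
by rewrite E eqxx in td.
Qed.

Lemma sorted_strip d s : (1 < size s)%N -> all (slot d) s ->
  sorted (nrel d) s \/ sorted (fun x y => nrel d y x) s -> is_strip T s.
Proof.
move=> s2 as_ so; have asn := all_nthP t0 as_.
have us : uniq s.
  case: so => so; first exact: sorted_nrel_uniq as_ so.
  by rewrite -rev_uniq (@sorted_nrel_uniq d) ?all_rev // rev_sorted.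
split => //; first by move=> x /(allP as_)/andP[].
case: so => /(sortedP t0) so.
- exists (fun i => uedge (nth t0 s i) d).
  have E i : (i.+1 < size s)%N -> uedge (nth t0 s i) d = dedge (nth t0 s i.+1) d.
    by move=> hi; apply/uedge_dedge/eqP/so.
  split=> [i hi|i j _ _|i hi]; last 2 first.
  + by rewrite /parallel eqxx.
  + have s1 := asn i.+1 (ltnW hi); have /andP[_ sd] := s1.
    rewrite /opposite /parallel eqxx andbT uedge_mem // (E i (ltnW hi)).
    by rewrite dedge_mem // eq_sym uedge_neq_dedge.
  + have /andP[_ s1] := asn i (ltnW hi); have /andP[_ s2'] := asn i.+1 hi.
    by rewrite uedge_mem // E // dedge_mem.
- exists (fun i => dedge (nth t0 s i) d).
  have E i : (i.+1 < size s)%N -> dedge (nth t0 s i) d = uedge (nth t0 s i.+1) d.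
    by move=> hi; apply/esym/uedge_dedge/eqP/so.
  split=> [i hi|i j _ _|i hi]; last 2 first.
  + by rewrite /parallel eqxx.
  + have s1 := asn i.+1 (ltnW hi); have /andP[_ sd] := s1.
    rewrite /opposite /parallel eqxx andbT dedge_mem // (E i (ltnW hi)).
    by rewrite uedge_mem // uedge_neq_dedge.
  + have /andP[_ s1] := asn i (ltnW hi); have /andP[_ s2'] := asn i.+1 hi.
    by rewrite dedge_mem // E // uedge_mem.
Qed.

Lemma run_rev s : is_run T s -> is_run T (rev s).
Proof.
have sr s' : is_strip T s' -> is_strip T (rev s').
  move=> hs; have [d [as_ so]] := strip_sorted hs; have [s2 _ _ _] := hs.
  apply: (@sorted_strip d); rewrite ?size_rev ?all_rev // !rev_sorted.
  by case: so; [right|left].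
move=> [hs mx]; split=> [|s' hs' inf]; first exact: sr.
by rewrite -(mx (rev s')) ?revK //; [exact: sr|rewrite -[s]revK infix_rev].
Qed.

Lemma path_traject d (x : tile) p : slot d x -> all (slot d) p -> path (nrel d) x p ->
  p = traject (nx d) (nx d x) (size p).
Proof.
elim: p x => [//|y p IH] x sx /= /andP[sy ap] /andP[xy yp].
have /andP[yT _] := sy; rewrite (pvK wp sx yT xy).2; congr (_ :: _); exact: IH.
Qed.

Definition is_start (u : tile * 'I_3) :=
  [&& slot u.2 u.1, hasnext T u.1 u.2 & ~~ hasprev T u.1 u.2].

Lemma run_start s : is_run T s -> exists2 u, is_start u &
  s = traject (nx u.2) u.1 (size s) \/ rev s = traject (nx u.2) u.1 (size s).
Proof.
have fwd s' d : is_run T s' -> all (slot d) s' -> sorted (nrel d) s' ->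
    exists2 u, is_start u & s' = traject (nx u.2) u.1 (size s').
  move=> [[s2 _ _ _] mx]; case: s' s2 mx => [//|x [//|y p]] _ mx /= /and3P[sx sy ap] /andP[xy yp].
  have /andP[yT _] := sy.
  exists (x, d); last first.
    by congr (_ :: _); rewrite /= (@path_traject d x (y :: p)) //= ?sy ?ap ?xy // ?size_traject.
  rewrite /is_start /fst /snd sx andTb; apply/andP; split; first by apply/hasnextP; exists y.
  apply/negP => /hasprevP[z zT zx]; have sz := slot_nrelV wp sx zT zx.
  have hs : is_strip T [:: z, x, y & p].
    by apply: (@sorted_strip d); rewrite //= ?sz ?sx ?sy ?zx ?xy //; left.
  have inf : infix [:: x, y & p] [:: z, x, y & p] by exact: (suffix_infix [:: z] _).
  by have /(congr1 size) /= := mx _ hs inf; lia.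
move=> rs; have [d [as_ so]] := strip_sorted rs.1; case: so => so.
  by have [u uS E] := fwd s d rs as_ so; exists u => //; left.
have [u uS E] : exists2 u, is_start u & rev s = traject (nx u.2) u.1 (size (rev s)).
  by apply: (fwd _ d); [exact: run_rev|rewrite all_rev|rewrite rev_sorted].
by exists u => //; right; rewrite size_rev in E.
Qed.
End Runs.

(** * Counting runs and the tiles on them *)

Section RunCount.
Variables (R : realType) (kappa : nat) (T : {fset tile}).
Hypothesis hT : doku_tiling R kappa T.
Let wp := doku_well_placed hT.
Notation slot := (slot T).
Notation nx := (nx T).
Notation st := (st T).
Let t0 : tile := (0, 0).

Lemma chain_stops d (x : tile) : slot d x -> exists n, ~~ hasnext T (iter n (nx d) x) d.
Proof.
move=> sx; apply: contrapT => nex.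
have all_next i : hasnext T (iter i (nx d) x) d.
  by apply: contrapT => /negP ni; apply: nex; exists i.
have lamE i : lam d (up (iter i (nx d) x)) = lam d (up x) + i%:Z.
  elim: i => [|i IH]; first by rewrite addr0.
  have [nT xn] := nx_nrel (all_next i).
  have /andP[_ sd] := slot_iter_nx wp i.+1 sx.
  by rewrite iterS (nrel_lam sd xn) IH; lia.
pose s := [seq iter i (nx d) x | i <- iota 0 #|` T|.+1].
have us : uniq s.
  rewrite map_inj_in_uniq ?iota_uniq // => i j _ _ E.
  by have := lamE i; rewrite E (lamE j); lia.
have : (size s <= size (enum_fset T))%N.
  apply: uniq_leq_size => // y /mapP[i _ ->].
  by have /andP[] := slot_iter_nx wp i sx.
by rewrite size_map size_iota ltnn.
Qed.

(** The chain from a start, followed until no next tile exists, extends at neither end; being a run,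
    it has [kappa] tiles. *)
Lemma start_run u : is_start T u -> [/\ (1 < kappa)%N, is_run T (traject (nx u.2) u.1 kappa),
  forall i, (i.+1 < kappa)%N -> hasnext T (iter i (nx u.2) u.1) u.2 &
  ~~ hasnext T (iter kappa.-1 (nx u.2) u.1) u.2].
Proof.
case: u => x d; rewrite /is_start /fst /snd => /and3P[sx hx px].
have := chain_stops sx; case/ex_minnP => n nn nmin.
have hn i : (i < n)%N -> hasnext T (iter i (nx d) x) d.
  by move=> hi; apply: contrapT => /negP h; have := nmin i h; rewrite leqNgt hi.
have n0 : (0 < n)%N by case: n nn {nmin hn} => //; rewrite hx.
have sl i := slot_iter_nx wp i sx.
have rel i : (i < n)%N -> nrel d (iter i (nx d) x) (iter i.+1 (nx d) x).
  by move=> /hn /nx_nrel[].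
suff rn : is_run T (traject (nx d) x n.+1).
  have kE : n.+1 = kappa by have := doku_run_size hT rn; rewrite size_traject.
  by rewrite -kE; split.
have aL : all (slot d) (traject (nx d) x n.+1) by apply/allP => y /trajectP[i _ ->].
split.
  have sz : (1 < size (traject (nx d) x n.+1))%N by rewrite size_traject ltnS.
  have so : sorted (nrel d) (traject (nx d) x n.+1).
    apply/(sortedP x) => i; rewrite size_traject => hi.
    by rewrite !nth_traject ?(ltnW hi) //; exact: rel.
  exact (sorted_strip sz aL (or_introl so)).
move=> s' hs' /infixP[p [q s'E]].
have [d' [as' so]] := strip_sorted hT hs'; move: as' so; rewrite {}s'E => as' so.
have Lc : traject (nx d) x n.+1 = [:: x, nx d x & traject (nx d) (nx d (nx d x)) n.-1].
  by case: n n0 {nn nmin hn rel aL as' so} => [//|n].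
have x1 := rel 0%N n0.
have xd : x.2 != d by case/andP: sx.
have yd : (nx d x).2 != d by case/andP: (sl 1%N).
(* A larger strip cannot read the chain backwards: its first two tiles fix the orientation, and then
   also the direction. *)
case: so => so; last first.
  move: so; rewrite Lc => /cat_sorted2[_] /= /andP[h _].
  by move: (nrel_two d' xd yd x1); rewrite h.
have dE : d' = d.
  move: so; rewrite Lc => /cat_sorted2[_] /= /andP[h _].
  exact: nrel_dir h x1.
rewrite dE in as' so.
have -> : q = [::].
  case: q as' so => [//|z q] as' so; exfalso.
  move: so as'; rewrite trajectSr -cats1 -!catA catA /= => /cat_sorted2[_] /= /andP[h _].
  rewrite all_cat => /andP[_ /= /and3P[_ /andP[zT _] _]].
  by case/hasnextP: nn; exists z.
case/lastP: p as' so => [|p y] as' so; first by rewrite cats0.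
exfalso; move: so as'; rewrite cat_rcons Lc => /cat_sorted2[_] /= /andP[h _].
rewrite all_cat => /andP[_ /= /and3P[/andP[yT _] _ _]].
by move/negP: px; apply; apply/hasprevP; exists y.
Qed.

Definition slots := [seq u <- [seq (t, d) | t <- enum_fset T, d <- enum 'I_3] | u.1.2 != u.2].
Definition starts := [seq u <- slots | is_start T u].

Lemma mem_slots u : (u \in slots) = slot u.2 u.1.
Proof.
case: u => t d; rewrite mem_filter !slotE andbC /=; congr (_ && _).
apply/allpairsP/idP => [[[t' d'] [tT _ [-> _]]]//|tT].
by exists (t, d); split => //; rewrite mem_enum.
Qed.
Lemma uniq_slots : uniq slots.
Proof.
apply: filter_uniq; apply: allpairs_uniq; [exact: fset_uniq|exact: enum_uniq|].
by move=> [t d] [t' d'] _ _ [-> ->].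
Qed.
Lemma mem_starts u : (u \in starts) = is_start T u.
Proof. by rewrite mem_filter mem_slots /is_start; case: (slot _ _) => //=; rewrite ?andbT ?andbF. Qed.

Lemma iter_start_inj d (x y : tile) i j : is_start T (x, d) -> is_start T (y, d) ->
  (i < kappa)%N -> (j < kappa)%N -> iter i (nx d) x = iter j (nx d) y -> x = y /\ i = j.
Proof.
move=> xs ys; have [_ _ hx _] := start_run xs; have [_ _ hy _] := start_run ys.
have /and3P[/= sx _ px] := xs; have /and3P[/= sy _ py] := ys.
elim: i j => [|i IH] [|j] hi hj //=.
- move=> E; exfalso; have [nT n] := nx_nrel (hy j hj).
  by move/negP: px; apply; apply/hasprevP; exists (iter j (nx d) y);
    [case/andP: (slot_iter_nx wp j sy)|rewrite E].
- move=> E; exfalso; have [nT n] := nx_nrel (hx i hi).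
  by move/negP: py; apply; apply/hasprevP; exists (iter i (nx d) x);
    [case/andP: (slot_iter_nx wp i sx)|rewrite -E].
- move=> E; have [nT n] := nx_nrel (hx i hi); have [nT' n'] := nx_nrel (hy j hj).
  have xT : iter i (nx d) x \in T by case/andP: (slot_iter_nx wp i sx).
  have yT : iter j (nx d) y \in T by case/andP: (slot_iter_nx wp j sy).
  rewrite /= in n n'; rewrite -E in n'.
  by have [-> ->] := IH j (ltnW hi) (ltnW hj) (nrel_inj wp xT yT n n').
Qed.

(** With [n = kappa] this lists once every pair of a tile and a direction in which it has a
    neighbour; with [n = kappa.-1] only pairs that have a next tile. *)
Definition walk n := [seq (iter i (nx u.2) u.1, u.2) | u <- starts, i <- iota 0 n].

Lemma uniq_walk n : (n <= kappa)%N -> uniq (walk n).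
Proof.
move=> nk; apply: allpairs_uniq; [exact: (filter_uniq _ uniq_slots)|exact: iota_uniq|].
move=> [? ?] [? ?] /allpairsP[[a b] [/= as_ bi [-> ->]]] /allpairsP[[a' b'] [/= as' bi' [-> ->]]].
case: a as_ => x d; case: a' as' => y e; rewrite !mem_starts /= => ys xs E.
have de : d = e by exact: (congr1 snd E).
rewrite -{}de in ys E *; move: bi bi'; rewrite !mem_iota !add0n => bi bi'.
by have [-> ->] := iter_start_inj xs ys (leq_trans bi nk) (leq_trans bi' nk) (congr1 fst E).
Qed.

Lemma size_walk n : size (walk n) = (size starts * n)%N.
Proof. by rewrite size_allpairs size_iota. Qed.

Lemma st_is_start d x : slot d x -> hasnext T x d || hasprev T x d -> is_start T (st d x, d).
Proof.
move=> sx h; rewrite /is_start /= (st_slot wp sx) (st_noprev wp sx) andbT andTb.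
apply/negPn/negP => nn; have [i xE] := st_iter wp sx.
have xs : x = st d x by rewrite {1}xE iter_fix // nx_id.
by move: h; rewrite xs (negPf nn) (negPf (st_noprev wp sx)).
Qed.

Lemma mem_walk u : (u \in walk kappa) = (u \in slots) && (hasnext T u.1 u.2 || hasprev T u.1 u.2).
Proof.
case: u => x d; rewrite mem_slots; apply/allpairsP/andP => [[[[y e] i] [/= ys ik [-> ->]]]|[/= sx h]].
  rewrite mem_starts in ys; have /and3P[/= sy hy py] := ys; rewrite /fst /snd.
  split; first exact: (slot_iter_nx wp i sy).
  case: i ik => [|i] ik; first by apply/orP; left.
  move: ik.
  rewrite mem_iota add0n => ik; have [_ _ hn _] := start_run ys.
  have [nT n] := nx_nrel (hn i ik).
  apply/orP; right; apply/hasprevP; exists (iter i (nx e) y) => //.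
  by case/andP: (slot_iter_nx wp i sy).
have ss := st_is_start sx h; have [k1 _ _ nl] := start_run ss; have [i xE] := st_iter wp sx.
exists ((st d x, d), minn i kappa.-1); split => /=; first by rewrite mem_starts.
  by rewrite mem_iota add0n (leq_ltn_trans (geq_minr _ _)) // prednK // ltnW.
congr pair; rewrite {1}xE; have [ik|ik] := leqP i kappa.-1 => //.
by rewrite -(subnK (ltnW ik)) iterD (iter_fix _ (nx_id nl)).
Qed.

Lemma count_nontrivial : count (fun u => hasnext T u.1 u.2 || hasprev T u.1 u.2) slots = (size starts * kappa)%N.
Proof.
rewrite -size_walk -size_filter; apply/perm_size/uniq_perm.
- exact: (filter_uniq _ uniq_slots).
- exact: uniq_walk.
- by move=> u; rewrite mem_walk mem_filter andbC.
Qed.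

Lemma arcs_ge : (size starts * kappa.-1 <= count (fun u => hasnext T u.1 u.2) slots)%N.
Proof.
rewrite -size_walk -size_filter; apply: uniq_leq_size; first by apply: uniq_walk; exact: leq_pred.
move=> u /allpairsP[[[y e] i] [/= ys ik ->]]; rewrite mem_starts in ys.
rewrite mem_filter mem_slots /=; have [k1 _ hn _] := start_run ys; have /and3P[/= sy _ _] := ys.
rewrite (slot_iter_nx wp i sy) andbT; apply: hn; move: ik; rewrite mem_iota add0n => ik; by rewrite -ltn_predRL.
Qed.

Definition run_of (u : tile * 'I_3) : set (seq tile) :=
  [set traject (nx u.2) u.1 kappa; rev (traject (nx u.2) u.1 kappa)].

Lemma runsE : runs T = [set run_of u | u in [set` starts]].
Proof.
apply/seteqP; split=> X.
  move=> [s rs <-]; have [u us sE] := run_start hT rs; exists u; first by rewrite /= mem_starts.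
  have sk := doku_run_size hT rs; rewrite sk in sE; rewrite /run_of.
  case: sE => <- //; rewrite revK; apply/seteqP; split=> z /= []; tauto.
move=> [u /=]; rewrite mem_starts => us <-; have [_ rs _ _] := start_run us.
by exists (traject (nx u.2) u.1 kappa).
Qed.

(** The first two tiles determine direction and orientation, so a chain never equals the reversal of
    a chain. *)
Lemma run_of_inj : {in [set` starts] &, injective run_of}.
Proof.
move=> u v; rewrite !inE /= !mem_starts => us vs E.
have [k1 _ hu _] := start_run us; have [_ _ hv _] := start_run vs.
have h : run_of v (traject (nx u.2) u.1 kappa) by rewrite -E; left.
have k2 : kappa = kappa.-2.+2 by lia.
have /and3P[su _ _] := us; have /and3P[sv _ _] := vs.
have [_ nu1] := nx_nrel (hu 0%N k1); have [_ nv1] := nx_nrel (hv 0%N k1).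
case: h => /= h.
  move: h nu1; rewrite k2 /= => -[uv] [n1 _] nu1.
  case: u v us vs E hu hv su sv nv1 uv n1 nu1 => x d [y e] /= _ _ _ _ _ _ _ nv1 -> n1 nu1.
  by rewrite /= n1 in nu1; rewrite (nrel_dir nu1 nv1).
have so1 : sorted (nrel u.2) (traject (nx u.2) u.1 kappa).
  apply/(sortedP u.1) => i; rewrite size_traject => hi.
  by rewrite !nth_traject ?(ltnW hi) //; have [] := nx_nrel (hu i hi).
have so2 : sorted (fun x y => nrel v.2 y x) (traject (nx u.2) u.1 kappa).
  rewrite h rev_sorted; apply/(sortedP v.1) => i; rewrite size_traject => hi.
  by rewrite !nth_traject ?(ltnW hi) //; have [] := nx_nrel (hv i hi).
exfalso; move: so1 so2; rewrite k2 /= => /andP[a _] /andP[b _].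
have /andP[_ s1] := slot_iter_nx wp 1 su; have /andP[_ s0] := su.
by move: (nrel_two v.2 s0 s1 a); rewrite b.
Qed.
End RunCount.

(** * Potentials of strips; strips meet at most once *)

Section Cross.
Variables (R : realType) (kappa : nat) (T : {fset tile}).
Hypothesis hT : doku_tiling R kappa T.
Let wp := doku_well_placed hT.
Let nh := doku_no_holes hT.
Notation slot := (slot T).
Notation nx := (nx T).
Notation st := (st T).

Lemma uedge_V (t : tile) d : slot d t -> (uedge t d).1 \in VT T /\ (uedge t d).1 + dir d \in VT T.
Proof.
move=> /andP[tT td]; have [h1 h2] := mem_vertices_edge (uedge_mem td).
by split; apply/in_VT; exists t.
Qed.
Lemma dedge_V (t : tile) d : slot d t -> (dedge t d).1 \in VT T /\ (dedge t d).1 + dir d \in VT T.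
Proof.
move=> /andP[tT td]; have [h1 h2] := mem_vertices_edge (dedge_mem td).
by split; apply/in_VT; exists t.
Qed.

Definition on_strip d r (e : edge) := (e.2 == d) && has (fun y => [&& slot d y, st d y == r &
  (e == uedge y d) || (e == dedge y d)]) (enum_fset T).

Lemma on_strip_u d r (y : tile) : slot d y -> on_strip d r (uedge y d) = (st d y == r).
Proof.
move=> sy; have /andP[yT _] := sy; rewrite /on_strip eqxx /=; apply/hasP/idP => [[z zT /and3P[sz zr]]|yr].
  case/orP=> /eqP; first by move/(uedge_eq hT yT zT) => ->.
  by move/uedge_dedge/eqP => yz; rewrite -(st_nrel wp sy zT yz).
by exists y => //; rewrite sy yr eqxx.
Qed.
Lemma on_strip_d d r (y : tile) : slot d y -> on_strip d r (dedge y d) = (st d y == r).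
Proof.
move=> sy; have /andP[yT _] := sy; rewrite /on_strip eqxx /=; apply/hasP/idP => [[z zT /and3P[sz zr]]|yr].
  case/orP=> /eqP; last by move/(dedge_eq hT yT zT) => ->.
  by move/esym/uedge_dedge/eqP => zy; rewrite (st_nrel wp sz yT zy).
by exists y => //; rewrite sy yr eqxx orbT.
Qed.

(** The sign of a crossing: the change in the potential of a strip of direction [d] along a crossed
    tile, from its downward to its upward side of direction [d']. That it depends only on the
    directions is what makes crossings add up. *)
Definition eps (d' d : 'I_3) : int :=
  if d' == 0 then -1 else if d' == 2 then 1 else if d == 2 then 1 else -1.

Lemma tail_shift (t : tile) d' d : d' != t.2 -> d != t.2 -> d != d' ->
  ((uedge t d').1 = (dedge t d').1 + dir d /\ eps d' d = 1 /\
     ((dedge t d').1 = (uedge t d).1 \/ (dedge t d').1 = (dedge t d).1)) \/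
  ((dedge t d').1 = (uedge t d').1 + dir d /\ eps d' d = -1 /\
     ((uedge t d').1 = (uedge t d).1 \/ (uedge t d').1 = (dedge t d).1)).
Proof.
rewrite /uedge /dedge /dn /=; case: (up t) => x y; elim/I3P: t.2; elim/I3P: d'; elim/I3P: d => // _ _ _;
  rewrite ?latE /eps /=;
  first [ left; split; [lat|split; [by []|first [left; lat | right; lat]]]
        | right; split; [lat|split; [by []|first [left; lat | right; lat]]] ].
Qed.

(** Consecutive edges of the strip have their tails joined by an edge of another direction, so the
    potential has one value at all tails, normalised to 0; the heads have value 1. Every other tile
    edge joins equal values, and (P1) spreads the range to all vertices. *)
Lemma strip_potential d (r : tile) : slot d r -> ~~ hasprev T r d ->
  exists h : lattice -> int,
  [/\ forall t e, t \in T -> e \in edges t -> h (e.1 + dir e.2) - h e.1 = (on_strip d r e)%:Z,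
      forall v, v \in VT T -> (h v == 0) || (h v == 1) &
      forall t, slot d t -> st d t == r -> h (uedge t d).1 = 0 /\ h (dedge t d).1 = 0].
Proof.
move=> sr nr; pose c (e : edge) : int := (on_strip d r e)%:Z.
have c0 (e : edge) : e.2 != d -> c e = 0 by move=> /negPf ed; rewrite /c /on_strip ed.
have [h0 hh0] : exists h : lattice -> int, forall (t : tile) (e : edge), t \in T -> e \in edges t ->
    h (e.1 + dir e.2) - h e.1 = c e.
  apply: (potential wp nh) => t e tT et; have [ed|ed] := eqVneq e d; last by rewrite !c0.
  have se : slot d t by rewrite !slotE tT eq_sym -ed.
  by rewrite ed /c on_strip_u // on_strip_d.
pose h (v : lattice) : int := h0 v - h0 (dedge r d).1.
have hh (t : tile) (e : edge) : t \in T -> e \in edges t -> h (e.1 + dir e.2) - h e.1 = c e.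
  move=> tT et; rewrite -(hh0 t e tT et) /h.
  by move: (h0 _) (h0 _) (h0 _) => a1 a2 a3; ring.
have tails (t : tile) : slot d t -> h (uedge t d).1 = h (dedge t d).1.
  move=> /andP[tT td]; have dt : d != t.2 by rewrite eq_sym.
  have [d'' /andP[a b]] : exists d'', (d'' != t.2) && (d'' != d).
    by clear -td; move: td; elim/I3P: t.2; elim/I3P: d => // _; first [by exists 0|by exists 1|by exists 2].
  have ta : t.2 != d'' by rewrite eq_sym.
  have hu := hh t (uedge t d'') tT (uedge_mem ta); have hd := hh t (dedge t d'') tT (dedge_mem ta).
  rewrite c0 // /= in hu; rewrite c0 // /= in hd.
  case: (tail_shift dt a b) => [[-> [_ []]]|[-> [_ []]]] ->; move: hu hd; rewrite /uedge /dedge /=; lia.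
have chain i : h (dedge (iter i (nx d) r) d).1 = 0.
  elim: i => [|i IH]; first by rewrite /h subrr.
  rewrite iterS; case: (boolP (hasnext T (iter i (nx d) r) d)) => [/nx_nrel[nT xn]|/nx_id ->//].
  rewrite -(proj2 (uedge_dedge _ _ _) (eqP xn)) tails; [exact: IH|exact: (slot_iter_nx wp)].
have zero (t : tile) : slot d t -> st d t == r -> h (uedge t d).1 = 0 /\ h (dedge t d).1 = 0.
  move=> s_t /eqP tr; have [i tE] := st_iter wp s_t; rewrite tr in tE.
  by rewrite tails // tE chain.
exists h; split => //.
pose g v := (h v == 0) || (h v == 1).
have gc : forall t u v, t \in T -> u \in vertices t -> v \in vertices t -> g u = g v.
  move=> t u v tT; apply: vertices_const => e et; have := hh t e tT et.
  have [ed|ed] := eqVneq e.2 d; last by rewrite c0 //; move/eqP; rewrite subr_eq0 => /eqP E; rewrite /g E.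
  move: et; rewrite mem_edges ed => /andP[dt' et]; have s_t : slot d t by rewrite !slotE tT eq_sym.
  have ce : c e = (st d t == r)%:Z.
    by case/orP: et => /eqP ->; rewrite /c ?on_strip_u // on_strip_d.
  rewrite ce; case: (boolP (st d t == r)) => tr; last first.
    by move/eqP; rewrite subr_eq0 => /eqP E; rewrite /g E.
  have [z1 z2] := zero t s_t tr.
  have te : h e.1 = 0 by case/orP: et => /eqP ->.
  by rewrite te subr0 => E; rewrite /g E te.
move=> v /in_VT[t tT vt]; rewrite -/(g v).
have /andP[rT rd] := sr.
have [rv _] := mem_vertices_edge (dedge_mem rd).
by rewrite (const_on_T hT gc tT rT vt rv) /g /h subrr.
Qed.

Lemma strip_cross (h : lattice -> int) d d' (r z : tile) :
  (forall t e, t \in T -> e \in edges t -> h (e.1 + dir e.2) - h e.1 = (on_strip d r e)%:Z) ->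
  d != d' -> slot d' z ->
  h (uedge z d').1 - h (dedge z d').1 = eps d' d * ((z.2 != d) && (st d z == r))%:Z.
Proof.
move=> hh dd /andP[zT zd']; have d'z : d' != z.2 by rewrite eq_sym.
have [zd|zd] := eqVneq z.2 d.
  have -> : (~~ true && (st d z == r)) = false by [].
  rewrite mulr0; have [d'' /andP[a b]] : exists d'', (d'' != z.2) && (d'' != d').
    by clear -d'z; move: d'z; elim/I3P: z.2; elim/I3P: d' => // _; first [by exists 0|by exists 1|by exists 2].
  have za : z.2 != d'' by rewrite eq_sym.
  have off (e : edge) : e.2 = d'' -> on_strip d r e = false.
    by move=> ed; rewrite /on_strip ed -zd (negPf a).
  have hu := hh z _ zT (uedge_mem za); have hd := hh z _ zT (dedge_mem za).
  rewrite off // in hu; rewrite off // in hd.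
  case: (tail_shift d'z a b) => [[-> [_ []]]|[-> [_ []]]] ->; move: hu hd; rewrite /uedge /dedge /=; lia.
have -> : (~~ false && (st d z == r)) = (st d z == r) by [].
have sz : slot d z by rewrite !slotE zT.
have dz : d != z.2 by rewrite eq_sym.
have hu := hh z _ zT (uedge_mem zd); have hd := hh z _ zT (dedge_mem zd).
rewrite on_strip_u // in hu; rewrite on_strip_d // in hd.
case: (tail_shift d'z dz dd) => [[-> [-> []]]|[-> [-> []]]] ->; move: hu hd; rewrite /uedge /dedge /=; lia.
Qed.

(** Along a strip of direction [d'], every crossing changes the potential of the other strip by the
    same sign. The range 0, 1 has room for one change only. *)
Lemma strips_meet_once d d' (x y : tile) : d != d' -> slot d x -> slot d' x -> slot d y -> slot d' y ->
  st d x = st d y -> st d' x = st d' y -> x = y.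
Proof.
move=> dd sx sx' sy sy' e e'.
have [h [hh range _]] := strip_potential (st_slot wp sx) (st_noprev wp sx).
have step z := @strip_cross h d d' (st d x) z hh dd.
have sgn : eps d' d = 1 \/ eps d' d = -1 by rewrite /eps; case: ifP; [right|case: ifP; [left|case: ifP; [left|right]]].
have key (u v : tile) i : slot d u -> slot d' u -> slot d v -> slot d' v ->
    st d u = st d x -> st d v = st d x -> v = iter i (nx d') u -> u = v.
  move=> su su' sv sv' eu ev.
  (* [m] counts the crossings met before step [n]. It is positive as soon as the chain has left [u],
     since [u] itself is a crossing. *)
  have mono n : exists m : nat, h (dedge (iter n (nx d') u) d').1 - h (dedge u d').1 = eps d' d * m%:Z
      /\ ((0 < m)%N \/ iter n (nx d') u = u).
    elim: n => [|n [m [hm ho]]]; first by exists 0%N; rewrite subrr mulr0; split => //; right.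
    rewrite iterS; case: (boolP (hasnext T (iter n (nx d') u) d')) => [/nx_nrel[nT xn]|/nx_id ->]; last by exists m.
    have sn := slot_iter_nx wp n su'.
    have st1 := step _ sn; rewrite (proj2 (uedge_dedge _ _ _) (eqP xn)) in st1.
    exists (m + ((iter n (nx d') u).2 != d) && (st d (iter n (nx d') u) == st d x))%N; split.
      by rewrite PoszD mulrDr -hm -st1; ring.
    left; case: ho => [m0|->]; first by rewrite addn_gt0 m0.
    by rewrite eu eqxx (proj2 (andP su)) addn_gt0 orbT.
  move=> vE; have [m [hm ho]] := mono i; rewrite -vE in hm ho.
  case: ho => [m0|//].
  have sv1 := step v sv'; rewrite ev eqxx (proj2 (andP sv)) /= in sv1.
  have r1 := range _ (uedge_V sv').1; have r2 := range _ (dedge_V su').1.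
  exfalso; clear -hm sv1 r1 r2 m0 sgn.
  move: hm sv1 r1 r2; move: (h _) (h _) (h _) => a1 a2 a3; case: sgn => ->; lia.
have [i xE] := st_iter wp sx'; have [j yE] := st_iter wp sy'; rewrite -e' in yE.
have [ij|ij] := leqP i j.
  apply: (key x y (j - i)%N) => //; apply: (etrans yE).
  by rewrite [in RHS]xE -iterD (subnK ij).
apply/esym/(key y x (i - j)%N) => //; apply: (etrans xE).
by rewrite [in RHS]yE -iterD (subnK (ltnW ij)).
Qed.
End Cross.

(** * Vertex positions from the potentials of all strips *)

Section Coordinates.
Variables (R : realType) (kappa : nat) (T : {fset tile}).
Hypothesis hT : doku_tiling R kappa T.
Let wp := doku_well_placed hT.
Notation slot := (slot T).
Notation nx := (nx T).
Notation st := (st T).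

Definition good_potential (u : tile * 'I_3) (h : lattice -> int) :=
  [/\ forall t e, t \in T -> e \in edges t -> h (e.1 + dir e.2) - h e.1 = (on_strip T u.2 u.1 e)%:Z,
      forall v, v \in VT T -> (h v == 0) || (h v == 1) &
      forall t, slot u.2 t -> st u.2 t == u.1 -> h (uedge t u.2).1 = 0 /\ h (dedge t u.2).1 = 0].

Lemma potentials : exists H : tile * 'I_3 -> lattice -> int, forall u,
  slot u.2 u.1 -> ~~ hasprev T u.1 u.2 -> good_potential u (H u).
Proof.
have P u : {h | slot u.2 u.1 -> ~~ hasprev T u.1 u.2 -> good_potential u h}.
  apply: cid; case: (boolP (slot u.2 u.1 && ~~ hasprev T u.1 u.2)) => [/andP[s1 s2]|h].
    by have [h hh] := strip_potential hT s1 s2; exists h.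
  by exists (fun=> 0) => s1 s2; rewrite s1 s2 in h.
by exists (fun u => sval (P u)) => u; exact: (svalP (P u)).
Qed.

Variable roots : seq (tile * 'I_3).
Hypothesis uroots : uniq roots.
Hypothesis mem_roots : forall u, (u \in roots) = slot u.2 u.1 && ~~ hasprev T u.1 u.2.
Variable H : tile * 'I_3 -> lattice -> int.
Hypothesis hH : forall u, slot u.2 u.1 -> ~~ hasprev T u.1 u.2 -> good_potential u (H u).

(** Each tile edge lies in exactly one strip, single tiles included. Along it one potential grows by
    one, and the position by the direction of that strip. *)
Lemma coord_const (p q : lattice) : p \in VT T -> q \in VT T ->
  p - \sum_(w <- roots) dir w.2 *~ H w p = q - \sum_(w <- roots) dir w.2 *~ H w q.
Proof.
move=> /in_VT[s sT ps] /in_VT[t tT qt].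
pose g (v : lattice) : lattice := v - \sum_(w <- roots) dir w.2 *~ H w v.
suff gc : forall t u v, t \in T -> u \in vertices t -> v \in vertices t -> g u = g v.
  exact: (const_on_T hT gc sT tT ps qt).
move=> {s t p q sT tT ps qt} t p q tT; apply: (@vertices_const _ g) => e et; rewrite /g.
have et' := et; move: et'; rewrite mem_edges => /andP[dt ee].
have s_t : slot e.2 t by rewrite !slotE tT eq_sym.
have on (w : tile * 'I_3) : on_strip T w.2 w.1 e = (w == (st e.2 t, e.2)).
  case: w => x d /=; have [<-|de] := eqVneq e.2 d; last first.
    by rewrite /on_strip (negPf de) xpair_eqE (eq_sym d) (negPf de) andbF.
  rewrite xpair_eqE eqxx andbT (eq_sym x).
  case/orP: ee => /eqP E.
    have -> : on_strip T e.2 x e = on_strip T e.2 x (uedge t e.2) by rewrite -E.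
    by rewrite (on_strip_u hT).
  have -> : on_strip T e.2 x e = on_strip T e.2 x (dedge t e.2) by rewrite -E.
  by rewrite (on_strip_d hT).
have w0 : (st e.2 t, e.2) \in roots by rewrite mem_roots /= (st_slot wp s_t) (st_noprev wp s_t).
have -> : \sum_(w <- roots) dir w.2 *~ H w (e.1 + dir e.2) =
    \sum_(w <- roots) dir w.2 *~ H w e.1 + dir e.2.
  transitivity (\sum_(w <- roots) (dir w.2 *~ H w e.1 + dir w.2 *~ (w == (st e.2 t, e.2))%:Z)).
    apply: eq_big_seq => w; rewrite mem_roots => /andP[w1 w2]; have [hh _ _] := hH w1 w2.
    have E := hh t e tT et; rewrite on in E.
    have -> : H w (e.1 + dir e.2) = H w e.1 + (w == (st e.2 t, e.2))%:Z by rewrite -E [RHS]addrC subrK.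
    by rewrite mulrzDr.
  rewrite big_split /=; congr (_ + _); rewrite (bigD1_seq _ w0) //= eqxx mulr1z big1 ?addr0 //.
  by move=> w /negPf ->; rewrite mulr0z.
by rewrite opprD addrACA subrr addr0.
Qed.

(** If the strip is one tile, no other tile has an edge on it, and by (P3) the other tiles are still
    joined. *)
Lemma trivial_const u (s s' : tile) (p q : lattice) : slot u.2 u.1 -> ~~ hasprev T u.1 u.2 ->
  ~~ hasnext T u.1 u.2 -> s \in T -> s' \in T -> s != u.1 -> s' != u.1 ->
  p \in vertices s -> q \in vertices s' -> H u p = H u q.
Proof.
move=> su np nn sT s'T sn sn' ps qs; have [hh _ _] := hH su np.
have uT : u.1 \in T by case/andP: su.
suff gc : forall t x y, t \in T -> t != u.1 -> x \in vertices t -> y \in vertices t -> H u x = H u y.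
  exact: (const_removed hT uT gc sT s'T sn sn' ps qs).
move=> t x y tT tu; apply: (@vertices_const _ (H u)) => e et.
have := hh t e tT et; move: (et); rewrite mem_edges => /andP[dt ee].
have s_t : slot e.2 t by rewrite !slotE tT eq_sym.
suff -> : on_strip T u.2 u.1 e = false by move/eqP; rewrite subr_eq0 => /eqP.
have [du|du] := eqVneq e.2 u.2; last by rewrite /on_strip (negPf du).
have -> : on_strip T u.2 u.1 e = (st u.2 t == u.1).
  rewrite -du; case/orP: ee => /eqP E.
    have -> : on_strip T e.2 u.1 e = on_strip T e.2 u.1 (uedge t e.2) by rewrite -E.
    by rewrite (on_strip_u hT).
  have -> : on_strip T e.2 u.1 e = on_strip T e.2 u.1 (dedge t e.2) by rewrite -E.
  by rewrite (on_strip_d hT).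
apply/negP => /eqP stu; rewrite du in s_t; have [i tE] := st_iter wp s_t.
by move: tu; rewrite tE stu iter_fix ?eqxx // nx_id.
Qed.

(** The step at the crossing forces the potential to the upper or lower end of its range according
    to the sign, and a further step would leave the range. So the final value depends on the two
    directions only. *)
Lemma crossed_value u d (r z : tile) n i : slot u.2 u.1 -> ~~ hasprev T u.1 u.2 -> u.2 != d ->
  slot d r -> (i < n)%N -> z = iter i (nx d) r -> z.2 != u.2 -> st u.2 z = u.1 ->
  (forall j, (j < n)%N -> hasnext T (iter j (nx d) r) d) ->
  H u (dedge (iter n (nx d) r) d).1 = (eps d u.2 == 1)%:Z.
Proof.
move=> su np ud sr hi zE zu zs hn; have [hh range _] := hH su np.
have step m : (m < n)%N -> H u (dedge (iter m.+1 (nx d) r) d).1 =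
    H u (dedge (iter m (nx d) r) d).1 + eps d u.2 * (((iter m (nx d) r).2 != u.2) && (st u.2 (iter m (nx d) r) == u.1))%:Z.
  move=> hm; have [nT xn] := nx_nrel (hn m hm).
  rewrite iterS -(proj2 (uedge_dedge _ _ _) (eqP xn)).
  by rewrite -(strip_cross hT hh ud (slot_iter_nx wp m sr)) addrC subrK.
have sgn : eps d u.2 = 1 \/ eps d u.2 = -1.
  by rewrite /eps; case: ifP; [right|case: ifP; [left|case: ifP; [left|right]]].
have V m := range _ (dedge_V (slot_iter_nx wp m sr)).1.
have stepi : H u (dedge (iter i.+1 (nx d) r) d).1 = H u (dedge (iter i (nx d) r) d).1 + eps d u.2.
  by rewrite step // -zE zu zs eqxx mulr1.
have goal_i m : (m <= n - i.+1)%N -> H u (dedge (iter (m + i.+1) (nx d) r) d).1 = (eps d u.2 == 1)%:Z.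
  elim: m => [|m IH] hm.
    rewrite add0n; have := V i; have := V i.+1; rewrite stepi; case: sgn => -> /=; lia.
  have := V (m.+1 + i.+1)%N; rewrite addSn step; last lia.
  rewrite IH; last lia.
  case: (_ && _); rewrite ?mulr0 ?addr0 ?mulr1 //; case: sgn => -> //=.
by have := goal_i (n - i.+1)%N (leqnn _); rewrite subnK.
Qed.
End Coordinates.

(** * Identities between directions and the arithmetic of the lower bound *)

(** The three elements of ['I_3] add up to zero, so for [a != b] this is the remaining direction. *)
Definition third (a b : 'I_3) : 'I_3 := - (a + b).

Lemma third_neql a b : a != b -> third a b != a.
Proof. by elim/I3P: a; elim/I3P: b. Qed.
Lemma third_neqr a b : a != b -> third a b != b.
Proof. by elim/I3P: a; elim/I3P: b. Qed.
Lemma dir_delta d k l : k != d -> l != d -> k != l ->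
  (dir d + delta k == delta l) || (dir d + delta l == delta k).
Proof. by elim/I3P: d; elim/I3P: k; elim/I3P: l. Qed.

(** Only two classes differ from [d], so [k0 = k2], and adding the two equations would give
    [dir d + dir d = 0]. *)
Lemma dir_delta3 d k0 k1 k2 : k0 != d -> k1 != d -> k2 != d -> k0 != k1 -> k1 != k2 ->
  dir d + delta k1 == delta k0 -> dir d + delta k2 == delta k1 -> False.
Proof. by elim/I3P: d; elim/I3P: k0; elim/I3P: k1; elim/I3P: k2. Qed.

Lemma dir_mulz2 d : dir d *~ 2 = dir d + dir d.
Proof. by rewrite -[2]/(1 + 1) mulrzDr mulr1z. Qed.

Lemma dir_neq0 d : dir d != 0.
Proof. by elim/I3P: d. Qed.

Lemma sum_neq3 (k : 'I_3) (F : 'I_3 -> nat) : (\sum_(d | d != k) F d = F (k + 1)%R + F (k + 2)%R)%N.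
Proof.
rewrite (bigD1 (k + 1)) /=; last by elim/I3P: k.
rewrite (bigD1 (k + 2)) /=; last by elim/I3P: k.
rewrite big1 ?addn0 // => i; by elim/I3P: k; elim/I3P: i.
Qed.

Lemma card_uniq_seq (K : choiceType) (s : seq K) : uniq s -> ([set` s] #= `I_(size s))%card.
Proof.
case: s => [|x0 s] us.
  by rewrite (_ : [set` [::]] = set0) ?II0 //; apply/seteqP; split.
have -> : [set` x0 :: s] = nth x0 (x0 :: s) @` `I_(size (x0 :: s)).
  apply/seteqP; split=> [x /= xs|x [i /= hi <-]]; last exact: mem_nth.
  by exists (index x (x0 :: s)); [move: xs; rewrite -index_mem|exact: nth_index].
apply: inj_card_eq => i j; rewrite !inE => hi hj /eqP; rewrite nth_uniq // => /eqP; exact.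
Qed.

Lemma sum01 (K : eqType) (f : K -> int) (D : seq K) : (forall w, w \in D -> (f w == 0) || (f w == 1)) ->
  [/\ 0 <= \sum_(w <- D) f w, \sum_(w <- D) f w <= (size D)%:Z &
      forall r, r \in D -> f r = 0 -> \sum_(w <- D) f w < (size D)%:Z].
Proof.
elim: D => [|x D IH] h; first by rewrite big_nil.
have [|a b c] := IH; first by move=> w wD; apply: h; rewrite inE wD orbT.
have hx : f x = 0 \/ f x = 1 by case/orP: (h x (mem_head _ _)) => /eqP; [left|right].
rewrite big_cons -[size (x :: D)]/(size D).+1 intS; clear IH h.
move: a b c; move: (\sum_(w <- D) f w) (size D)%:Z => S z a b c.
have S1 : 0 <= f x + S by lia.
have S2 : f x + S <= 1 + z by lia.
split=> // r; rewrite inE => /orP[/eqP -> fx|rD fr]; first by lia.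
by have := c r rD fr; lia.
Qed.

(** Put r = a + b + c, e = ab + bc + ca and 3 kappa = 2 r + m. From 3 e <= r^2 the hypotheses yield
    r m <= 3 r + 9 and 12 t >= 9 kappa^2 - m^2, which settles m <= 3. For m >= 4 this gives r <= 9,
    and kappa >= 5 leaves only m = 4, r = 7, kappa = 6; then e = 16, attained only by 3 + 2 + 2. *)
Lemma tiling_arith (kappa t l a b c : nat) : (5 <= kappa)%N -> (0 < t)%N -> (l <= t)%N ->
  (2 * t = kappa * (a + b + c) + l)%N -> (l <= a + b + c + 3)%N ->
  (t <= l + (a * b + b * c + c * a))%N ->
  (3 * (kappa * kappa) <= 4 * t + 3)%N \/
  kappa = 6 /\ [\/ (a = 3 /\ b + c = 4)%N, (b = 3 /\ c + a = 4)%N | (c = 3 /\ a + b = 4)%N].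
Proof.
move=> k5 t0 lt h2 h3 h4.
have AG x y : (2 * (x * y) <= x * x + y * y)%N by have := (nat_Cauchy x y).1; rewrite -!mulnn.
have he : (3 * (a * b + b * c + c * a) <= (a + b + c) * (a + b + c))%N.
  by have := AG a b; have := AG b c; have := AG c a; nia.
clear AG.
have p0 : (0 < a + b + c)%N by nia.
set e := (a * b + b * c + c * a)%N in h4 he.
have [r rE] : exists r, r = (a + b + c)%N by exists (a + b + c)%N.
rewrite -rE in h2 h3 he p0.
have h1 : (3 * (kappa * r) <= 2 * (r * r) + 3 * r + 9)%N by lia.
have [c0|c0] := leqP (3 * kappa) (2 * r).
  left; have : (kappa * (3 * kappa) <= kappa * (2 * r))%N by rewrite leq_mul2l c0 orbT.
  by rewrite !(mulnCA kappa); lia.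
have [m mE] : exists m, (3 * kappa = 2 * r + m)%N by exists (3 * kappa - 2 * r)%N; lia.
have E1 : (9 * (kappa * kappa) = 4 * (r * r) + 4 * (r * m) + m * m)%N.
  have -> : (9 * (kappa * kappa) = (3 * kappa) * (3 * kappa))%N by ring.
  by rewrite mE; ring.
have E2 : (3 * (kappa * r) = 2 * (r * r) + r * m)%N.
  have -> : (3 * (kappa * r) = (3 * kappa) * r)%N by ring.
  by rewrite mE; ring.
have [m3|m4] := leqP m 3.
  left; have : (m * m <= 9)%N by nia.
  by lia.
have rm : (r * m <= 3 * r + 9)%N by lia.
have r4 : (r * 4 <= r * m)%N by rewrite leq_mul2l m4 orbT.
have r9 : (r <= 9)%N by lia.
have r6 : (6 <= r)%N.
  rewrite leqNgt; apply/negP => r5.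
  have h5 : (r = 1 \/ r = 2 \/ r = 3 \/ r = 4 \/ r = 5)%N by lia.
  by case: h5 => [E|[E|[E|[E|E]]]]; rewrite E in rm mE; lia.
have m4' : m = 4%N.
  apply/eqP; rewrite eqn_leq m4 andbT leqNgt; apply/negP => m5.
  have : (r * 5 <= r * m)%N by rewrite leq_mul2l m5 orbT.
  by lia.
right; have r7 : r = 7%N by lia.
have k6 : kappa = 6%N by lia.
split=> //; have e16 : e = 16%N by rewrite r7 k6 in h2 h3 he; lia.
move: e16; rewrite /e => e16.
have s7 : (a + b + c = 7)%N by lia.
have ck : all (fun x : nat => all (fun y : nat =>
    ((x + y <= 7) ==> (x * y + y * (7 - x - y) + (7 - x - y) * x == 16) ==>
    [|| x == 3, y == 3 | 7 - x - y == 3])%N) (iota 0 8)) (iota 0 8) by [].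
have cE : c = (7 - a - b)%N by lia.
rewrite cE in e16.
have a8 : a \in iota 0 8 by rewrite mem_iota add0n /=; lia.
have b8 : b \in iota 0 8 by rewrite mem_iota add0n /=; lia.
have ab7 : (a + b <= 7)%N by lia.
have h := allP (allP ck _ a8) _ b8.
rewrite /= ab7 e16 eqxx /= in h.
case/or3P: h => /eqP h; [apply: Or31|apply: Or32|apply: Or33]; lia.
Qed.

(** * Leaves, runs and the global inequalities *)

Section Counting.
Variables (R : realType) (kappa : nat) (T : {fset tile}).
Hypothesis hT : doku_tiling R kappa T.
Let wp := doku_well_placed hT.
Notation slot := (slot T).
Notation nx := (nx T).
Notation st := (st T).
Notation starts := (starts T).

Definition nstarts d := count (fun u : tile * 'I_3 => u.2 == d) starts.

Lemma count_slots (P : pred (tile * 'I_3)) :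
  count P (slots T) = (\sum_(t <- enum_fset T) \sum_(d | d != t.2) P (t, d))%N.
Proof.
rewrite count_sum big_filter big_mkcond big_allpairs; apply: eq_bigr => t _.
rewrite big_enum [RHS]big_mkcond; apply: eq_big => // d _.
by rewrite /= eq_sym.
Qed.

Lemma size_starts : size starts = (nstarts 0%R + nstarts 1%R + nstarts 2%R)%N.
Proof.
rewrite /nstarts; elim: starts => //= u s ->.
by elim/I3P: u.2 => /=; lia.
Qed.

Lemma adjacent_nontrivial (s y : tile) : s \in T -> y \in T -> Defs.adjacent s y ->
  exists2 d, d != s.2 & hasnext T s d || hasprev T s d.
Proof.
move=> sT yT [sy [e [es ey]]]; move: es ey; rewrite !mem_edges => /andP[ds es] /andP[dy ey].
exists e.2 => //; case/orP: es => /eqP es; case/orP: ey => /eqP ey.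
- by move: sy; rewrite (uedge_eq hT sT yT (etrans (esym es) ey)) eqxx.
- by apply/orP; left; apply/hasnextP; exists y => //; apply/eqP/uedge_dedge; rewrite -es.
- by apply/orP; right; apply/hasprevP; exists y => //; apply/eqP/uedge_dedge; rewrite -ey.
- by move: sy; rewrite (dedge_eq hT sT yT (etrans (esym es) ey)) eqxx.
Qed.

(** Alone in both of its directions, a tile would have no neighbour at all, against (P1); a second
    tile exists because (P3) leaves a nonempty set after the removal. *)
Lemma leafdir_unique (t : tile) d d' : leafdir T t d -> leafdir T t d' -> d = d'.
Proof.
move=> l l'; apply/eqP/negPn/negP => dd.
have /and4P[tT dt nn np] := l; have /and4P[_ dt' nn' np'] := l'.
have iso (y : tile) : y \in T -> Defs.adjacent t y -> False.
  move=> yT /(adjacent_nontrivial tT yT)[e et].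
  have [->|ed] := eqVneq e d; first by rewrite (negPf nn) (negPf np).
  have [->|ed'] := eqVneq e d'; first by rewrite (negPf nn') (negPf np').
  by move: et dt dt' dd ed ed'; elim/I3P: t.2; elim/I3P: d {l nn np}; elim/I3P: d' {l' nn' np'}; elim/I3P: e.
have [ne _] := doku_removal hT tT; case/fset0Pn: ne => s; rewrite !inE => /andP[/eqP st_ sT].
apply: st_.
apply: (graph_connected_ind (doku_adjacent_connected hT) (P := fun s => s = t) _ tT sT) => //.
by move=> x y xT yT xy E; exfalso; rewrite E in xy; exact: (iso y yT xy).
Qed.

Lemma sum_leafdir (t : tile) : t \in T -> (\sum_(d | d != t.2) leafdir T t d = is_leaf T t)%N.
Proof.
move=> tT; case: (boolP (is_leaf T t)) => [/existsP[d ld]|nl].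
  have /and4P[_ dt _ _] := ld; rewrite (bigD1 d) //= ld big1 // => i /andP[_ id_].
  by case: (boolP (leafdir T t i)) => // li; rewrite (leafdir_unique li ld) eqxx in id_.
rewrite big1 // => i _; case: (boolP (leafdir T t i)) => // li.
by case/negP: nl; apply/existsP; exists i.
Qed.

Lemma double_tiles : (2 * #|` T| = kappa * size starts + size (leaves T))%N.
Proof.
have E : count (fun u => ~~ (hasnext T u.1 u.2 || hasprev T u.1 u.2)) (slots T) = size (leaves T).
  rewrite count_slots size_filter count_sum !big_seq; apply: eq_bigr => t tT.
  rewrite -(sum_leafdir tT); apply: eq_bigr => d dt.
  by rewrite /leafdir tT dt /= negb_or.
have E2 : size (slots T) = (2 * #|` T|)%N.
  rewrite -(count_predT (slots T)) count_slots (eq_bigr (fun=> 2%N)); last by move=> t _; rewrite sum_neq3.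
  by rewrite big_const_seq count_predT iter_addn_0.
have F := count_predC (fun u : tile * 'I_3 => hasnext T u.1 u.2 || hasprev T u.1 u.2) (slots T).
have G := count_nontrivial hT.
by rewrite -E2 -F mulnC -G -E.
Qed.

(** A run has [kappa - 1] shared edges, so [leaf_bound] and [double_tiles] combine to 4 l + 2 rho
    (kappa - 1) <= 6 + 2 (kappa rho + l). *)
Lemma leaves_le : (size (leaves T) <= size starts + 3)%N.
Proof.
have A := leaf_bound hT; have B := arcs_ge hT; have C := double_tiles.
have k2 := doku_kappa hT; rewrite count_slots in B.
have D : (size starts * kappa.-1 + size starts = kappa * size starts)%N.
  by rewrite -{2}(muln1 (size starts)) -mulnDr addn1 prednK 1?mulnC // ltnW.
have B' : (size starts * kappa.-1 <= arcs T)%N by exact: B.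
clear B; move: A B' C D; move: (size starts * kappa.-1)%N (kappa * size starts)%N (arcs T) => X Y Z.
move: (#|` T|) (size (leaves T)) (size starts) => t l s; lia.
Qed.

Lemma nonleaf_start (x : tile) d : slot d x -> ~~ is_leaf T x -> is_start T (st d x, d).
Proof.
move=> sx nl; apply: (st_is_start hT sx); apply/negPn/negP; rewrite negb_or => h.
case/negP: nl; apply/existsP; exists d; have /andP[xT xd] := sx.
by rewrite /leafdir xT eq_sym xd.
Qed.

(** A non-leaf tile lies on a run in each of its two directions, and by [strips_meet_once] this pair
    of runs determines it. *)
Lemma core_class_le k :
  (count (fun t : tile => (t.2 == k) && ~~ is_leaf T t) (enum_fset T) <= nstarts (k + 1)%R * nstarts (k + 2)%R)%N.
Proof.
have N (i : 'I_3) : [&& i + 1 != i, i + 2 != i & i + 1 != i + 2] by elim/I3P: i.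
have /and3P[n1 n2 n12] := N k.
pose S d := [seq u.1 | u : tile * 'I_3 <- starts & u.2 == d].
have sS d : size (S d) = nstarts d by rewrite size_map size_filter.
rewrite -size_filter -!sS -(size_allpairs (fun x y : tile => (x, y))).
rewrite -(size_map (fun t : tile => (st (k + 1) t, st (k + 2) t))).
have sl (t : tile) d : d != k -> t \in T -> t.2 == k -> slot d t.
  by move=> dk tT /eqP tk; rewrite slotE tT tk eq_sym.
apply: uniq_leq_size.
  rewrite map_inj_in_uniq; first by apply: filter_uniq; exact: fset_uniq.
  move=> x y; rewrite !mem_filter => /andP[/andP[xk _] xT] /andP[/andP[yk _] yT] E.
  by apply: (strips_meet_once hT n12); rewrite ?sl //; [exact: (congr1 fst E)|exact: (congr1 snd E)].
move=> z /mapP[t]; rewrite mem_filter => /andP[/andP[tk nl] tT] ->.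
apply/allpairsP; exists (st (k + 1) t, st (k + 2) t); split => //=.
  apply/mapP; exists (st (k + 1) t, k + 1) => //; rewrite mem_filter eqxx mem_starts.
  exact: (nonleaf_start (sl _ _ n1 tT tk) nl).
apply/mapP; exists (st (k + 2) t, k + 2) => //; rewrite mem_filter eqxx mem_starts.
exact: (nonleaf_start (sl _ _ n2 tT tk) nl).
Qed.

Lemma core_le : (#|` T| <= size (leaves T) +
  (nstarts 0%R * nstarts 1%R + nstarts 1%R * nstarts 2%R + nstarts 2%R * nstarts 0%R))%N.
Proof.
have A := core_class_le 0; have B := core_class_le 1; have C := core_class_le 2.
have e1 : (0 + 1 : 'I_3) = 1 by apply/eqP.
have e2 : (0 + 2 : 'I_3) = 2 by apply/eqP.
have e3 : (1 + 1 : 'I_3) = 2 by apply/eqP.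
have e4 : (1 + 2 : 'I_3) = 0 by apply/eqP.
have e5 : (2 + 1 : 'I_3) = 0 by apply/eqP.
have e6 : (2 + 2 : 'I_3) = 1 by apply/eqP.
rewrite e1 e2 in A; rewrite e3 e4 in B; rewrite e5 e6 in C.
have D (s : seq tile) : size s = (count (is_leaf T) s + (count (fun t : tile => (t.2 == 0%R) && ~~ is_leaf T t) s
    + count (fun t : tile => (t.2 == 1%R) && ~~ is_leaf T t) s + count (fun t : tile => (t.2 == 2%R) && ~~ is_leaf T t) s))%N.
  elim: s => //= x s ->; case: (is_leaf T x); rewrite ?andbF ?andbT; elim/I3P: x.2 => /=; lia.
have L : size (leaves T) = count (is_leaf T) (enum_fset T) by rewrite size_filter.
rewrite L [X in (X <= _)%N](D (enum_fset T)) leq_add2l.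
by apply: leq_trans (leq_add (leq_add A B) C) _; rewrite addnC addnA.
Qed.

(** For a leaf, one of the two sides of direction [d] would touch no other tile by [leaf_private],
    yet there are neighbours across both. *)
Lemma inner_nonleaf d (x : tile) : slot d x -> hasnext T x d -> hasprev T x d -> ~~ is_leaf T x.
Proof.
move=> sx hn hp; apply/negP => /existsP[e le]; have /and4P[xT ex nn np] := le.
have de : d != e by apply/negP => /eqP E; rewrite -E hn in nn.
have /andP[_ xd] := sx; have dx : d != x.2 by rewrite eq_sym.
have irr (y : tile) : slot d y -> nrel d x y || nrel d y x -> y != x.
  move=> sy h; apply/eqP => E; rewrite E orbb in h.
  by have := nrel_two d xd xd h; rewrite h.
case: (leaf_private hT le dx de) => priv.
  case/hasnextP: hn => y yT xy; have sy := slot_nrel wp sx yT xy.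
  have [] := priv y yT (irr y sy _); first by rewrite xy.
  rewrite (proj2 (uedge_dedge _ _ _) (eqP xy)) => /negP[].
  by apply: (mem_vertices_edge (e := dedge y d) _).1; rewrite mem_edges eqxx orbT andbT eq_sym; case/andP: sy.
case/hasprevP: hp => y yT yx; have sy := slot_nrelV wp sx yT yx.
have [] := priv y yT (irr y sy _); first by rewrite yx orbT.
rewrite -(proj2 (uedge_dedge _ _ _) (eqP yx)) => /negP[].
by apply: (mem_vertices_edge (e := uedge y d) _).1; rewrite mem_edges eqxx andbT eq_sym; case/andP: sy.
Qed.

Lemma st_of_start d r : is_start T (r, d) -> st d r = r.
Proof. by case/and3P=> /= _ _ np; apply: iter_fix; exact: pv_id. Qed.

Lemma st_run d r i : is_start T (r, d) -> (i < kappa)%N -> st d (iter i (nx d) r) = r.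
Proof.
move=> rs; have [_ _ hn _] := start_run hT rs; have /and3P[/= sr _ _] := rs.
elim: i => [|i IH] ik; first exact: st_of_start.
have [nT n] := nx_nrel (hn i ik).
by rewrite iterS (st_nrel wp (slot_iter_nx wp i sr) nT n) IH // ltnW.
Qed.

Lemma run_prev d r i : is_start T (r, d) -> (i.+1 < kappa)%N -> hasprev T (iter i.+1 (nx d) r) d.
Proof.
move=> rs ik; have [_ _ hn _] := start_run hT rs; have /and3P[/= sr _ _] := rs.
have [nT n] := nx_nrel (hn i ik); apply/hasprevP; exists (iter i (nx d) r) => //.
by case/andP: (slot_iter_nx wp i sr).
Qed.

(** The two leaves stand on consecutive collinear edges. With equal classes they would be neighbours
    in the direction in which a leaf is alone; of the two orders of distinct classes, one makes
    their upward triangles coincide. *)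
Lemma leaf_gap d (L L' : tile) : slot d L -> slot d L' -> is_leaf T L -> is_leaf T L' ->
  hasprev T L d -> hasprev T L' d -> dn L' = dn L + dir d ->
  L.2 != L'.2 /\ dir d + delta L'.2 == delta L.2.
Proof.
move=> /andP[LT Ld] /andP[LT' Ld'] /existsP[l ll] /existsP[l' ll'] p p' E.
have /and4P[_ lL nn np] := ll; have /and4P[_ lL' nn' np'] := ll'.
have ld : l != d by apply/eqP => F; rewrite F p in np.
have E' : up L' + delta L'.2 = up L + delta L.2 + dir d by exact: E.
have [kk|kk] := eqVneq L.2 L'.2.
  exfalso; have lk : L.2 != l by rewrite eq_sym.
  case/orP: (dir_delta Ld ld lk) => /eqP F.
    case/hasnextP: nn; exists L' => //; apply/eqP; rewrite E -F /dn -addrA.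
    by rewrite (addrC (delta _)).
  case/hasprevP: np; exists L' => //; apply/eqP; apply: (addIr (dir d)).
  by rewrite -E /dn -kk -F -!addrA (addrC (dir d)).
split=> //; case/orP: (dir_delta Ld Ld' kk) => /eqP F; last exact/eqP.
exfalso; have uu : up L' = up L.
  by apply: (addIr (delta L'.2)); rewrite E' -F -addrA (addrC (delta _)).
have LL := up_inj_in wp LT' LT uu.
by move: E; rewrite LL => /eqP; rewrite -subr_eq0 opprD addNKr oppr_eq0 (negPf (dir_neq0 d)).
Qed.

(** The first tile and the direction of the strip that passes through [x] in its direction other
    than [d]. *)
Definition cross_start (x : tile) d := (st (third x.2 d) x, third x.2 d).

Lemma cross_start_inj d r i j : is_start T (r, d) -> (i < kappa)%N -> (j < kappa)%N ->
  cross_start (iter i (nx d) r) d = cross_start (iter j (nx d) r) d -> i = j.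
Proof.
move=> rs ik jk E; have /and3P[/= sr _ _] := rs.
have si := slot_iter_nx wp i sr; have sj := slot_iter_nx wp j sr.
have E2 : third (iter i (nx d) r).2 d = third (iter j (nx d) r).2 d by exact: (congr1 snd E).
have E1 : st (third (iter i (nx d) r).2 d) (iter i (nx d) r) = st (third (iter i (nx d) r).2 d) (iter j (nx d) r).
  by have := congr1 fst E; rewrite /cross_start /fst -E2.
have /andP[iT id_] := si; have /andP[jT jd] := sj.
have si' : slot (third (iter i (nx d) r).2 d) (iter i (nx d) r).
  by rewrite slotE iT eq_sym third_neql.
have sj' : slot (third (iter i (nx d) r).2 d) (iter j (nx d) r).
  by rewrite slotE jT E2 eq_sym third_neql.
have dd : d != third (iter i (nx d) r).2 d by rewrite eq_sym third_neqr.
have xy : iter i (nx d) r = iter j (nx d) r.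
  apply: (strips_meet_once hT dd si si' sj sj') => //.
  by rewrite (st_run rs ik) (st_run rs jk).
by have [_ ->] := iter_start_inj hT rs rs ik jk xy.
Qed.

Lemma run_inner d r i : is_start T (r, d) -> (0 < i)%N -> (i.+1 < kappa)%N ->
  ~~ is_leaf T (iter i (nx d) r).
Proof.
move=> rs i0 ik; have [_ _ hn _] := start_run hT rs; have /and3P[/= sr _ _] := rs.
apply: (inner_nonleaf (slot_iter_nx wp i sr) (hn i ik)).
by case: i i0 ik => // i _ ik; apply: run_prev => //; exact: ltnW.
Qed.

(* The inner tiles of a run cross distinct runs of the other directions. If there are only
   [kappa - 2] of those, all of them are crossed and nothing is left to cross the last tile. *)
Lemma run_crosses_all d r : is_start T (r, d) ->
  count (fun u : tile * 'I_3 => u.2 != d) starts = kappa.-2 ->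
  is_leaf T (iter kappa.-1 (nx d) r) /\
  forall u, u \in starts -> u.2 != d -> exists i, [/\ (i < kappa.-1)%N,
    (iter i (nx d) r).2 != u.2 & st u.2 (iter i (nx d) r) = u.1].
Proof.
move=> rs cO; have [k1 _ hn _] := start_run hT rs; have /and3P[/= sr _ _] := rs.
pose x i := iter i (nx d) r.
pose O := [seq u : tile * 'I_3 <- starts | u.2 != d].
have sO : size O = kappa.-2 by rewrite size_filter.
have td i : third (x i).2 d != d by apply: third_neqr; case/andP: (slot_iter_nx wp i sr).
have tx i : third (x i).2 d != (x i).2 by apply: third_neql; case/andP: (slot_iter_nx wp i sr).
have inO i : ~~ is_leaf T (x i) -> cross_start (x i) d \in O.
  move=> nl; rewrite mem_filter /= td mem_starts; apply: nonleaf_start => //.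
  by rewrite slotE eq_sym tx andbT; case/andP: (slot_iter_nx wp i sr).
have un n : (n < kappa)%N -> uniq [seq cross_start (x i) d | i <- iota 1 n].
  move=> nk; rewrite map_inj_in_uniq ?iota_uniq // => i j; rewrite !mem_iota => hi hj.
  by apply: (cross_start_inj rs); lia.
split.
  case: (boolP (is_leaf T (iter kappa.-1 (nx d) r))) => // nl; exfalso.
  have sub : {subset [seq cross_start (x i) d | i <- iota 1 kappa.-1] <= O}.
    move=> u /mapP[i]; rewrite mem_iota => hi ->; apply: inO.
    have [E|ne] := eqVneq i kappa.-1; first by rewrite E.
    by apply: run_inner => //; lia.
  have u1 : uniq [seq cross_start (x i) d | i <- iota 1 kappa.-1] by apply: un; lia.
  by have := uniq_leq_size u1 sub; rewrite size_map size_iota sO; lia.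
move=> u us ud.
have sub : {subset [seq cross_start (x i) d | i <- iota 1 kappa.-2] <= O}.
  move=> v /mapP[i]; rewrite mem_iota => hi ->; apply: inO.
  by apply: run_inner => //; lia.
have u2 : uniq [seq cross_start (x i) d | i <- iota 1 kappa.-2] by apply: un; lia.
have sz : (size O <= size [seq cross_start (x i) d | i <- iota 1 kappa.-2])%N.
  by rewrite size_map size_iota sO.
have [_ mm] := uniq_min_size u2 sub sz.
have : u \in O by rewrite mem_filter ud.
rewrite -mm => /mapP[i]; rewrite mem_iota => hi ->.
by exists i; split; [lia|rewrite eq_sym; exact: tx|].
Qed.

(** * The exceptional case: three parallel runs that cross all others *)

Section ThreeParallel.
Variable d : 'I_3.
Hypothesis c3 : nstarts d = 3%N.
Hypothesis cO : count (fun u : tile * 'I_3 => u.2 != d) starts = kappa.-2.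
Hypothesis k5 : (5 <= kappa)%N.

Definition roots := [seq u <- slots T | ~~ hasprev T u.1 u.2].
Lemma mem_roots u : (u \in roots) = slot u.2 u.1 && ~~ hasprev T u.1 u.2.
Proof. by rewrite mem_filter mem_slots andbC. Qed.

(** The tail of the edge shared by the last two tiles of the run. It is also a vertex of the last
    inner tile, which is not a leaf, so potentials of single tiles cannot tell tips apart. *)
Definition tip r := (dedge (iter kappa.-1 (nx d) r) d).1.
Definition parallels := [seq w <- roots | is_start T w && (w.2 == d)].

Lemma mem_parallels w : (w \in parallels) = is_start T w && (w.2 == d).
Proof.
rewrite mem_filter mem_roots; case: (boolP (is_start T w)) => //= /and3P[-> _ ->].
by rewrite !andbT.
Qed.

Lemma size_parallels : size parallels = 3%N.
Proof.
rewrite -[RHS]c3 /nstarts -size_filter; apply/perm_size/uniq_perm.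
- by do 2 apply: filter_uniq; exact: uniq_slots.
- by do 2 apply: filter_uniq; exact: uniq_slots.
- by move=> w; rewrite mem_parallels [in RHS]mem_filter mem_starts andbC.
Qed.

Lemma tip_in r : is_start T (r, d) -> tip r \in vertices (iter kappa.-2 (nx d) r).
Proof.
move=> rs; have [k1 _ hn _] := start_run hT rs; have /and3P[/= sr _ _] := rs.
have kE : kappa.-1 = kappa.-2.+1 by lia.
have hk : (kappa.-2.+1 < kappa)%N by lia.
have [nT n] := nx_nrel (hn _ hk).
rewrite /tip kE iterS -(proj2 (uedge_dedge _ _ _) (eqP n)).
apply: (proj1 (mem_vertices_edge (e := uedge _ d) _)).
rewrite mem_edges eqxx andbT eq_sym; by case/andP: (slot_iter_nx wp kappa.-2 sr).
Qed.

Lemma uniq_roots : uniq roots.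
Proof. by apply: filter_uniq; exact: uniq_slots. Qed.

Lemma tip_V r : is_start T (r, d) -> tip r \in VT T.
Proof.
move=> rs; have /and3P[/= sr _ _] := rs.
exact: (proj1 (dedge_V (slot_iter_nx wp kappa.-1 sr))).
Qed.

Lemma tip_gap x y : is_start T (x, d) -> is_start T (y, d) -> tip y = tip x + dir d ->
  (iter kappa.-1 (nx d) x).2 != (iter kappa.-1 (nx d) y).2 /\
  dir d + delta (iter kappa.-1 (nx d) y).2 == delta (iter kappa.-1 (nx d) x).2.
Proof.
have kE : kappa.-1 = kappa.-2.+1 by lia.
move=> xs ys E; have /and3P[/= sx _ _] := xs; have /and3P[/= sy _ _] := ys.
apply: leaf_gap.
- exact: (slot_iter_nx wp kappa.-1 sx).
- exact: (slot_iter_nx wp kappa.-1 sy).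
- by have [] := run_crosses_all xs cO.
- by have [] := run_crosses_all ys cO.
- by rewrite kE; apply: run_prev => //; lia.
- by rewrite kE; apply: run_prev => //; lia.
- have E' : dn (iter kappa.-1 (nx d) y) + nu d = dn (iter kappa.-1 (nx d) x) + nu d + dir d by exact: E.
  by apply: (addIr (nu d)); rewrite E'; exact: addrAC.
Qed.

Variable H : tile * 'I_3 -> lattice -> int.
Hypothesis hH : forall u, slot u.2 u.1 -> ~~ hasprev T u.1 u.2 -> good_potential T u (H u).
(** Only the three parallel runs contribute differently at different tips, so this sum is the
    position of a tip along [dir d]. *)
Definition rank p : int := \sum_(w <- parallels) H w p.

(** All other terms of [coord_const] agree at the two tips. A crossing run is crossed by both
    parallel runs and has the value given by [crossed_value]; a strip of one tile is a leaf,
    different from both penultimate tiles, so [trivial_const] applies. *)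
Lemma tip_coord r r' : is_start T (r, d) -> is_start T (r', d) ->
  tip r - dir d *~ rank (tip r) = tip r' - dir d *~ rank (tip r').
Proof.
move=> rs rs'.
have [k1 _ hn _] := start_run hT rs; have /and3P[/= sr _ _] := rs.
have [_ _ hn' _] := start_run hT rs'; have /and3P[/= sr' _ _] := rs'.
have := coord_const hT uniq_roots mem_roots hH (tip_V rs) (tip_V rs').
have sumE p : \sum_(w <- roots) dir w.2 *~ H w p = dir d *~ rank p +
    \sum_(w <- roots | ~~ (is_start T w && (w.2 == d))) dir w.2 *~ H w p.
  rewrite (bigID (fun w => is_start T w && (w.2 == d))) /=; congr (_ + _).
  rewrite /rank big_filter mulrz_sumr; apply: eq_bigr => w /andP[_ /eqP ->] //.
rewrite !sumE.
have -> : \sum_(w <- roots | ~~ (is_start T w && (w.2 == d))) dir w.2 *~ H w (tip r) =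
    \sum_(w <- roots | ~~ (is_start T w && (w.2 == d))) dir w.2 *~ H w (tip r').
  rewrite big_seq_cond [RHS]big_seq_cond; apply: eq_bigr => w /andP[].
  rewrite mem_roots => /andP[sw pw] nw; congr (_ *~ _).
  have [hw|hw] := boolP (hasnext T w.1 w.2).
    have ws : is_start T w by rewrite /is_start sw hw pw.
    rewrite ws /= in nw; have win : w \in starts by rewrite mem_starts.
    have [_ cr] := run_crosses_all rs cO; have [i [ik iw iE]] := cr w win nw.
    have [_ cr'] := run_crosses_all rs' cO; have [j [jk jw jE]] := cr' w win nw.
    have n1 m : (m < kappa.-1)%N -> hasnext T (iter m (nx d) r) d.
      by move=> hm; apply: hn; rewrite -ltn_predRL.
    have n2 m : (m < kappa.-1)%N -> hasnext T (iter m (nx d) r') d.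
      by move=> hm; apply: hn'; rewrite -ltn_predRL.
    have v1 : H w (tip r) = (eps d w.2 == 1)%:Z.
      rewrite /tip.
      exact: (@crossed_value _ _ _ hT _ uniq_roots _ hH w d r _ kappa.-1 i sw pw nw sr ik erefl iw iE n1).
    have v2 : H w (tip r') = (eps d w.2 == 1)%:Z.
      rewrite /tip.
      exact: (@crossed_value _ _ _ hT _ uniq_roots _ hH w d r' _ kappa.-1 j sw pw nw sr' jk erefl jw jE n2).
    by rewrite v1 v2.
  have wl : is_leaf T w.1.
    apply/existsP; exists w.2; have /andP[wT wd] := sw.
    by rewrite /leafdir wT eq_sym wd hw pw.
  have ne s : is_start T (s, d) -> iter kappa.-2 (nx d) s != w.1.
    move=> ss; apply/eqP => E; have k0 : (0 < kappa.-2)%N by lia.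
    have kk : (kappa.-2.+1 < kappa)%N by lia.
    by have := run_inner ss k0 kk; rewrite E wl.
  have inT s : slot d s -> iter kappa.-2 (nx d) s \in T.
    by move=> ss; case/andP: (slot_iter_nx wp kappa.-2 ss).
  exact: (trivial_const hT hH sw pw hw (inT r sr) (inT r' sr') (ne r rs) (ne r' rs') (tip_in rs) (tip_in rs')).
by rewrite !opprD !addrA => /addIr.
Qed.

(** Of the three summands, each 0 or 1, the one of the run itself is 0, because the tip is the tail
    of one of its own edges. *)
Lemma tip_range r : is_start T (r, d) -> 0 <= rank (tip r) < 3.
Proof.
move=> rs; have /and3P[/= sr _ np] := rs; have [k1 _ _ _] := start_run hT rs.
have [|a _ c] := @sum01 _ (fun w => H w (tip r)) parallels.
  move=> w; rewrite mem_parallels => /andP[/and3P[sw _ pw] _].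
  have [_ rg _] := hH sw pw; exact: (rg _ (tip_V rs)).
rewrite /rank a /=; have [_ _ z] := @hH (r, d) sr np.
have rin : (r, d) \in parallels by rewrite mem_parallels rs eqxx.
have z0 : H (r, d) (tip r) = 0.
  have st1 : st d (iter kappa.-1 (nx d) r) == r by rewrite (st_run rs) //; lia.
  exact: (proj2 (z _ (slot_iter_nx wp kappa.-1 sr) st1)).
by have := c _ rin z0; rewrite size_parallels.
Qed.

(** Equal ranks make the tips equal; then the last tiles share a downward side, so they coincide,
    and so do the runs. *)
Lemma tip_inj r r' : is_start T (r, d) -> is_start T (r', d) -> rank (tip r) = rank (tip r') -> r = r'.
Proof.
move=> rs rs' E; have := tip_coord rs rs'; rewrite E => /addIr tE.
have /and3P[/= sr _ _] := rs; have /and3P[/= sr' _ _] := rs'; have [k1 _ _ _] := start_run hT rs.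
have dE : iter kappa.-1 (nx d) r = iter kappa.-1 (nx d) r'.
  apply: (@dedge_eq _ _ _ hT _ _ d).
  - by case/andP: (slot_iter_nx wp kappa.-1 sr).
  - by case/andP: (slot_iter_nx wp kappa.-1 sr').
  - by rewrite [LHS]surjective_pairing [RHS]surjective_pairing; congr pair; exact: tE.
have kk : (kappa.-1 < kappa)%N by lia.
by have [] := iter_start_inj hT rs rs' kk kk dE.
Qed.

Lemma tip_ex m : 0 <= m < 3 -> exists2 r, is_start T (r, d) & rank (tip r) = m.
Proof.
move=> hm; have up_ : uniq parallels by apply: filter_uniq; exact: uniq_roots.
have mp := mem_parallels; move: size_parallels up_ mp.
case: parallels => [|[r1 d1] [|[r2 d2] [|[r3 d3] [|]]]] // _ up_ mp.
have /andP[s1 /eqP /= e1] : is_start T (r1, d1) && (d1 == d) by have := mp (r1, d1); rewrite !inE eqxx => <-.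
have /andP[s2 /eqP /= e2] : is_start T (r2, d2) && (d2 == d) by have := mp (r2, d2); rewrite !inE eqxx orbT => <-.
have /andP[s3 /eqP /= e3] : is_start T (r3, d3) && (d3 == d) by have := mp (r3, d3); rewrite !inE eqxx !orbT => <-.
rewrite {}e1 in s1 up_ mp; rewrite {}e2 in s2 up_ mp; rewrite {}e3 in s3 up_ mp.
have n12 : rank (tip r1) <> rank (tip r2).
  by move=> /(tip_inj s1 s2) E; move: up_; rewrite E /= inE eqxx.
have n13 : rank (tip r1) <> rank (tip r3).
  by move=> /(tip_inj s1 s3) E; move: up_; rewrite E /= !inE eqxx orbT.
have n23 : rank (tip r2) <> rank (tip r3).
  by move=> /(tip_inj s2 s3) E; move: up_; rewrite E /= !inE eqxx /= andbF.
have R1 := tip_range s1; have R2 := tip_range s2; have R3 := tip_range s3.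
have [E|[E|E]] : rank (tip r1) = m \/ rank (tip r2) = m \/ rank (tip r3) = m by lia.
- by exists r1.
- by exists r2.
- by exists r3.
Qed.

(** Ranks 0, 1, 2 put the three end leaves on consecutive collinear edges. By [leaf_gap] the class
    changes twice in the same sense, but only two classes are available. *)
Lemma three_parallel_potential : False.
Proof.
have [|a as_ na] := tip_ex (m := 0); first by [].
have [|b bs nb] := tip_ex (m := 1); first by [].
have [|c cs nc] := tip_ex (m := 2); first by [].
have tb : tip b = tip a + dir d.
  by have := tip_coord bs as_; rewrite na nb mulr1z mulr0z subr0 => <-; rewrite subrK.
have tc : tip c = tip b + dir d.
  have := tip_coord cs bs; rewrite nb nc mulr1z => E.
  have F : tip c = tip b - dir d + dir d *~ 2 by rewrite -E subrK.
  by rewrite F dir_mulz2 [LHS]addrA subrK.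
have [g1 g2] := tip_gap as_ bs tb; have [g3 g4] := tip_gap bs cs tc.
have nd x : is_start T (x, d) -> (iter kappa.-1 (nx d) x).2 != d.
  by move=> xs; have /and3P[/= sx _ _] := xs; case/andP: (slot_iter_nx wp kappa.-1 sx).
exact: (dir_delta3 (nd a as_) (nd b bs) (nd c cs) g1 g3 g2 g4).
Qed.
End ThreeParallel.

Lemma three_parallel_absurd d : nstarts d = 3%N ->
  count (fun u : tile * 'I_3 => u.2 != d) starts = kappa.-2 -> (5 <= kappa)%N -> False.
Proof.
by move=> c3 cO k5; have [H hH] := potentials hT; exact: (three_parallel_potential c3 cO k5 hH).
Qed.

Lemma tiling_bounds : (5 <= kappa)%N ->
  [/\ (3 * (kappa * kappa) <= 4 * #|` T| + 3)%N, (kappa * size starts <= 2 * #|` T|)%N &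
      (2 * #|` T| <= (kappa + 1) * size starts + 3)%N].
Proof.
move=> k5; have A := double_tiles; have B := leaves_le; have C := core_le.
split; [|by lia|by rewrite A mulnDl mul1n -addnA leq_add2l].
have t0 : (0 < #|` T|)%N by rewrite cardfs_gt0; case: (doku_adjacent_connected hT).
have lt : (size (leaves T) <= #|` T|)%N by rewrite size_filter count_size.
rewrite size_starts in A B.
have nz e : count (fun u : tile * 'I_3 => u.2 != e) starts = (size starts - nstarts e)%N.
  by rewrite -(count_predC (fun u : tile * 'I_3 => u.2 == e)) addKn.
have [//|[k6 cs]] := tiling_arith k5 t0 lt A B C; exfalso.
(* The two other directions have 4 runs together, which is [kappa - 2] for [kappa = 6]. *)
case: cs => -[h1 h2]; apply: (three_parallel_absurd h1 _ k5); rewrite nz size_starts k6; lia.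
Qed.

Lemma card_runs rho : (runs T #= `I_rho)%card -> rho = size starts.
Proof.
have us : uniq starts by apply: filter_uniq; exact: uniq_slots.
rewrite (runsE hT) (card_eql (inj_card_eq (run_of_inj hT))) (card_eql (card_uniq_seq us)).
by move/card_eq_II.
Qed.
End Counting.

Theorem theorem3 (R : realType) (kappa : nat) (T : {fset tile}) (tau rho : nat)
    (hkappa : (5 <= kappa)%N)
    (hT : doku_tiling R kappa T)
    (htau : tau = #|` T|)
    (hrho : (runs T #= `I_rho)%card) :
  Num.max (Num.ceil (3 * (kappa%:R ^+ 2 - 1) / 4 : rat))
          (Num.ceil (kappa%:R * rho%:R / 2 : rat)) <= tau%:Z
    <= Num.floor (((kappa%:R + 1) * rho%:R + 3) / 2 : rat).
Proof.
have rhoE := card_runs hT hrho; have [] := tiling_bounds hT hkappa.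
rewrite -htau -rhoE -!(ler_nat rat) !natrD !natrM !natrD => b1 b2 b3.
rewrite ge_max !ceil_le_int floor_ge_int -pmulrn.
apply/andP; split; [apply/andP; split|].
- by rewrite ler_pdivrMr // expr2; lra.
- by rewrite ler_pdivrMr //; lra.
- by rewrite ler_pdivlMr //; lra.
Qed.
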